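(* Let $X=(X_t)_{t\ge0}$, $X_0=0$, be a real-valued càdlàg Lévy process with canonical triplet $(\gamma,0,\Pi_X)$. Assume $X$ is in the domain of attraction of a stable law at $0$ (resp. at $\infty$) with non-stochastic centering and norming functions $a_t\in\mathbb{R}$, $b_t>0$, i.e. $(X_t-a_t)/b_t\to Y$ in distribution as $t\downarrow0$ (resp. $t\to\infty$) for an a.s. finite, non-degenerate, non-normal random variable $Y$, and that moreover $\mathcal{I}_t:=\big((X_{\tau t}-\tau a_t)/b_t\big)_{0\le\tau\le1}\to\mathcal{Y}=(Y_\tau)_{0\le\tau\le1}$ weakly in $\mathbb{D}$ with the $J_1$-topology as $t\downarrow0$ (resp. $t\to\infty$), where $\mathcal{Y}$ is a stable$(\alpha)$ Lévy process, $\alpha\in(0,2)$, with $Y_1\overset{D}{=}Y$, canonical triplet $(0,0,\Pi_Y)$ and $\overline{\Pi}_Y(x)=\Pi_Y(\mathbb{R}\setminus[-x,x])=cx^{-\alpha}$, $x>0$, for some $c>0$. Then, with the same $a_t,b_t$, and convergence in distribution in $\mathbb{D}$ with the $J_1$-topology as $t\downarrow0$ (resp. $t\to\infty$): (i) if $\overline{\Pi}^+_X(0+)=\infty$ and $r\in\mathbb{N}$, then $\big(({}^{(r)}X^R_{\tau t}-\tau a_t)/b_t\big)_{0\le\tau\le1}\to{}^{(r)}\mathcal{Y}^R:=\mathcal{R}^{(r)}_{trim}(\mathcal{Y})$; (ii) if $\overline{\Pi}^+_X(0+)=\overline{\Pi}^-_X(0+)=\infty$ and $r,s\in\mathbb{N}_0$,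 then $\big(({}^{(r,s)}X_{\tau t}-\tau a_t)/b_t\big)_{0\le\tau\le1}\to{}^{(r,s)}\mathcal{Y}:=\mathcal{T}^{(r,s)}_{rim}(\mathcal{Y})$; (iii) if $\overline{\Pi}_X(0+)=\infty$ and $r\in\mathbb{N}$, then $\big(({}^{(r)}\widetilde X_{\tau t}-\tau a_t)/b_t\big)_{0\le\tau\le1}\to{}^{(r)}\widetilde{\mathcal{Y}}:=\mathfrak{T}^{(r)}_{rim}(\mathcal{Y})$.
   Context: $\mathbb{D}=\mathbb{D}([0,1],\mathbb{R})$ is the space of càdlàg functions on $[0,1]$ with the Skorokhod $J_1$-topology. Tails of the Lévy measure: $\overline{\Pi}^+_X(x)=\Pi_X((x,\infty))$, $\overline{\Pi}^-_X(x)=\Pi_X((-\infty,-x))$, $\overline{\Pi}_X=\overline{\Pi}^+_X+\overline{\Pi}^-_X$. For $x\in\mathbb{D}$, $\Delta x(\tau)=x(\tau)-x(\tau-)$ ($\tau>0$), $\Delta x(0)=0$. Operators on $\mathbb{D}$: $\mathcal{S}_{\pm\Delta}(x)(\tau)=\sup_{0\le s\le\tau}\Delta(\pm x)(s)$; $\mathcal{T}^{(0,\pm)}_{rim}(x)=x$, $\mathcal{T}^{(1,\pm)}_{rim}(x)=x\mp\mathcal{S}_{\pm\Delta}(x)$, $\mathcal{T}^{(r,\pm)}_{rim}=\mathcal{T}^{(1,\pm)}_{rim}\circ\mathcal{T}^{(r-1,\pm)}_{rim}$; $\mathcal{T}^{(r,s)}_{rim}=\mathcal{T}^{(r,+)}_{rim}\circ\mathcal{T}^{(s,-)}_{rim}$.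 Record trimming: $R_1(x)=\inf\{s\in[0,1]:\Delta x(s)=\mathcal{S}_{+\Delta}(x)(1)\}$, $\mathcal{R}_{trim}(x)=x-\Delta x(R_1(x))\mathbf{1}_{[R_1(x),1]}$, $\mathcal{R}^{(r)}_{trim}=\mathcal{R}_{trim}\circ\mathcal{R}^{(r-1)}_{trim}$, $\mathcal{R}^{(0)}_{trim}(x)=x$. Signed modulus trimming: $\widetilde L_\tau(x)=\sup\{s\in[0,\tau]:|\Delta x(s)|=\sup_{0\le u\le\tau}|\Delta x(u)|\}$, $\mathfrak{T}_{rim}(x)(\tau)=x(\tau)-\Delta x(\widetilde L_\tau(x))$, $\mathfrak{T}^{(r)}_{rim}=\mathfrak{T}_{rim}\circ\mathfrak{T}^{(r-1)}_{rim}$, $\mathfrak{T}^{(0)}_{rim}(x)=x$. Trimmed processes of $X$ (for fixed $t>0$, as processes in $\tau\in[0,1]$): the lookback trimmed path $({}^{(r)}X^R_{t\tau})_{\tau\in[0,1]}=\mathcal{R}^{(r)}_{trim}\big((X_{t\tau})_{\tau\in[0,1]}\big)$; the asymmetrically trimmed process ${}^{(r,s)}X_{t\tau}=X_{t\tau}-\sum_{i=1}^r\Delta X^{(i)}_{t\tau}+\sum_{j=1}^s\Delta X^{(j),-}_{t\tau}$, where $\Delta X^{(i)}_u$ is the $i$-th largest positive jump of $X$ on $(0,u]$ and $\Delta X^{(j),-}_u$ the $j$-th largest magnitude of a negative jump on $(0,u]$, so that $({}^{(r,s)}X_{t\tau})_{\tau}=\mathcal{T}^{(r,s)}_{rim}\big((X_{t\tau})_\tau\big)$;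 the modulus trimmed process ${}^{(r)}\widetilde X_{t\tau}=X_{t\tau}-\sum_{i=1}^r\widetilde{\Delta X}^{(i)}_{t\tau}$, where $\widetilde{\Delta X}^{(i)}_u$ is the $i$-th largest jump in modulus on $(0,u]$ carrying the sign of the latest such jump, i.e. $({}^{(r)}\widetilde X_{t\tau})_\tau=\mathfrak{T}^{(r)}_{rim}\big((X_{t\tau})_\tau\big)$. *)

(* Defs.v *)
From HB Require Import structures.
From mathcomp Require Import all_boot all_order all_algebra.
From mathcomp Require Import all_classical all_reals all_analysis.
Set Implicit Arguments. Unset Strict Implicit. Unset Printing Implicit Defensive.
Import Order.TTheory GRing.Theory Num.Theory.
Import numFieldNormedType.Exports.
Local Open Scope classical_set_scope.
Local Open Scope ring_scope.

Section Defs.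
Variable R : realType.

(* cadlag on [0,1] (paths of D([0,1],R) are represented by functions R -> R,
   only their values on [0,1] matter) *)
Definition cadlag01 (x : R -> R) : Prop :=
  (forall s, 0 <= s < 1 -> x u @[u --> s^'+] --> x s) /\
  (forall s, 0 < s <= 1 -> cvg (x u @[u --> s^'-])).

Definition cadlag_pos (x : R -> R) : Prop :=
  (forall s, 0 <= s -> x u @[u --> s^'+] --> x s) /\
  (forall s, 0 < s -> cvg (x u @[u --> s^'-])).

Definition jump (x : R -> R) (s : R) : R :=
  if s <= 0 then 0 else x s - lim (x u @[u --> s^'-]).

Definition time_change (lam : R -> R) : Prop :=
  [/\ lam 0 = 0, lam 1 = 1,
      {within `[0, 1], continuous lam} &
      (forall s u, 0 <= s -> s < u -> u <= 1 -> lam s < lam u)].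

Definition J1_cvg (u : nat -> R -> R) (x : R -> R) : Prop :=
  forall e : R, 0 < e -> \forall n \near \oo,
    exists lam, time_change lam /\
      (forall s, 0 <= s <= 1 ->
         `|lam s - s| <= e /\ `|u n (lam s) - x s| <= e).

(* g : D -> R is continuous for the J1 topology (D is metrizable, so
   sequential continuity is continuity) *)
Definition J1_continuous (g : (R -> R) -> R) : Prop :=
  forall (u : nat -> R -> R) (x : R -> R),
    (forall n, cadlag01 (u n)) -> cadlag01 x -> J1_cvg u x ->
    g (u n) @[n --> \oo] --> g x.

Definition bounded_fun_D (g : (R -> R) -> R) : Prop :=
  exists M : R, forall x, `|g x| <= M.

Definition S_pos (x : R -> R) (tau : R) : R := sup (jump x @` `[0, tau]).
Definition S_neg (x : R -> R) (tau : R) : R :=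
  sup (jump (fun u => - x u) @` `[0, tau]).

Definition T1p (x : R -> R) : R -> R := fun tau => x tau - S_pos x tau.
Definition T1n (x : R -> R) : R -> R := fun tau => x tau + S_neg x tau.
Definition Trim_p (r : nat) : (R -> R) -> R -> R := iter r T1p.
Definition Trim_n (s : nat) : (R -> R) -> R -> R := iter s T1n.
Definition Trim_rs (r s : nat) (x : R -> R) : R -> R := Trim_p r (Trim_n s x).

Definition R1 (x : R -> R) : R :=
  inf [set s | 0 <= s <= 1 /\ jump x s = S_pos x 1].
Definition Rtrim1 (x : R -> R) : R -> R :=
  fun tau => x tau - (if R1 x <= tau <= 1 then jump x (R1 x) else 0).
Definition Rtrim (r : nat) : (R -> R) -> R -> R := iter r Rtrim1.

Definition Ltilde (x : R -> R) (tau : R) : R :=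
  sup [set s | 0 <= s <= tau /\
         `|jump x s| = sup ((fun u => `|jump x u|) @` `[0, tau])].
Definition Mtrim1 (x : R -> R) : R -> R :=
  fun tau => x tau - jump x (Ltilde x tau).
Definition Mtrim (r : nat) : (R -> R) -> R -> R := iter r Mtrim1.

Context {d : measure_display} {Omega : measurableType d}.

Definition same_law {d' : measure_display} {Omega' : measurableType d'}
  (P : probability Omega R) (Z : Omega -> R)
  (P' : probability Omega' R) (Z' : Omega' -> R) : Prop :=
  forall B : set R, measurable B -> P (Z @^-1` B) = P' (Z' @^-1` B).

Definition indep_RVs (P : probability Omega R) (n : nat)
  (Z : 'I_n -> Omega -> R) : Prop :=
  forall B : 'I_n -> set R, (forall i, measurable (B i)) ->
    fine (P (\bigcap_(i in setT) (Z i @^-1` B i))) =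
    \prod_(i < n) fine (P (Z i @^-1` B i)).

Definition levy_process (P : probability Omega R) (X : R -> Omega -> R) : Prop :=
  [/\ (forall t, measurable_fun setT (X t)),
      (forall w, X 0 w = 0),
      (forall w, cadlag_pos (fun t => X t w)),
      (forall (n : nat) (t : nat -> R), 0 <= t 0%N -> (forall i, t i <= t i.+1) ->
         indep_RVs P (fun i : 'I_n => fun w => X (t i.+1) w - X (t i) w)) &
      (forall s t, 0 <= s -> 0 <= t ->
         same_law P (fun w => X (t + s) w - X s w) P (X t))].

Definition levy_measure (Pi : {measure set R -> \bar R}) : Prop :=
  Pi [set 0] = 0%E /\
  (\int[Pi]_x (Num.min 1 (x ^+ 2))%:E < +oo)%E.

(* X has canonical (Levy-Khintchine) triplet (gamma, sigma2, Pi), with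
   truncation function 1_{|x| <= 1}:
   E e^{i theta X_t} = exp(t Psi(theta)),
   Psi(theta) = i gamma theta - sigma2 theta^2/2
                + \int (e^{i theta x} - 1 - i theta x 1_{|x|<=1}) Pi(dx),
   written out via real and imaginary parts. *)
Definition has_triplet (P : probability Omega R) (X : R -> Omega -> R)
  (gamma sigma2 : R) (Pi : {measure set R -> \bar R}) : Prop :=
  levy_measure Pi /\
  forall t theta : R, 0 <= t ->
    let RePsi := - (sigma2 * theta ^+ 2) / 2 +
                 Rintegral Pi setT (fun x => cos (theta * x) - 1) in
    let ImPsi := gamma * theta +
                 Rintegral Pi setT (fun x => sin (theta * x)
                                     - (if `|x| <= 1 then theta * x else 0)) in
    Rintegral P setT (fun w => cos (theta * X t w)) = expR (t * RePsi) * cos (t * ImPsi) /\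
    Rintegral P setT (fun w => sin (theta * X t w)) = expR (t * RePsi) * sin (t * ImPsi).

Definition stable_levy (alpha : R) (P : probability Omega R)
  (Y : R -> Omega -> R) : Prop :=
  forall a : R, 0 < a -> exists da : R,
    same_law P (Y a) P (fun w => a `^ (alpha^-1) * Y 1 w + da).

End Defs.

Definition tail_pos {R : realType} (Pi : {measure set R -> \bar R}) (x : R) : \bar R :=
  Pi `]x, +oo[%classic.
Definition tail_neg {R : realType} (Pi : {measure set R -> \bar R}) (x : R) : \bar R :=
  Pi `]-oo, - x[%classic.
Definition tail {R : realType} (Pi : {measure set R -> \bar R}) (x : R) : \bar R :=
  (tail_pos Pi x + tail_neg Pi x)%E.

Definition time_lim {R : realType} (at0 : bool) : set_system R :=
  if at0 then (0:R)^'+ else +oo.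

Definition cvg_dist {R : realType} (at0 : bool)
  {d : measure_display} {Omega : measurableType d} (P : probability Omega R)
  (Z : R -> Omega -> R)
  {d' : measure_display} {Omega' : measurableType d'} (P' : probability Omega' R)
  (W : Omega' -> R) : Prop :=
  forall g : R -> R, continuous g -> (exists M : R, forall y, `|g y| <= M) ->
    (\int[P]_w (g (Z t w))%:E)%E @[t --> time_lim at0] -->
    (\int[P']_w (g (W w))%:E)%E.

Definition cvg_dist_J1 {R : realType} (at0 : bool)
  {d : measure_display} {Omega : measurableType d} (P : probability Omega R)
  (Z : R -> Omega -> R -> R)
  {d' : measure_display} {Omega' : measurableType d'} (P' : probability Omega' R)
  (W : Omega' -> R -> R) : Prop :=
  forall g : (R -> R) -> R, J1_continuous g -> bounded_fun_D g ->
    (\int[P]_w (g (Z t w))%:E)%E @[t --> time_lim at0] -->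
    (\int[P']_w (g (W w))%:E)%E.

(* Main.v *)
(* Trimming commutes with affine changes of the path, so each trimmed and
   normalized process is the image of the normalized process I_t under the
   trimming operator.  The running-supremum operators are Lipschitz for the J1
   topology, which gives (ii).  The record and signed-modulus operators are J1
   continuous only at paths whose nonzero jumps have pairwise distinct moduli, a
   property that both operators preserve; (i) and (iii) follow from the
   continuous mapping theorem once the stable limit has this property almost
   surely.  The mapping theorem sandwiches a bounded functional between J1
   Lipschitz functionals; these are measurable along the process because a
   cadlag path is the J1 limit of countably many quantized step paths.  Ties are
   excluded without the Levy-Ito decomposition: if jumps of one fixed modulus had
   positive probability then, by scaling, so would jumps of infinitely many
   moduli bounded away from 0, uniformly; hence the increments over a grid of
   mesh 1/N fall near a given level at rate o(1) per unit time, and independence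
   of two increments makes near ties improbable. *)
Require Import Defs.
From HB Require Import structures.
From mathcomp Require Import all_boot all_order all_algebra.
From mathcomp Require Import all_classical all_reals all_analysis.
From mathcomp Require Import measurable_realfun ring lra.
Import Order.TTheory GRing.Theory Num.Theory.
Import numFieldNormedType.Exports.
Local Open Scope classical_set_scope.
Local Open Scope ring_scope.
Set Implicit Arguments.
Unset Strict Implicit.

(** * Cadlag paths and their jumps *)

(** Stability is available only up to a shift depending on the time scale. Comparing cells of length
    [a / N] and [1 / N] removes it: both increments are small with probability above 2/3, so the
    relative shift tends to 0. The infinitely many levels must be met by one path, since it is
    within a single cadlag path that large jumps are finitely many; for [a] in []1/2, 1]] the jumps
    of [u |-> Y (u * a)] are jumps of [Y] itself, and the levels [scale a * v] are distinct. A rate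
    o(1) suffices by the following count: over at most [N ^ 2] ordered pairs of cells, with the
    moduli above [eta] cut into strips, a near tie has probability at most [N ^ 2] times the sum
    over strips of (mass of the strip) times (mass near its level), hence at most [kappa] times the
    bounded quantity [N * mu N (modulus_ge eta)], with [kappa] arbitrary. The test functionals are
    not assumed measurable, so before the limit the mapping argument relies only on monotonicity of
    the integral; measurability is established for the envelopes along the limit process. *)

Section OneSidedLimits.
Context {R : realType}.
Implicit Types (x : R -> R) (s l e r : R).

Lemma right_cvgP x s l :
  x u @[u --> s^'+] --> l <->
  (forall e, 0 < e -> exists2 r, 0 < r &
     forall u, s < u -> u < s + r -> `|x u - l| <= e).
Proof.
split.
  move=> /cvgrPdist_le h e e0; have [r /= r0 hr] := h e e0.
  exists r => // u su ur; rewrite distrC; apply: hr => //=.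
  by rewrite distrC ger0_norm; lra.
move=> h; apply/cvgrPdist_le => e e0; have [r r0 hr] := h e e0.
exists r => //= u /= du su; rewrite distrC; apply: hr => //.
by move: du; rewrite distrC ger0_norm; lra.
Qed.

Lemma left_cvgP x s l :
  x u @[u --> s^'-] --> l <->
  (forall e, 0 < e -> exists2 r, 0 < r &
     forall u, s - r < u -> u < s -> `|x u - l| <= e).
Proof.
split.
  move=> /cvgrPdist_le h e e0; have [r /= r0 hr] := h e e0.
  exists r => // u su ur; rewrite distrC; apply: hr => //=.
  by rewrite ger0_norm; lra.
move=> h; apply/cvgrPdist_le => e e0; have [r r0 hr] := h e e0.
exists r => //= u /= du su; rewrite distrC; apply: hr => //.
by move: du; rewrite ger0_norm; lra.
Qed.

Lemma left_cauchy_cvg x s :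
  (forall e, 0 < e -> exists2 r, 0 < r &
     forall u v, s - r < u -> u < s -> s - r < v -> v < s -> `|x u - x v| <= e) ->
  cvg (x u @[u --> s^'-]).
Proof.
move=> h; apply/cauchy_cvgP; apply: cauchy_exP => e e0.
have e20 : 0 < e / 2 by lra.
have [r r0 hr] := h _ e20; exists (x (s - r / 2)).
exists r => //= u /= du us; move: du; rewrite ger0_norm; last by lra.
move=> du; rewrite -ball_normE /=; apply: le_lt_trans (hr _ _ _ _ _ _) _; lra.
Qed.

End OneSidedLimits.

Section Cadlag.
Context {R : realType}.
Implicit Types (x y : R -> R) (s u t e r : R) (ts : seq R).

Definition separated ts s u := exists2 t, t \in ts & s < t <= u.

(* [x] oscillates by at most [e] on each of the cells [t_i, t_(i+1)) cut out
   by the points of [ts]; [ts] need not be sorted. *)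
Definition osc_le x e ts :=
  forall s u, 0 <= s -> s <= u -> u <= 1 -> ~ separated ts s u -> `|x s - x u| <= e.

(** Let [c] be the supremum of the times up to which a finite partition exists. The left limit at
    [c] shows that [c] is itself reached, and right continuity would carry the partition past any
    [c < 1]. *)
Lemma cadlag01_osc x : cadlag01 x -> forall e, 0 < e -> exists ts, osc_le x e ts.
Proof.
move=> [xr xl] e e0.
pose A := [set t | 0 <= t <= 1 /\ exists ts, forall s u, 0 <= s -> s <= u ->
   u <= t -> ~ separated ts s u -> `|x s - x u| <= e].
have A0 : A 0.
  split; first by lra.
  exists [::] => s u s0 su u0 _; have -> : s = u by lra.
  by rewrite subrr normr0 ltW.
have e20 : 0 < e / 2 by lra.
have ubA : has_ubound A by exists 1 => t [/andP[]].
have hsA : has_sup A by split; first exists 0.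
set c := sup A.
have c0 : 0 <= c by apply: ub_le_sup.
have c1 : c <= 1 by apply: ge_sup; [exists 0 | move=> t [/andP[]]].
have Ac : A c.
  have [->//|cn0] := eqVneq c 0.
  have cp : 0 < c by lra.
  have /xl : 0 < c <= 1 by lra.
  move=> /left_cvgP /(_ _ e20)[r r0 hr].
  have [t [t01 [ts hts]] tc] := sup_adherent r0 hsA.
  have tlec : t <= c by apply: ub_le_sup => //; split => //; exists ts.
  split; first by lra.
  (* [t] lies within [r] of [c], so on [[t, c)] the path stays within [e / 2] of its left limit at
     [c]; the point [c] starts a cell of its own. *)
  exists (t :: c :: ts) => s u s0 su uc nsep.
  have [ut|ut] := leP u t.
    apply: hts => // -[v vts hv]; apply: nsep; exists v => //.
    by rewrite !inE vts !orbT.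
  have [ec|uc'] := eqVneq u c.
    have [->|nsc] := eqVneq s u; first by rewrite subrr normr0 ltW.
    by exfalso; apply: nsep; exists c; rewrite ?inE ?eqxx ?orbT//; lra.
  have [st|ts'] := ltP s t.
    by exfalso; apply: nsep; exists t; rewrite ?inE ?eqxx ?orbT//; lra.
  have uc2 : u < c by lra.
  have h1 := hr u ltac:(rewrite /c in tc *; lra) uc2.
  have h2 := hr s ltac:(rewrite /c in tc *; lra) ltac:(lra).
  rewrite !ler_norml in h1 h2 *; lra.
have [c1' | c1'] := eqVneq c 1.
  case: Ac => _ [ts hts]; exists ts => s u s0 su u1 ns.
  by apply: hts => //; rewrite c1'.
exfalso.
have clt1 : c < 1 by lra.
have /xr : 0 <= c < 1 by lra.
move=> /right_cvgP /(_ _ e20)[r r0 hr].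
case: Ac => _ [ts hts].
have [r' r'0 [r'r r'1]] : exists2 r', 0 < r' & r' < r /\ c + r' <= 1.
  have [h|h] := leP (c + r / 2) 1; first by exists (r / 2); lra.
  by exists (1 - c); lra.
have : A (c + r').
  split; first by lra.
  exists (c :: ts) => s u s0 su ur nsep.
  have [uc|cu] := leP u c.
    apply: hts => // -[v vts hv]; apply: nsep; exists v => //.
    by rewrite !inE vts !orbT.
  have [sc|cs] := ltP s c.
    by exfalso; apply: nsep; exists c; rewrite ?inE ?eqxx ?orbT//; lra.
  have h1 := hr u cu ltac:(lra).
  have h2 : `|x s - x c| <= e / 2.
    have [->|nsc] := eqVneq s c; first by rewrite subrr normr0 ltW.
    by apply: hr; lra.
  rewrite !ler_norml in h1 h2 *; lra.
move=> /(ub_le_sup ubA); rewrite -/c; lra.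
Qed.

Lemma separated_right ts s : exists2 r, 0 < r & forall u, u < s + r -> ~ separated ts s u.
Proof.
elim: ts => [|t ts [r r0 hr]]; first by exists 1 => // u _ [].
have [st|ts'] := ltP s t.
  have [rt|tr] := leP r (t - s).
    exists r => // u us [v]; rewrite inE => /orP[/eqP ->|vts] hv; first by lra.
    by apply: (hr u us); exists v.
  exists (t - s) => [|u us [v]]; first by lra.
  rewrite inE => /orP[/eqP ->|vts] hv; first by lra.
  by apply: (hr u); [lra|exists v].
exists r => // u us [v]; rewrite inE => /orP[/eqP ->|vts] hv; first by lra.
by apply: (hr u us); exists v.
Qed.

(** Both times stay strictly below [s], so [s] itself may be a partition point. *)
Lemma separated_left ts s : exists2 r, 0 < r &
  forall u v, s - r < u -> v < s -> ~ separated ts u v.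
Proof.
elim: ts => [|t ts [r r0 hr]]; first by exists 1 => // u v _ _ [].
have [st|ts'] := ltP t s.
  have [rt|tr] := leP r (s - t).
    exists r => // u w us sw [v]; rewrite inE => /orP[/eqP ->|vts] hv; first by lra.
    by apply: (hr u w us sw); exists v.
  exists (s - t) => [|u w us sw [v]]; first by lra.
  rewrite inE => /orP[/eqP ->|vts] hv; first by lra.
  by apply: (hr u w _ sw); [lra|exists v].
exists r => // u w us sw [v]; rewrite inE => /orP[/eqP ->|vts] hv; first by lra.
by apply: (hr u w us sw); exists v.
Qed.

(** This converse lets a trimmed path be shown cadlag by exhibiting a partition for it, without
    computing its one-sided limits. *)
Lemma osc_cadlag01 x : (forall e, 0 < e -> exists ts, osc_le x e ts) -> cadlag01 x.
Proof.
move=> h; split=> s s01.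
  apply/right_cvgP => e e0; have [ts hts] := h e e0.
  have [r r0 hr] := separated_right ts s.
  have [r' r'0 [r'r r'1]] : exists2 r', 0 < r' & r' <= r /\ s + r' <= 1.
    have [h1|h1] := leP (s + r) 1; first by exists r; lra.
    by exists (1 - s); lra.
  exists r' => // u su ur; rewrite distrC; apply: hts; [lra|lra|lra|].
  by apply: hr; lra.
apply: left_cauchy_cvg => e e0; have [ts hts] := h e e0.
have [r r0 hr] := separated_left ts s.
have [r' r'0 [r'r r'1]] : exists2 r', 0 < r' & r' <= r /\ 0 <= s - r'.
  have [h1|h1] := leP 0 (s - r); first by exists r; lra.
  by exists s; lra.
exists r' => // u v ur us vr vs.
have [uv|vu] := leP u v; first by apply: hts; [lra|lra|lra|apply: hr; lra].
by rewrite distrC; apply: hts; [lra|lra|lra|apply: hr; lra].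
Qed.

Lemma cadlag01P x : cadlag01 x <-> (forall e, 0 < e -> exists ts, osc_le x e ts).
Proof. by split; [exact: cadlag01_osc|exact: osc_cadlag01]. Qed.

Lemma exists_left_of s r r' : 0 < s -> 0 < r -> 0 < r' ->
  exists u, [&& 0 < u, u < s, s - r < u & s - r' < u].
Proof.
move=> s0 r0 r'0; pose m := Num.max 0 (Num.max (s - r) (s - r')).
have ms : m < s by rewrite !gt_max s0 !ltrBlDr !ltrDl r0.
have mu : m < (m + s) / 2 by lra.
exists ((m + s) / 2); apply/and4P; split; first 1 last; first by lra.
- by apply: le_lt_trans mu; rewrite /m !le_max lexx orbT.
- by apply: le_lt_trans mu; rewrite /m !le_max lexx !orbT.
- by apply: le_lt_trans mu; rewrite /m !le_max lexx.
Qed.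

Lemma jump0 x s : s <= 0 -> jump x s = 0.
Proof. by rewrite /jump => ->. Qed.

Lemma jump_left_cvg x s : cadlag01 x -> 0 < s <= 1 ->
  x u @[u --> s^'-] --> x s - jump x s.
Proof.
move=> [_ xl] s01; rewrite /jump ifN; last by rewrite -ltNge; case/andP: s01.
by rewrite opprB addrC subrK; exact: xl.
Qed.

Lemma jump_leftP x s : cadlag01 x -> 0 < s <= 1 -> forall e, 0 < e ->
  exists2 r, 0 < r & forall u, s - r < u -> u < s -> `|x s - x u - jump x s| <= e.
Proof.
move=> cx s01 e e0; have /left_cvgP/(_ e e0)[r r0 hr] := jump_left_cvg cx s01.
exists r => // u ru us; have := hr u ru us; rewrite distrC.
by rewrite (_ : x s - jump x s - x u = x s - x u - jump x s)//; ring.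
Qed.

Lemma jump_eqP x s j : 0 < s ->
  (forall e, 0 < e -> exists2 r, 0 < r &
    forall u, s - r < u -> u < s -> `|x s - x u - j| <= e) -> jump x s = j.
Proof.
move=> s0 h; rewrite /jump ifN; last by rewrite -ltNge.
have {}h : x u @[u --> s^'-] --> x s - j; last first.
  by rewrite (cvg_lim (@norm_hausdorff _ _) h); lra.
apply/left_cvgP => e e0; have [r r0 hr] := h e e0; exists r => // u ru us.
rewrite distrC (_ : x s - j - x u = x s - x u - j); last by ring.
exact: hr.
Qed.

(** Off the partition, the points just left of [s] share the cell of [s]. Hence all jumps exceeding
    [e] sit at the finitely many partition points. *)
Lemma jump_osc x e ts s : cadlag01 x -> osc_le x e ts -> 0 <= s <= 1 ->
  s \notin ts -> `|jump x s| <= e.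
Proof.
move=> cx hts s01 sts; have [s0|s0] := leP s 0.
  rewrite jump0// normr0; have := hts 0 0; rewrite subrr normr0; apply=> //.
  by case=> t _; lra.
apply/ler_addgt0Pr => d d0.
have s01' : 0 < s <= 1 by rewrite s0; case/andP: s01.
have [r r0 hr] := jump_leftP cx s01' d0.
have [r' r'0 hr'] := separated_left ts s.
have [u /and4P[u0 u1 u2 u3]] := exists_left_of s0 r0 r'0.
have h1 := hr u u2 u1.
have h2 : `|x u - x s| <= e.
  apply: hts; [lra|lra|lra|] => -[t tts /andP[t1 t2]].
  have [ts'|] := ltP t s; first by apply: (hr' u t u3 ts'); exists t => //; lra.
  by move=> st; have ets : t = s; [lra | move: sts; rewrite -ets tts].
rewrite !ler_norml in h1 h2 *; lra.
Qed.

End Cadlag.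

(** * J1 closeness *)

Section SkorokhodCloseness.
Context {R : realType}.
Implicit Types (x y u : R -> R) (s t e r : R) (lam mu : R -> R).

Lemma tc_le lam s t : time_change lam -> 0 <= s -> s <= t -> t <= 1 -> lam s <= lam t.
Proof.
move=> [_ _ _ h] s0 st t1; have [->//|nst] := eqVneq s t.
by apply/ltW/h => //; rewrite lt_neqAle nst.
Qed.

Lemma tc_ltE lam s t : time_change lam -> 0 <= s <= 1 -> 0 <= t <= 1 ->
  (lam s < lam t) = (s < t).
Proof.
move=> tc s01 t01; apply/idP/idP => [h|st]; last by case: tc => _ _ _; apply; lra.
rewrite ltNge; apply/negP => ts; have := tc_le tc (s := t) (t := s); lra.
Qed.

Lemma tc_leE lam s t : time_change lam -> 0 <= s <= 1 -> 0 <= t <= 1 ->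
  (lam s <= lam t) = (s <= t).
Proof. by move=> tc s01 t01; rewrite !leNgt tc_ltE. Qed.

Lemma tc_range lam s : time_change lam -> 0 <= s <= 1 -> 0 <= lam s <= 1.
Proof.
move=> tc s01; have [l0 l1 _ _] := tc.
have h1 := tc_le tc (s := 0) (t := s).
have h2 := tc_le tc (s := s) (t := 1).
rewrite l0 in h1; rewrite l1 in h2; lra.
Qed.

Lemma tc_surj lam t : time_change lam -> 0 <= t <= 1 ->
  exists2 s, 0 <= s <= 1 & lam s = t.
Proof.
move=> [l0 l1 lc _] t01.
have [c c01 <-] := IVT ler01 lc (v := t) ltac:(rewrite l0 l1 min_l// max_r//).
by exists c => //; move: c01; rewrite in_itv.
Qed.

(** A monotone surjection of an interval is continuous, so compositions and inverses of time changes
    need no separate continuity argument. *)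
Lemma time_change_surj lam :
  (forall s t, 0 <= s -> s < t -> t <= 1 -> lam s < lam t) ->
  (forall s, 0 <= s <= 1 -> 0 <= lam s <= 1) ->
  (forall t, 0 <= t <= 1 -> exists2 s, 0 <= s <= 1 & lam s = t) -> time_change lam.
Proof.
move=> inc rg surj.
have mono : {in `[0, 1] &, {mono lam : s t / s <= t}}.
  move=> s t; rewrite !in_itv/= => s01 t01; apply/idP/idP => [|st].
    rewrite leNgt => h; rewrite leNgt; apply: contra h => h; apply: inc => //; lra.
  have [->//|nst] := eqVneq s t; apply/ltW/inc; lra.
have l0 : lam 0 = 0.
  have [s s01 ls] := surj 0 ltac:(lra).
  have := rg 0 ltac:(lra); have := mono 0 s; rewrite !in_itv/= ls => h1 h2.
  have := h1 ltac:(lra) s01; have -> : 0 <= s by lra.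
  lra.
have l1 : lam 1 = 1.
  have [s s01 ls] := surj 1 ltac:(lra).
  have := rg 1 ltac:(lra); have := mono s 1; rewrite !in_itv/= ls => h1 h2.
  have := h1 s01 ltac:(lra); have -> : s <= 1 by lra.
  lra.
split => //; apply: segment_inc_surj_continuous => //.
move=> t /=; rewrite l0 l1 in_itv/= => t01; have [s s01 ls] := surj t t01.
by exists s => //=; rewrite in_itv.
Qed.

Lemma time_change_id : time_change (@id R).
Proof. by apply: time_change_surj => // t t01; exists t. Qed.

Lemma time_change_comp lam mu : time_change lam -> time_change mu ->
  time_change (mu \o lam).
Proof.
move=> tl tm; apply: time_change_surj => [s t s0 st t1|s s01|t t01] /=.
- have h1 := tc_range tl (s := s); have h2 := tc_range tl (s := t).
  by rewrite tc_ltE ?tc_ltE//; [lra|lra|apply: h1; lra|apply: h2; lra].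
- by do 2 apply: tc_range => //.
- have [v v01 <-] := tc_surj tm t01; have [s s01 <-] := tc_surj tl v01.
  by exists s.
Qed.

Lemma time_change_inv lam : time_change lam ->
  exists mu, time_change mu /\ forall s, 0 <= s <= 1 -> lam (mu s) = s.
Proof.
move=> tl.
have /choice [mu hmu] : forall t, exists s, 0 <= t <= 1 -> 0 <= s <= 1 /\ lam s = t.
  move=> t; have [t01|nt] := boolP (0 <= t <= 1); last by exists 0.
  by have [s s01 ls] := tc_surj tl t01; exists s.
exists mu; split; last by move=> s /hmu[].
apply: time_change_surj => [s t s0 st t1|s /hmu[]//|t t01].
- have [m1 e1] := hmu s ltac:(lra); have [m2 e2] := hmu t ltac:(lra).
  by rewrite -(tc_ltE tl)// e1 e2.
- exists (lam t); first exact: tc_range.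
  have [m1 e1] := hmu _ (tc_range tl t01).
  have h1 := tc_leE tl m1 t01; have h2 := tc_leE tl t01 m1.
  by apply/eqP; rewrite eq_le -h1 -h2 e1 lexx.
Qed.

(** The body of [J1_cvg] with the time change exposed: the estimates for trimming keep the same
    [lam] before and after the operator. *)
Definition tc_close lam e x u := time_change lam /\
  forall s, 0 <= s <= 1 -> `|lam s - s| <= e /\ `|u (lam s) - x s| <= e.

Definition J1_close x u e := exists lam, tc_close lam e x u.

Lemma J1_close_ge0 x u e : J1_close x u e -> 0 <= e.
Proof. by move=> [lam [_ /(_ 0)]] []; [lra|move=> h _; apply: le_trans h]. Qed.

Lemma J1_close_refl x : J1_close x x 0.
Proof. by exists id; split=> [|s _]; [exact: time_change_id|rewrite !subrr normr0]. Qed.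

Lemma J1_close_sym x u e : J1_close x u e -> J1_close u x e.
Proof.
move=> [lam [tl hl]]; have [mu [tm hm]] := time_change_inv tl.
exists mu; split=> // s s01; have [h1 h2] := hl _ (tc_range tm s01).
by move: h1 h2; rewrite hm// distrC => -> h2; rewrite distrC.
Qed.

(** Tolerances add with no loss, as for a metric; this is what makes the minorants below Lipschitz
    with the constant [k] itself. *)
Lemma J1_close_trans y x u e e' : J1_close x y e -> J1_close y u e' ->
  J1_close x u (e + e').
Proof.
move=> [lam [tl hl]] [mu [tm hm]]; exists (mu \o lam).
split=> [|s s01]; first exact: time_change_comp.
have [h1 h2] := hl s s01; have [h3 h4] := hm _ (tc_range tl s01).
rewrite /= !ler_norml in h1 h2 h3 h4 *; split; lra.
Qed.

Lemma J1_close_le x u e e' : e <= e' -> J1_close x u e -> J1_close x u e'.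
Proof.
move=> ee [lam [tl hl]]; exists lam; split=> // s s01; have [h1 h2] := hl s s01.
by split; apply: le_trans ee.
Qed.

(** A jump is a limit of differences [x s - x t], and replacing [x] by [u \o lam] costs [e] at each
    of the two points. *)
Lemma tc_close_jump lam e x u s : cadlag01 x -> cadlag01 u -> tc_close lam e x u ->
  0 <= s <= 1 -> `|jump u (lam s) - jump x s| <= e + e.
Proof.
move=> cx cu [tl hl] s01; have [l0 l1 _ _] := tl.
have e0 : 0 <= e by apply: (@J1_close_ge0 x u); exists lam.
have [s0|sp] := leP s 0.
  have -> : s = 0 by lra.
  by rewrite l0 !jump0// subrr normr0; lra.
have s01' : 0 < s <= 1 by lra.
have ls01 : 0 < lam s <= 1.
  have := tc_range tl s01; have := tc_ltE tl (s := 0) (t := s); rewrite l0 sp; lra.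
apply/ler_addgt0Pr => d d0.
have d20 : 0 < d / 2 by lra.
have [r1 r10 h1] := jump_leftP cx s01' d20.
have [r2 r20 h2] := jump_leftP cu ls01 d20.
have [lsp _] := andP ls01.
(* [v] is chosen close to [lam s], pulled back to [t0], and [t] is then taken between [t0] and [s]:
   so [t] is close to [s] and [lam t] close to [lam s] simultaneously. *)
have [v /and4P[v0 vl vr _]] := exists_left_of lsp r20 r20.
have [t0 t001 lt0] := tc_surj tl (t := v) ltac:(lra).
have t0s : t0 < s by rewrite -(tc_ltE tl)// lt0.
have st0 : 0 < s - t0 by lra.
have [t /and4P[tp ts tr tt0]] := exists_left_of sp r10 st0.
have t01 : 0 <= t <= 1 by lra.
have lt : lam t < lam s by rewrite tc_ltE.
have vt : v < lam t by rewrite -lt0 tc_ltE//; lra.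
have g1 := h1 t tr ts.
have g2 := h2 (lam t) ltac:(lra) lt.
have [_ g3] := hl s s01; have [_ g4] := hl t t01.
move: g1 g2 g3 g4.
move: (x s) (x t) (u (lam s)) (u (lam t)) (jump u _) (jump x _) => a b a' b' j j'.
rewrite !ler_norml; clear => /andP[? ?] /andP[? ?] /andP[? ?] /andP[? ?].
by apply/andP; split; lra.
Qed.

End SkorokhodCloseness.

(** * Attained extrema and gaps in finite sets of reals *)

Section FiniteSets.
Context {R : realType}.
Implicit Types (f : R -> R) (ts : seq R) (E : set R).

Lemma seq_lt_bound f (P : R -> Prop) ts (m : R) :
  (forall t, t \in ts -> P t -> f t < m) ->
  exists2 m', m' < m & forall t, t \in ts -> P t -> f t <= m'.
Proof.
elim: ts => [_|t ts ih h]; first by exists (m - 1); [lra|].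
have [m' m'm h'] := ih (fun t' tts => h t' (ltac:(by rewrite inE tts orbT))).
have [Pt|nPt] := pselect (P t).
  have ftm := h t ltac:(by rewrite inE eqxx) Pt.
  exists (Num.max m' (f t)); first by rewrite gt_max m'm.
  move=> v; rewrite inE => /orP[/eqP -> _|vts Pv]; first by rewrite le_max lexx orbT.
  by rewrite le_max h'.
by exists m' => // v; rewrite inE => /orP[/eqP ->//|vts]; exact: h'.
Qed.

Lemma finite_max E ts : (forall t, E t -> t \in ts) -> E !=set0 ->
  exists2 t, E t & forall s, E s -> s <= t.
Proof.
elim: ts E => [E h [t /h]//|t ts ih E h [v Ev]].
have [[w [Ew wt]]|nw] := pselect (exists w, E w /\ t < w).
  have [||z [Ez zt] hz] := ih [set s | E s /\ t < s].
  - by move=> s [/h]; rewrite inE => /orP[/eqP ->|//]; rewrite ltxx.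
  - by exists w.
  exists z => // s Es; have [ts'|st] := ltP t s; first exact: hz.
  by apply: ltW; apply: le_lt_trans zt.
have hle s : E s -> s <= t by move=> Es; rewrite leNgt; apply/negP => ?; apply: nw; exists s.
have [Et|nEt] := pselect (E t); first by exists t.
apply: ih; last by exists v.
by move=> s Es; have := h s Es; rewrite inE => /orP[/eqP st|//]; rewrite st in Es.
Qed.

Lemma sup_max E t : E t -> (forall s, E s -> s <= t) -> sup E = t.
Proof.
move=> Et h; apply/eqP; rewrite eq_le; apply/andP; split.
  by apply: ge_sup; [exists t|move=> s /h].
by apply: ub_le_sup => //; exists t => s /h.
Qed.

Lemma inf_min E t : E t -> (forall s, E s -> t <= s) -> inf E = t.
Proof.
move=> Et h; apply/eqP; rewrite eq_le; apply/andP; split.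
  by apply: ge_inf => //; exists t => s /h.
by apply: lb_le_inf; [exists t|move=> s /h].
Qed.

Lemma finite_min E ts : (forall t, E t -> t \in ts) -> E !=set0 ->
  exists2 t, E t & forall s, E s -> t <= s.
Proof.
move=> h [v Ev]; have [||t Et ht] := @finite_max [set s | E (- s)] (map -%R ts).
- by move=> s /h; rewrite -{2}[s]opprK; exact: map_f.
- by exists (- v); rewrite /= opprK.
by exists (- t) => // s Es; rewrite lerNl; apply: ht; rewrite /= opprK.
Qed.

Lemma seq_gap ts : exists2 g, 0 < g &
  forall s t, s \in ts -> t \in ts -> `|s - t| < g -> s = t.
Proof.
elim: ts => [|t ts [g g0 hg]]; first by exists 1.
have [m mlt hm] := @seq_lt_bound (fun s => - `|s - t|) (fun s => s != t) ts 0
  ltac:(by move=> s _ st; rewrite oppr_lt0 normr_gt0 subr_eq0).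
exists (Num.min g (- m)); first by rewrite lt_min g0 oppr_gt0.
have key s : s \in ts -> `|s - t| < Num.min g (- m) -> s = t.
  move=> sts; rewrite lt_min => /andP[_ h]; apply/eqP/negPn/negP => st.
  by have := hm s sts st; rewrite lerNl leNgt h.
move=> s v; rewrite !inE => /orP[/eqP ->|sts] /orP[/eqP ->|vts] //.
- by rewrite distrC => /(key _ vts).
- exact: key.
- by rewrite lt_min => /andP[h _]; exact: hg.
Qed.

End FiniteSets.

(** * Running suprema of functions with finitely many large values *)

Section RunningSup.
Context {R : realType}.
Implicit Types (f : R -> R) (s t tau kappa m : R).

Definition running_sup f tau := sup (f @` `[0, tau]).

(** The common shape of [jump x] and of its modulus. The value 0 at time 0 makes running suprema
    nonnegative; finite exceedance sets make them attained. *)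
Definition finitely_above f := f 0 = 0 /\
  forall kappa, 0 < kappa -> exists ts : seq R,
    forall s, 0 <= s <= 1 -> kappa < f s -> s \in ts.

Lemma finitely_above_ub f : finitely_above f ->
  exists M, forall s, 0 <= s <= 1 -> f s <= M.
Proof.
move=> [_ /(_ 1 ltr01) [ts h]].
exists (Num.max 1 (\sum_(t <- ts) `|f t|)) => s s01.
rewrite le_max; have [//|fs] := leP (f s) 1; rewrite /=.
rewrite (big_rem s) /=; last exact: h.
by apply: ler_wpDr; [exact: sumr_ge0|exact: ler_norm].
Qed.

Section Fixed.
Variables (f : R -> R) (tau : R).
Hypotheses (ff : finitely_above f) (tau01 : 0 <= tau <= 1).

Let nonempty_img : (f @` `[0, tau]) !=set0.
Proof. by exists (f 0), 0 => //=; rewrite in_itv/= lexx; case/andP: tau01. Qed.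

Lemma running_sup_ge s : 0 <= s <= tau -> f s <= running_sup f tau.
Proof.
move=> s0; apply: ub_le_sup; last by exists s => //=; rewrite in_itv.
have [M hM] := finitely_above_ub ff.
by exists M => z [t /=]; rewrite in_itv/= => tt <-; apply: hM; have := tau01; lra.
Qed.

Lemma running_sup_le m : (forall s, 0 <= s <= tau -> f s <= m) -> running_sup f tau <= m.
Proof. by move=> h; apply: ge_sup nonempty_img _ => z [t /=]; rewrite in_itv/= => tt <-; exact: h. Qed.

Lemma running_sup_ge0 : 0 <= running_sup f tau.
Proof. by have := @running_sup_ge 0; case: ff => -> _; apply; have := tau01; lra. Qed.

(** If the supremum [m] is positive, only finitely many values exceed [m / 2]; were all of them
    below [m], so would be their maximum, and [m] would not be the supremum. If [m] is not positive,
    time 0 attains it. *)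
Lemma running_sup_attained : exists2 s, 0 <= s <= tau & f s = running_sup f tau.
Proof.
set m := running_sup f tau; have [m0|m0] := leP m 0.
  exists 0; first by have := tau01; lra.
  by apply/eqP; rewrite eq_le running_sup_ge ?(le_trans m0)//; [case: ff => ->|have := tau01; lra].
apply: contrapT => hn.
have m20 : 0 < m / 2 by lra.
have [_ /(_ _ m20) [ts hts]] := ff.
have [t _ t01|m' m'm hm'] := @seq_lt_bound _ f (fun s => 0 <= s <= tau) ts m.
  rewrite lt_neqAle running_sup_ge// andbT; apply/eqP => e; apply: hn; exists t => //.
have : m <= Num.max (m / 2) m'.
  apply: running_sup_le => s s01; rewrite le_max; have [//|h] := leP (f s) (m / 2).
  by apply/orP; right; apply: hm' => //; apply: hts => //; have := tau01; lra.
rewrite le_max; lra.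
Qed.

End Fixed.

Lemma running_sup_mono f s t : finitely_above f -> 0 <= s -> s <= t -> t <= 1 ->
  running_sup f s <= running_sup f t.
Proof.
move=> ff s0 st t1; apply: running_sup_le; first lra.
by move=> v v0; apply: running_sup_ge => //; lra.
Qed.

Lemma running_sup_osc f s t m : finitely_above f -> 0 <= s -> s <= t -> t <= 1 ->
  0 <= m -> (forall v, s < v <= t -> f v <= m) ->
  running_sup f t <= running_sup f s + m.
Proof.
move=> ff s0 st t1 m0 h; apply: running_sup_le; first lra.
move=> v v0; have [vs|sv] := leP v s.
  by rewrite ler_wpDr// running_sup_ge//; lra.
by rewrite ler_wpDl ?running_sup_ge0//; [lra|apply: h; lra].
Qed.

End RunningSup.

(** * Trimming operators and ties *)

Section JumpSup.
Context {R : realType}.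
Implicit Types (x u : R -> R) (s t tau e kappa : R) (lam f g : R -> R).

Lemma abs_jump_finitely_above x : cadlag01 x -> finitely_above (fun s => `|jump x s|).
Proof.
move=> cx; split; first by rewrite jump0// normr0.
move=> k k0; have [ts hts] := cadlag01_osc cx k0; exists ts => s s01.
by apply: contraTT => sts; rewrite -leNgt; exact: jump_osc hts s01 sts.
Qed.

Lemma jump_finitely_above x : cadlag01 x -> finitely_above (jump x).
Proof.
move=> cx; split; first by rewrite jump0.
move=> k k0; have [_ /(_ k k0) [ts hts]] := abs_jump_finitely_above cx.
by exists ts => s s01 ks; apply: hts => //; apply: lt_le_trans ks (ler_norm _).
Qed.

(** The time change maps [[0, tau]] onto [[0, lam tau]], so the two suprema run over matched
    values. *)
Lemma running_sup_close lam f g d tau : time_change lam -> finitely_above f ->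
  finitely_above g -> 0 <= tau <= 1 ->
  (forall s, 0 <= s <= 1 -> `|g (lam s) - f s| <= d) ->
  `|running_sup g (lam tau) - running_sup f tau| <= d.
Proof.
move=> tl ff fg tau01 h; have lt01 := tc_range tl tau01.
have [l0 _ _ _] := tl.
rewrite ler_distlC; apply/andP; split.
  rewrite lerBlDr; apply: running_sup_le => // t t0.
  have t01 : 0 <= t <= 1 by lra.
  have [s s01 lst] := tc_surj tl t01.
  have := h s s01; rewrite lst ler_distlC => /andP[h1 _].
  rewrite -lerBlDr; apply: le_trans h1 _; apply: running_sup_ge => //.
  by move: t0; rewrite -lst tc_leE//; lra.
apply: running_sup_le => // s s0.
have s01 : 0 <= s <= 1 by lra.
have := h s s01; rewrite ler_distlC => /andP[_ h1].
apply: le_trans h1 _; rewrite lerD2r; apply: running_sup_ge => //.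
by rewrite tc_leE//; have := tc_range tl s01; lra.
Qed.

End JumpSup.

Section RunningSupTrimming.
Context {R : realType}.
Implicit Types (x u : R -> R) (s t tau e kappa : R) (lam : R -> R).

(** Within a cell of the partition all jumps are at most [e / 2], so the running supremum rises by
    no more than that. *)
Lemma T1p_cadlag x : cadlag01 x -> cadlag01 (T1p x).
Proof.
move=> cx; apply/cadlag01P => e e0; have e20 : 0 < e / 2 by lra.
have [ts hts] := cadlag01_osc cx e20; exists ts => s t s0 st t1 ns.
have fx := jump_finitely_above cx.
have h1 := hts s t s0 st t1 ns.
have h2 : S_pos x s <= S_pos x t by exact: running_sup_mono.
have h3 : S_pos x t <= S_pos x s + e / 2.
  apply: running_sup_osc => //; first exact: ltW.
  move=> v vst; apply: le_trans (ler_norm _) _; apply: (jump_osc cx hts); first lra.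
  by apply/negP => vts; apply: ns; exists v.
rewrite /T1p !ler_norml in h1 *; lra.
Qed.

(** The factor 3 is one [e] for the path and two for its jumps, hence for their running supremum. *)
Lemma T1p_close lam e x u : cadlag01 x -> cadlag01 u -> tc_close lam e x u ->
  tc_close lam (3 * e) (T1p x) (T1p u).
Proof.
move=> cx cu h; have [tl hl] := h; split=> // s s01.
have e0 : 0 <= e by apply: (@J1_close_ge0 _ x u); exists lam.
have [h1 h2] := hl s s01; split; first by apply: le_trans h1 _; lra.
have h3 : `|S_pos u (lam s) - S_pos x s| <= e + e :=
  running_sup_close tl (jump_finitely_above cx) (jump_finitely_above cu) s01
    (fun t t01 => tc_close_jump cx cu h t01).
rewrite /T1p !ler_norml in h2 h3 *; lra.
Qed.

Lemma cadlag01N x : cadlag01 x -> cadlag01 (fun s => - x s).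
Proof.
move=> /cadlag01P h; apply/cadlag01P => e e0; have [ts hts] := h e e0.
by exists ts => s t s0 st t1 ns; rewrite -opprD normrN; exact: hts.
Qed.

Lemma tc_closeN lam e x u : tc_close lam e x u ->
  tc_close lam e (fun s => - x s) (fun s => - u s).
Proof.
move=> [tl hl]; split=> // s s01; have [h1 h2] := hl s s01; split=> //.
by rewrite -opprD normrN.
Qed.

Lemma T1nE x : T1n x = (fun s => - T1p (fun t => - x t) s).
Proof. by apply/funext => s; rewrite /T1n /T1p opprB opprK addrC. Qed.

Lemma T1n_cadlag x : cadlag01 x -> cadlag01 (T1n x).
Proof. by move=> cx; rewrite T1nE; exact/cadlag01N/T1p_cadlag/cadlag01N. Qed.

Lemma T1n_close lam e x u : cadlag01 x -> cadlag01 u -> tc_close lam e x u ->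
  tc_close lam (3 * e) (T1n x) (T1n u).
Proof.
move=> cx cu h; rewrite !T1nE; apply: tc_closeN; apply: T1p_close; [exact: cadlag01N..|].
exact: tc_closeN.
Qed.

Lemma Trim_rs_cadlag (r s : nat) x : cadlag01 x -> cadlag01 (Trim_rs r s x).
Proof.
move=> cx; rewrite /Trim_rs /Trim_p; elim: r => [|r ih] /=; last exact: T1p_cadlag.
by rewrite /Trim_n; elim: s => [//|s ih] /=; exact: T1n_cadlag.
Qed.

Lemma Trim_rs_close (r s : nat) lam e x u : cadlag01 x -> cadlag01 u -> tc_close lam e x u ->
  tc_close lam (3 ^+ (r + s) * e) (Trim_rs r s x) (Trim_rs r s u).
Proof.
move=> cx cu h; elim: r => [|r ih].
  rewrite /Trim_rs /Trim_p add0n /=; elim: s => [|s ih] /=; first by rewrite expr0 mul1r.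
  rewrite exprS -mulrA; apply: T1n_close => //; exact: (@Trim_rs_cadlag 0 s).
rewrite addSn exprS -mulrA; apply: T1p_close => //; exact: Trim_rs_cadlag.
Qed.

Lemma Trim_rs_J1_cvg (r s : nat) (u : nat -> R -> R) x :
  (forall n, cadlag01 (u n)) -> cadlag01 x -> J1_cvg u x ->
  J1_cvg (fun n => Trim_rs r s (u n)) (Trim_rs r s x).
Proof.
move=> cu cx h e e0.
have k0 : 0 < 3 ^+ (r + s) :> R by apply: exprn_gt0; lra.
have := h (e / 3 ^+ (r + s)) ltac:(exact: divr_gt0).
apply: filterS => n [lam hl]; exists lam.
by have := Trim_rs_close r s cx (cu n) hl; rewrite mulrC divfK ?gt_eqF.
Qed.

End RunningSupTrimming.

Section Ties.
Context {R : realType}.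
Implicit Types (x u : R -> R) (s t tau e kappa : R) (lam : R -> R).

(** Moduli are compared rather than signed jumps: if a positive and a negative jump had equal size,
    a small perturbation could change which of them modulus trimming removes. *)
Definition no_ties x := forall s t, 0 <= s <= 1 -> 0 <= t <= 1 ->
  `|jump x s| = `|jump x t| -> jump x s != 0 -> s = t.

(** Only finitely many jumps exceed [kappa] in modulus, so their distinct moduli are a positive
    distance apart. *)
Lemma no_ties_gap x kappa : cadlag01 x -> no_ties x -> 0 < kappa ->
  exists2 g, 0 < g & forall s t, 0 <= s <= 1 -> 0 <= t <= 1 ->
    kappa < `|jump x s| -> kappa < `|jump x t| ->
    `| `|jump x s| - `|jump x t| | < g -> s = t.
Proof.
move=> cx nt k0; have [_ /(_ _ k0)[ts hts]] := abs_jump_finitely_above cx.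
have [g g0 hg] := seq_gap [seq `|jump x s| | s <- ts].
exists g; first exact: g0.
move=> s t s01 t01 ks kt st; apply: (nt s t s01 t01).
  by apply: hg st; apply: map_f; exact: hts.
by rewrite -normr_gt0; apply: lt_trans ks.
Qed.

(** When the largest jump is positive, finitely many times realize it and the infimum is a minimum.
    Otherwise the supremum is 0, and time 0, where [jump] is 0 by convention, is the least
    candidate. *)
Lemma R1P x : cadlag01 x -> 0 <= R1 x <= 1 /\ jump x (R1 x) = S_pos x 1.
Proof.
move=> cx; have fx := jump_finitely_above cx.
have i01 : 0 <= (1 : R) <= 1 by lra.
have [s s01 hs] := running_sup_attained fx i01.
have m0 : 0 <= S_pos x 1 := running_sup_ge0 fx i01.
pose E := [set s | 0 <= s <= 1 /\ jump x s = S_pos x 1].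
suff [t [t01 ht] hm] : exists2 t, E t & forall s, E s -> t <= s.
  by rewrite /R1 (inf_min (t := t)).
have [m0'|mp] := leP (S_pos x 1) 0.
  exists 0; last by move=> v [/andP[]].
  by split; [lra|rewrite jump0//; apply/eqP; rewrite eq_le m0' andbT].
have m2 : 0 < S_pos x 1 / 2 by lra.
have [_ /(_ _ m2)[ts hts]] := fx.
apply: (@finite_min _ _ ts); last by exists s.
by move=> t [t01 ht]; apply: hts => //; rewrite ht; lra.
Qed.

Lemma Rtrim1_cadlag x : cadlag01 x -> cadlag01 (Rtrim1 x).
Proof.
move=> cx; apply/cadlag01P => e e0; have [ts hts] := cadlag01_osc cx e0.
exists (R1 x :: ts) => s t s0 st t1 ns.
have h1 : `|x s - x t| <= e.
  by apply: hts => // -[v vts hv]; apply: ns; exists v => //; rewrite inE vts orbT.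
rewrite /Rtrim1; have -> : (R1 x <= s <= 1) = (R1 x <= t <= 1).
  have [rs|sr] := leP (R1 x) s; first by have -> : R1 x <= t <= 1; lra.
  rewrite /=; apply/esym/negbTE/negP => rt; apply: ns; exists (R1 x); rewrite ?mem_head//.
  lra.
by rewrite opprB addrA subrK.
Qed.

Lemma norm_sub_sub_le (a b c d p q r : R) : `|a - b| <= p -> `|c| <= q -> `|d| <= r ->
  `|a - c - (b - d)| <= p + q + r.
Proof.
move=> h1 h2 h3; rewrite (_ : a - c - (b - d) = a - b - c + d); last by ring.
by apply: le_trans (ler_normD _ _) (lerD _ h3); apply: le_trans (ler_normB _ _) (lerD h1 h2).
Qed.

(** Either the largest jump of [x] is small, and then so are both removed jumps, or the gap between
    large jumps forces [lam] to match the two record times exactly, so that both removals start at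
    corresponding instants. *)
Lemma Rtrim1_J1_cvg (u : nat -> R -> R) x :
  (forall n, cadlag01 (u n)) -> cadlag01 x -> no_ties x -> J1_cvg u x ->
  J1_cvg (fun n => Rtrim1 (u n)) (Rtrim1 x).
Proof.
move=> cu cx nt h e e0.
have k0 : 0 < e / 8 by lra.
have [g g0 hg] := no_ties_gap cx nt k0.
have [e' e'0 [e'k e'g]] : exists2 e', 0 < e' & e' <= e / 32 /\ 4 * e' < g.
  exists (Num.min (e / 32) (g / 8)); first by rewrite lt_min; lra.
  split; first by rewrite ge_min lexx.
  have : Num.min (e / 32) (g / 8) <= g / 8 by rewrite ge_min lexx orbT.
  lra.
have := h e' e'0; apply: filterS => n [lam hl]; exists lam.
have hc : tc_close lam e' x (u n) by [].
have [tl {}hl] := hc; split=> // s s01; have [hs1 hs2] := hl s s01.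
split; first by apply: le_trans hs1 _; lra.
have hj := tc_close_jump cx (cu n) hc.
have i01 : 0 <= (1 : R) <= 1 by lra.
have [l0 l1 _ _] := tl.
have hS : `|S_pos (u n) 1 - S_pos x 1| <= e' + e'.
  rewrite -{1}l1; exact: running_sup_close tl (jump_finitely_above cx)
    (jump_finitely_above (cu n)) i01 hj.
have [r01 hr] := R1P cx; have [q01 hq] := R1P (cu n).
have [p p01 hp] := tc_surj tl q01.
have Mx : 0 <= S_pos x 1 := running_sup_ge0 (jump_finitely_above cx) i01.
have Mu : 0 <= S_pos (u n) 1 := running_sup_ge0 (jump_finitely_above (cu n)) i01.
rewrite /Rtrim1 hr hq.
(* In the small case the error is at most [e' + (e / 4 + 2 * e') + e / 4], below [e] since
   [e' <= e / 32]. *)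
have [Mk|kM] := leP (S_pos x 1) (e / 4).
  have Su : S_pos (u n) 1 <= e / 4 + (e' + e').
    by move: hS; rewrite ler_norml => /andP[_]; clear -Mk; lra.
  have {}h1 b : `|if b then S_pos x 1 else 0| <= e / 4.
    by case: b; rewrite ?normr0 ?(ger0_norm Mx)//; clear -e0; lra.
  have {}h2 b : `|if b then S_pos (u n) 1 else 0| <= e / 4 + (e' + e').
    by case: b; rewrite ?normr0 ?(ger0_norm Mu)//; clear -e0 e'0; lra.
  apply: le_trans (norm_sub_sub_le hs2 (h2 _) (h1 _)) _.
  by clear -e'k e0; lra.
have jp := hj p p01; rewrite hp hq in jp.
have jpM : jump x p <= S_pos x 1 := running_sup_ge (jump_finitely_above cx) i01 p01.
move: hS jp; rewrite !ler_norml => /andP[hS1 hS2] /andP[jp1 jp2].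
(* The jump of [x] at [p] is within [2 * e'] of the record of [u n], itself within [2 * e'] of the
   record of [x]; as [4 * e' < g], the gap leaves only [R1 x]. *)
have ep : p = R1 x.
  have jp0 : `|jump x p| = jump x p.
    by rewrite ger0_norm//; clear -jp1 jp2 hS1 hS2 kM e'k; lra.
  have jr0 : `|jump x (R1 x)| = S_pos x 1 by rewrite hr ger0_norm.
  apply: hg => //; rewrite ?jp0 ?jr0.
  - by clear -jp1 jp2 hS1 hS2 kM e'k; lra.
  - by clear -kM e0; lra.
  - rewrite ltr_norml; clear -jp1 jp2 hS1 hS2 jpM e'g e'0.
    by apply/andP; split; lra.
have -> : (R1 (u n) <= lam s <= 1) = (R1 x <= s <= 1).
  rewrite -hp -ep tc_leE//; case: (p <= s) => //=.
  by rewrite -{1}l1 tc_leE.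
move: hs2; rewrite ler_norml => /andP[hs2 hs3].
clear -hs2 hs3 hS1 hS2 e'k e0.
by case: ifP => _; apply/andP; split; lra.
Qed.

(** Close to the left of [s] the subtracted step is constant: already present if [R1 x < s], still
    absent otherwise. Only the jump at [R1 x] is affected. *)
Lemma jump_Rtrim1 x s : cadlag01 x -> 0 <= s <= 1 ->
  jump (Rtrim1 x) s = if s == R1 x then 0 else jump x s.
Proof.
move=> cx s01; have [s0|sp] := leP s 0.
  by rewrite !jump0//; case: ifP.
have s01' : 0 < s <= 1 by rewrite sp; case/andP: s01.
apply: jump_eqP => // e e0; have [r r0 hr] := jump_leftP cx s01' e0.
have [R01 _] := R1P cx.
have [r' r'0 [r'r hr']] : exists2 r', 0 < r' & r' <= r /\
    forall t, s - r' < t -> t < s -> (R1 x <= t <= 1) = (R1 x < s).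
  have [Rs|sR] := ltP (R1 x) s.
    exists (Num.min r (s - R1 x)); first by rewrite lt_min r0 subr_gt0.
    split; first by rewrite ge_min lexx.
    move=> t st ts; have : Num.min r (s - R1 x) <= s - R1 x by rewrite ge_min lexx orbT.
    lra.
  by exists r => //; split=> // t _ ts; apply/negbTE/negP; lra.
exists r' => // t rt ts; rewrite /Rtrim1 (hr' t)//.
have := hr t ltac:(lra) ts.
have [->|nR] := eqVneq s (R1 x).
  rewrite lexx ltxx /= ifT; last by lra.
  by rewrite !subr0 addrAC.
have -> : (R1 x <= s <= 1) = (R1 x < s) by rewrite lt_neqAle eq_sym nR; lra.
by case: ifP => _; rewrite ?subr0// opprB addrA subrK.
Qed.

Lemma Rtrim1_no_ties x : cadlag01 x -> no_ties x -> no_ties (Rtrim1 x).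
Proof.
move=> cx nt s t s01 t01; rewrite !jump_Rtrim1//.
case: eqP => [|_]; first by rewrite eqxx.
case: eqP => [_ e0|_]; last exact: nt.
by move: e0; rewrite normr0 => /normr0_eq0 ->; rewrite eqxx.
Qed.

End Ties.

(** * Signed modulus trimming: continuity and preservation of distinct jumps *)

Section ModulusTrimming.
Context {R : realType}.
Implicit Types (x u : R -> R) (s t tau e kappa : R) (lam : R -> R).

Definition jump_modulus x tau := running_sup (fun s => `|jump x s|) tau.

Lemma jump_modulus_ge x tau s : cadlag01 x -> tau <= 1 -> 0 <= s <= tau ->
  `|jump x s| <= jump_modulus x tau.
Proof.
move=> cx t1 s0; apply: (running_sup_ge (abs_jump_finitely_above cx)) => //.
by rewrite t1 andbT; case/andP: s0 => s0; exact: le_trans.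
Qed.

(** Finitely many times realize a positive maximal modulus, so the supremum is attained. On a
    stretch without jumps every time is a candidate and the supremum is [tau] itself. *)
Lemma LtildeP x tau : cadlag01 x -> 0 <= tau <= 1 ->
  [/\ 0 <= Ltilde x tau <= tau, `|jump x (Ltilde x tau)| = jump_modulus x tau &
      forall s, 0 <= s <= tau -> `|jump x s| = jump_modulus x tau -> s <= Ltilde x tau].
Proof.
move=> cx t01; have fx := abs_jump_finitely_above cx.
have [s s0 hs] := running_sup_attained fx t01.
have m0 : 0 <= jump_modulus x tau := running_sup_ge0 fx t01.
pose E := [set s | 0 <= s <= tau /\ `|jump x s| = jump_modulus x tau].
suff [t [t0 ht] hm] : exists2 t, E t & forall s, E s -> s <= t.
  have -> : Ltilde x tau = t by apply: sup_max.
  by split=> // v v0 hv; apply: hm; split.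
have [m0'|mp] := leP (jump_modulus x tau) 0.
  exists tau; last by move=> v [/andP[]].
  have tt : 0 <= tau <= tau by rewrite lexx andbT; case/andP: t01.
  split=> //; apply/eqP; rewrite eq_le jump_modulus_ge//=; last by case/andP: t01.
  exact: le_trans m0' (normr_ge0 _).
have m2 : 0 < jump_modulus x tau / 2 by lra.
have [_ /(_ _ m2)[ts hts]] := fx.
apply: (@finite_max _ _ ts); last by exists s.
move=> t [t0 ht]; apply: hts; last by rewrite ht; lra.
by case/andP: t0 => t0 tt; rewrite t0 (le_trans tt)//; case/andP: t01.
Qed.

Lemma jump_modulus_mono x s t : cadlag01 x -> 0 <= s -> s <= t -> t <= 1 ->
  jump_modulus x s <= jump_modulus x t.
Proof. by move=> cx; apply: running_sup_mono; exact: abs_jump_finitely_above. Qed.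

Lemma jump_modulus_close lam e x u s : cadlag01 x -> cadlag01 u ->
  tc_close lam e x u -> 0 <= s <= 1 ->
  `|jump_modulus u (lam s) - jump_modulus x s| <= e + e.
Proof.
move=> cx cu hc s01; have [tl _] := hc.
apply: (running_sup_close tl (abs_jump_finitely_above cx)
  (abs_jump_finitely_above cu) s01) => t t01.
exact: le_trans (ler_dist_dist _ _) (tc_close_jump cx cu hc t01).
Qed.

#[local] Opaque Ltilde jump jump_modulus.

Lemma subrBB (a b c d : R) : a - b - (c - d) = a - c - (b - d).
Proof. ring. Qed.

Lemma subrBBB (a b c d j : R) : a - b - (c - d) - (j - (b - d)) = a - c - j.
Proof. ring. Qed.

(** Between two times of one cell, either the latest record is unchanged, or the new record lies
    inside the cell; in the latter case it is at most [e / 3], and the old record is no larger. *)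
Lemma Mtrim1_cadlag x : cadlag01 x -> cadlag01 (Mtrim1 x).
Proof.
move=> cx; apply/cadlag01P => e e0; have e30 : 0 < e / 3 by lra.
have [ts hts] := cadlag01_osc cx e30.
exists ts => s t s0 st t1 ns; have h1 := hts s t s0 st t1 ns.
have s01 : 0 <= s <= 1 by rewrite s0 (le_trans st).
have t01 : 0 <= t <= 1 by rewrite t1 (le_trans s0).
have [Ls0 Lsm Lsx] := LtildeP cx s01; have [Lt0 Ltm Ltx] := LtildeP cx t01.
have mst : jump_modulus x s <= jump_modulus x t.
  exact: jump_modulus_mono.
have [/andP[Ls0' Ls1] /andP[Lt0' Lt1]] := (Ls0, Lt0).
rewrite /Mtrim1; have [Lts|sLt] := leP (Ltilde x t) s.
  have em : jump_modulus x s = jump_modulus x t.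
    have s1 : s <= 1 by case/andP: s01.
    apply: le_anti; rewrite mst -Ltm; apply: jump_modulus_ge => //.
    by rewrite Lt0'.
  have -> : Ltilde x s = Ltilde x t.
    apply: le_anti; apply/andP; split.
      by apply: Ltx; [rewrite Ls0' (le_trans Ls1 st)|rewrite Lsm].
    by apply: Lsx; [rewrite Lt0' Lts|rewrite em].
  by rewrite opprB addrA subrK; apply: le_trans h1 _; clear -e0; lra.
have Ltts : `|jump x (Ltilde x t)| <= e / 3.
  apply: (jump_osc cx hts); first by rewrite Lt0' (le_trans Lt1).
  by apply/negP => h; apply: ns; exists (Ltilde x t); rewrite ?sLt.
have Lsts : `|jump x (Ltilde x s)| <= e / 3.
  by rewrite Lsm; apply: le_trans mst _; rewrite -Ltm.
by apply: le_trans (norm_sub_sub_le h1 Lsts Ltts) _; clear -e0; lra.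
Qed.

(** The dichotomy of record trimming, now at every time [s]: the record time of [u n] up to [lam s]
    pulls back to a time in [[0, s]], and if the record is large the gap makes it the record time of
    [x]. Comparing the jumps there also matches their signs. *)
Lemma Mtrim1_J1_cvg (u : nat -> R -> R) x :
  (forall n, cadlag01 (u n)) -> cadlag01 x -> no_ties x -> J1_cvg u x ->
  J1_cvg (fun n => Mtrim1 (u n)) (Mtrim1 x).
Proof.
move=> cu cx nt h e e0.
have k0 : 0 < e / 8 by lra.
have [g g0 hg] := no_ties_gap cx nt k0.
have [e' e'0 [e'k e'g]] : exists2 e', 0 < e' & e' <= e / 32 /\ 4 * e' < g.
  exists (Num.min (e / 32) (g / 8)); first by rewrite lt_min; lra.
  split; first by rewrite ge_min lexx.
  have : Num.min (e / 32) (g / 8) <= g / 8 by rewrite ge_min lexx orbT.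
  lra.
have := h e' e'0; apply: filterS => n [lam hl]; exists lam.
have hc : tc_close lam e' x (u n) by [].
have [tl {}hl] := hc; split=> // s s01; have [hs1 hs2] := hl s s01.
split; first by apply: le_trans hs1 _; clear -e'k e0; lra.
have hj := tc_close_jump cx (cu n) hc.
have ls01 := tc_range tl s01.
have hS := jump_modulus_close cx (cu n) hc s01.
have [r0 hr _] := LtildeP cx s01; have [q0 hq _] := LtildeP (cu n) ls01.
have r01 : 0 <= Ltilde x s <= 1.
  by case/andP: r0 => -> r0 /=; apply: le_trans r0 _; case/andP: s01.
have q01 : 0 <= Ltilde (u n) (lam s) <= 1.
  by case/andP: q0 => -> q0 /=; apply: le_trans q0 _; case/andP: ls01.
have [p p01 hp] := tc_surj tl q01.
have ps : 0 <= p <= s.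
  case/andP: (p01) => -> _ /=; rewrite -(tc_leE tl)// hp.
  by case/andP: q0.
rewrite /Mtrim1.
have [Mk|kM] := leP (jump_modulus x s) (e / 4).
  have h1 : `|jump x (Ltilde x s)| <= e / 4 by rewrite hr.
  have h2 : `|jump (u n) (Ltilde (u n) (lam s))| <= e / 4 + (e' + e').
    rewrite hq; move: hS; rewrite ler_norml => /andP[_].
    by clear -Mk; lra.
  apply: le_trans (norm_sub_sub_le hs2 h2 h1) _.
  by clear -e'k e0; lra.
have jp := hj p p01; rewrite hp in jp.
have s1 : s <= 1 by case/andP: s01.
have jpM := jump_modulus_ge cx s1 ps.
have jpM' : jump_modulus x s - 4 * e' <= `|jump x p|.
  move: hS; rewrite -hq ler_norml => /andP[hS _].
  have := le_trans (ler_dist_dist _ _) jp; rewrite ler_norml => /andP[_].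
  by clear -hS; lra.
have ep : p = Ltilde x s.
  apply: hg p01 r01 _ _ _.
  - by clear -jpM' kM e'k; lra.
  - by rewrite hr; clear -kM e0; lra.
  - rewrite hr ltr_norml; clear -jpM jpM' e'g e'0.
    by apply/andP; split; lra.
rewrite ep in jp.
rewrite subrBB.
apply: le_trans (ler_normB _ _) _; apply: le_trans (lerD hs2 jp) _.
by clear -e'k e0; lra.
Qed.

(** As [u] increases to [s] the record at [u] stabilizes: close to [s] all jumps are at most half of
    some fixed earlier jump, so no new record appears. The limiting record [l] determines the left
    limit of the trimmed path. *)
Lemma left_record x s : cadlag01 x -> 0 < s <= 1 ->
  exists (l : R), exists2 r : R, 0 < r & [/\ 0 <= l < s,
    forall u : R, s - r < u -> u < s -> jump x (Ltilde x u) = jump x l &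
    forall v : R, 0 <= v < s -> `|jump x v| <= `|jump x l| /\
      (`|jump x v| = `|jump x l| -> jump x v != 0 -> v <= l)].
Proof.
move=> cx /andP[s0 s1].
have [[v0 [v00 jv0]]|nv] := pselect (exists v, 0 <= v < s /\ jump x v != 0); last first.
  have z v : 0 <= v < s -> jump x v = 0.
    by move=> hv; apply/eqP/negPn/negP => h; apply: nv; exists v.
  (* Without nonzero jumps before [s] every removed jump is 0, and [l := 0] serves by default. *)
  exists 0, s => //; split; first by rewrite lexx.
    move=> u; rewrite subrr => u0 us; have u01 : 0 <= u <= 1 by rewrite !ltW// (lt_le_trans us).
    have [/andP[L0 L1] _ _] := LtildeP cx u01.
    by rewrite !z// ?lexx// L0 (le_lt_trans L1).
  by move=> v vs; rewrite !z ?lexx// eqxx; split.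
have k0 : 0 < `|jump x v0| / 2 by rewrite divr_gt0// normr_gt0.
have kv : `|jump x v0| / 2 < `|jump x v0| by clear -k0; lra.
have [ts hts] := cadlag01_osc cx k0.
have [r r0 hr] := separated_left ts s.
have rv : 0 < s - v0 by rewrite subr_gt0; case/andP: v00.
have [u0 /and4P[u00 u0s u0r u0v]] := exists_left_of s0 r0 rv.
rewrite opprB addrC subrK in u0v.
have small v : u0 < v -> v < s -> `|jump x v| <= `|jump x v0| / 2.
  move=> uv vs; apply: (jump_osc cx hts).
    by rewrite (ltW (lt_trans u00 uv)) (le_trans (ltW vs)).
  by apply/negP => vts; apply: (hr u0 v u0r vs); exists v => //; rewrite uv lexx.
have u01 : 0 <= u0 <= 1 by rewrite (ltW u00) (le_trans (ltW u0s)).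
have [/andP[L0 L1] Lm Lx] := LtildeP cx u01.
have big : `|jump x v0| <= jump_modulus x u0.
  by apply: jump_modulus_ge => //; [case/andP: u01|case/andP: v00 => -> _ /=; exact: ltW].
exists (Ltilde x u0), (s - u0); first by rewrite subr_gt0.
split; first by rewrite L0 (le_lt_trans L1).
- move=> u; rewrite opprB addrC subrK => u0u us.
  have u01' : 0 <= u <= 1 by rewrite (ltW (lt_trans u00 u0u)) (le_trans (ltW us)).
  have [/andP[K0 K1] Km Kx] := LtildeP cx u01'.
  have mono : jump_modulus x u0 <= jump_modulus x u.
    by apply: jump_modulus_mono (ltW u0u) _; [by []|exact: ltW|case/andP: u01'].
  have Ku0 : Ltilde x u <= u0.
    rewrite leNgt; apply/negP => h; have := small _ h (le_lt_trans K1 us).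
    by rewrite Km leNgt (lt_le_trans kv)// (le_trans big).
  have em : jump_modulus x u = jump_modulus x u0.
    apply: le_anti; rewrite mono andbT -Km; apply: jump_modulus_ge => //.
      by case/andP: u01.
    by rewrite K0.
  congr (jump x _); apply: le_anti; apply/andP; split.
    by apply: Lx; [rewrite K0 Ku0|rewrite Km].
  by apply: Kx; [rewrite L0 (le_trans L1 (ltW u0u))|rewrite Lm em].
- move=> v /andP[v0' vs]; rewrite Lm; have [vu|uv] := leP v u0.
    split; first by apply: jump_modulus_ge; rewrite ?v0' //; case/andP: u01.
    by move=> e _; apply: Lx; rewrite ?v0'.
  have lt : `|jump x v| < jump_modulus x u0.
    by apply: le_lt_trans (small v uv vs) _; exact: lt_le_trans big.
  by split; [exact: ltW|move=> e; rewrite e ltxx in lt].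
Qed.

(* At a record time of the modulus the trimmed path inherits the previous
   record; at any other time it keeps its own jump. *)
Lemma jump_Mtrim1 x s : cadlag01 x -> no_ties x -> 0 <= s <= 1 ->
  jump (Mtrim1 x) s != 0 -> exists sigma : R, jump (Mtrim1 x) s = jump x sigma /\
  ((sigma = s /\ exists2 l : R, 0 <= l < s & `|jump x s| < `|jump x l|) \/
   [/\ 0 <= sigma < s, `|jump x sigma| <= `|jump x s| &
     forall v : R, 0 <= v < s -> `|jump x v| <= `|jump x sigma| /\
      (`|jump x v| = `|jump x sigma| -> jump x v != 0 -> v <= sigma)]).
Proof.
move=> cx nt s01; have [s0|sp] := leP s 0; first by rewrite jump0// eqxx.
have s01' : 0 < s <= 1 by rewrite sp; case/andP: s01.
have s1 : s <= 1 by case/andP: s01.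
have [l [r r0 [l0s hl hv]]] := left_record cx s01'.
have [l0 ls] := andP l0s.
(* The subtracted term moves from the jump at the record [l] left of [s] to the jump at the record
   time for [s]. *)
have jE : jump (Mtrim1 x) s = jump x s - (jump x (Ltilde x s) - jump x l).
  apply: jump_eqP => // e e0; have [r' r'0 hr'] := jump_leftP cx s01' e0.
  exists (Num.min r r'); first by rewrite lt_min r0.
  move=> u ru us.
  have [ru1 ru2] : s - r < u /\ s - r' < u.
    by split; apply: le_lt_trans ru; rewrite lerD2l lerN2 ge_min lexx ?orbT.
  rewrite /Mtrim1 (hl u ru1 us); have := hr' u ru2 us.
  by rewrite subrBBB.
have [/andP[L0 L1] Lm Lx] := LtildeP cx s01.
rewrite jE; have [Ls|nLs] := eqVneq (Ltilde x s) s.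
  rewrite Ls opprB addrC subrK => _; exists l; split=> //; right; split=> //.
  rewrite Ls in Lm; rewrite Lm; apply: jump_modulus_ge => //.
  by rewrite l0 ltW.
have Lls : Ltilde x s < s by rewrite lt_neqAle nLs.
have hL := hv (Ltilde x s) ltac:(by rewrite L0).
have lm : `|jump x l| <= jump_modulus x s by rewrite jump_modulus_ge// l0 ltW.
have el : `|jump x (Ltilde x s)| = `|jump x l| by apply/eqP; rewrite eq_le hL.1 Lm.
have sm : `|jump x s| <= jump_modulus x s by rewrite jump_modulus_ge// ltW// lexx.
have [jl0|jl0] := eqVneq (jump x l) 0.
  have jL0 : jump x (Ltilde x s) = 0 by apply/normr0_eq0; rewrite el jl0 normr0.
  have js0 : jump x s = 0.
    by apply/normr0_eq0/eqP; rewrite eq_le normr_ge0 andbT (le_trans sm)// -Lm jL0 normr0.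
  by rewrite jl0 jL0 js0 subrr subr0 eqxx.
have Ll : Ltilde x s = l.
  apply: (nt _ _ _ _ el); first by rewrite L0 (le_trans L1).
    by rewrite l0 (le_trans (ltW ls)).
  by rewrite -normr_gt0 el normr_gt0.
rewrite Ll subrr subr0 => js; exists s; split=> //; left; split=> //.
exists l => //; rewrite lt_neqAle -el Lm sm andbT; apply/eqP => e.
by have := Lx s ltac:(by rewrite ltW//= lexx) e; rewrite leNgt Lls.
Qed.

(** Two jumps of equal modulus, at [s < t], come from one jump of [x], at time [a]. As [a <= s < t],
    the time [t] is a record time and [a] the record just before it. If [a = s], then [s] was not a
    record, and an earlier larger jump contradicts the maximality of [a]. If [a < s], then [s] was a
    record at least as large as [a], so [a] was not the latest before [t]. *)
Lemma Mtrim1_no_ties x : cadlag01 x -> no_ties x -> no_ties (Mtrim1 x).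
Proof.
move=> cx nt.
suff key s t : 0 <= s <= 1 -> 0 <= t <= 1 -> `|jump (Mtrim1 x) s| = `|jump (Mtrim1 x) t| ->
    jump (Mtrim1 x) s != 0 -> s < t -> False.
  move=> s t s01 t01 st s0; have [h|h|//] := ltgtP s t; first by case: (key s t).
  by case: (key t s) => //; rewrite -normr_gt0 -st normr_gt0.
move=> s01 t01 st s0 lt.
have t0 : jump (Mtrim1 x) t != 0 by rewrite -normr_gt0 -st normr_gt0.
have [a [ea ha]] := jump_Mtrim1 cx nt s01 s0.
have [b [eb hb]] := jump_Mtrim1 cx nt t01 t0.
have a01 : 0 <= a <= s.
  case: ha => [[-> _]|[/andP[-> h] _ _]]; last by rewrite ltW.
  by rewrite lexx andbT; case/andP: s01.
have b01 : 0 <= b <= t.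
  case: hb => [[-> _]|[/andP[-> h] _ _]]; last by rewrite ltW.
  by rewrite lexx andbT; case/andP: t01.
have [[a0 as'] [b0 bt]] := (andP a01, andP b01).
have [[s00 s1] [t00 t1]] := (andP s01, andP t01).
have ab : a = b.
  apply: nt; rewrite ?a0 ?b0 ?(le_trans as') ?(le_trans bt)//.
    by rewrite -ea -eb.
  by rewrite -ea.
subst b; rewrite ea in s0.
case: hb => [[at' _]|[_ _ hb]]; first by move: as'; rewrite at' leNgt lt.
have sv : 0 <= s < t by rewrite s00.
case: ha => [[as0 [l /andP[l0 ls] hl]]|[/andP[_ as0] js _]].
  have [h _] := hb l ltac:(by rewrite l0 (lt_trans ls)).
  by move: hl; rewrite -as0 ltNge h.
have [h1 h2] := hb s sv.
have e : `|jump x s| = `|jump x a| by apply/eqP; rewrite eq_le h1.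
have js0 : jump x s != 0 by rewrite -normr_gt0 e normr_gt0.
by have := h2 e js0; rewrite leNgt as0.
Qed.

End ModulusTrimming.

Section Iterates.
Context {R : realType}.
Implicit Types (x : R -> R) (r : nat).

Section Iter.
Variable T : (R -> R) -> R -> R.
Hypothesis Tcadlag : forall x, cadlag01 x -> cadlag01 (T x).
Hypothesis Tno_ties : forall x, cadlag01 x -> no_ties x -> no_ties (T x).
Hypothesis Tcvg : forall (u : nat -> R -> R) x,
  (forall n, cadlag01 (u n)) -> cadlag01 x -> no_ties x -> J1_cvg u x ->
  J1_cvg (fun n => T (u n)) (T x).

Lemma iter_cadlag r x : cadlag01 x -> cadlag01 (iter r T x).
Proof. by move=> cx; elim: r => [//|r ih]; exact: Tcadlag. Qed.

Lemma iter_no_ties r x : cadlag01 x -> no_ties x -> no_ties (iter r T x).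
Proof.
by move=> cx nt; elim: r => [//|r ih]; apply: Tno_ties => //; exact: iter_cadlag.
Qed.

Lemma iter_J1_cvg r (u : nat -> R -> R) x :
  (forall n, cadlag01 (u n)) -> cadlag01 x -> no_ties x -> J1_cvg u x ->
  J1_cvg (fun n => iter r T (u n)) (iter r T x).
Proof.
move=> cu cx nt h; elim: r => [//|r ih].
apply: Tcvg ih => [n||]; [exact: iter_cadlag|exact: iter_cadlag|exact: iter_no_ties].
Qed.

End Iter.

End Iterates.

(** * Continuous mapping for J1 weak convergence *)

Section Envelope.
Context {R : realType}.
Implicit Types (x y u : R -> R) (h g : (R -> R) -> R) (e M k : R).

Definition J1_continuous_at h x := forall u : nat -> R -> R,
  (forall n, cadlag01 (u n)) -> J1_cvg u x -> h (u n) @[n --> \oo] --> h x.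

(* The largest minorant of [min h M] that is [k]-Lipschitz for [J1_close]. *)
Definition lipschitz_minorant h M k x : R :=
  inf [set v | v = M \/ exists y e, [/\ cadlag01 y, J1_close x y e & v = h y + k * e]].

Section Fixed.
Variables (h : (R -> R) -> R) (M : R).
Hypothesis hM : forall x, 0 <= h x <= M.

Let M0 : 0 <= M.
Proof. by case/andP: (hM id) => h0; exact: le_trans. Qed.

Let lb x k : 0 <= k -> lbound [set v | v = M \/
  exists y e, [/\ cadlag01 y, J1_close x y e & v = h y + k * e]] 0.
Proof.
move=> k0 v [->//|[y [e [_ xy ->]]]].
apply: addr_ge0; first by case/andP: (hM y).
by apply: mulr_ge0 => //; exact: J1_close_ge0 xy.
Qed.

Lemma lipschitz_minorant_le x k v : 0 <= k ->
  (v = M \/ exists y e, [/\ cadlag01 y, J1_close x y e & v = h y + k * e]) ->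
  lipschitz_minorant h M k x <= v.
Proof. by move=> k0 hv; apply: ge_inf => //; exists 0; exact: lb. Qed.

Lemma lipschitz_minorant_ge x k c :
  c <= M -> (forall y e, cadlag01 y -> J1_close x y e -> c <= h y + k * e) ->
  c <= lipschitz_minorant h M k x.
Proof.
move=> cM hc; apply: lb_le_inf; first by exists M; left.
by move=> v [->//|[y [e [cy xy ->]]]]; exact: hc.
Qed.

Lemma lipschitz_minorant_range x k : 0 <= k -> 0 <= lipschitz_minorant h M k x <= M.
Proof.
move=> k0; rewrite lipschitz_minorant_le ?andbT//; last by left.
apply: lb_le_inf; [by exists M; left|exact: lb].
Qed.

Lemma lipschitz_minorant_le_self x k : 0 <= k -> cadlag01 x ->
  lipschitz_minorant h M k x <= h x.
Proof.
move=> k0 cx; apply: lipschitz_minorant_le => //; right; exists x, 0; split=> //.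
  exact: J1_close_refl.
by rewrite mulr0 addr0.
Qed.

(** A competitor [y] at tolerance [e'] from [u] is a competitor at tolerance [e + e'] from [x]. *)
Lemma lipschitz_minorant_lip x u k e : 0 <= k -> J1_close x u e ->
  lipschitz_minorant h M k x <= lipschitz_minorant h M k u + k * e.
Proof.
move=> k0 xu; have ke : 0 <= k * e by apply: mulr_ge0 => //; exact: J1_close_ge0 xu.
rewrite -lerBlDr; apply: lipschitz_minorant_ge => [|y e' cy uy].
  by rewrite lerBlDr ler_wpDr//; apply: lipschitz_minorant_le => //; left.
rewrite lerBlDr; apply: lipschitz_minorant_le => //; right; exists y, (e + e').
split=> //; first exact: J1_close_trans uy.
by rewrite mulrDr [k * e + _]addrC addrA.
Qed.

Lemma lipschitz_minorant_continuous k : 0 <= k ->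
  J1_continuous (lipschitz_minorant h M k).
Proof.
move=> k0 u x cu cx ux; apply/cvgrPdist_le => e e0.
(* [k + 1] instead of [k] keeps the quotient meaningful for [k = 0]. *)
have d0 : 0 < e / (k + 1) by rewrite divr_gt0// ltr_wpDl.
have := ux _ d0; apply: filterS => n xu.
have kd : k * (e / (k + 1)) <= e.
  rewrite mulrA ler_pdivrMr ?ltr_wpDl// mulrC ler_pM2l//; lra.
have h1 := lipschitz_minorant_lip k0 xu.
have h2 := lipschitz_minorant_lip k0 (J1_close_sym xu).
move: h1 h2; move: (lipschitz_minorant _ _ _ _) (lipschitz_minorant _ _ _ _) => a b.
by move: kd; move: (k * _) => q; clear; rewrite ler_norml => ? ? ?; apply/andP; split; lra.
Qed.

Lemma J1_continuous_at_close x e : cadlag01 x -> J1_continuous_at h x -> 0 < e ->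
  exists2 r, 0 < r & forall y, cadlag01 y -> J1_close x y r -> `|h x - h y| <= e.
Proof.
move=> cx hx e0; apply: contrapT => hn.
have /choice[u hu] : forall n : nat, exists y,
    [/\ cadlag01 y, J1_close x y n.+1%:R^-1 & ~ `|h x - h y| <= e].
  move=> n; apply: contrapT => hn'; apply: hn; exists n.+1%:R^-1; first by rewrite invr_gt0.
  by move=> y cy xy; apply: contrapT => hy; apply: hn'; exists y.
have : J1_cvg u x.
  move=> r r0; near=> n; have [_ xy _] := hu n; apply: J1_close_le xy.
  by apply: ltW; near: n; exact: (near_infty_natSinv_lt (PosNum r0)).
move=> /(hx _ (fun n => let: And3 c _ _ := hu n in c)) /cvgrPdist_le /(_ e e0) [n _ hn'].
by have [_ _] := hu n; apply; apply: hn' => /=.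
Unshelve. all: by end_near. Qed.

(** Competitors within [r] of [x] have values within [e] of [h x]; farther ones pay a penalty above
    [k * r], which exceeds [M] once [k >= M / r]. *)
Lemma lipschitz_minorant_cvg x : cadlag01 x -> J1_continuous_at h x ->
  lipschitz_minorant h M k%:R x @[k --> \oo] --> h x.
Proof.
move=> cx hx; apply/cvgrPdist_le => e e0.
have [r r0 hr] := J1_continuous_at_close cx hx e0.
near=> k.
have k0 : 0 <= k%:R :> R by [].
have kM : M / r <= k%:R by near: k; exact: nbhs_infty_ger.
rewrite ler_pdivrMr// in kM.
have h1 := lipschitz_minorant_le_self k0 cx.
rewrite ger0_norm ?subr_ge0// lerBlDr -lerBlDl.
apply: lipschitz_minorant_ge => [|y d cy xy].
  rewrite lerBlDr ler_wpDr ?(ltW e0)//; by case/andP: (hM x).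
have [dr|rd] := leP d r.
  have := hr y cy (J1_close_le dr xy); rewrite ler_norml => /andP[_].
  have : 0 <= k%:R * d by apply: mulr_ge0 => //; exact: J1_close_ge0 xy.
  by move: (k%:R * d) => q; clear; lra.
have : k%:R * r <= k%:R * d by rewrite ler_wpM2l// ltW.
have /andP[hx0 hx1] := hM x; have /andP[hy0 _] := hM y.
by move: kM; move: (k%:R * d) (k%:R * r) => q q'; clear -hx1 hy0 e0; lra.
Unshelve. all: by end_near. Qed.

End Fixed.

End Envelope.

(** * Approximation by countably many step paths, and measurability of J1-continuous functionals *)

Section Discretization.
Context {R : realType}.
Implicit Types (x : R -> R) (s t u e : R) (N : nat) (ts : seq R).

(** Times and values lie on one grid of mesh [1 / N]. Integer data make these paths countably many
    for each [N]; on [[0, 1]] the index is at most [N], so [inord] does not fall back on its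
    default. *)
Definition step_path N (k : {ffun 'I_N.+1 -> int}) (s : R) : R :=
  (k (inord (Num.truncn (N%:R * s))))%:~R / N%:R.

Definition quantized_sample N x : {ffun 'I_N.+1 -> int} :=
  [ffun i : 'I_N.+1 => Num.floor (N%:R * x (i%:R / N%:R))].

Lemma step_path_cadlag N (k : {ffun 'I_N.+1 -> int}) : (0 < N)%N ->
  cadlag01 (step_path k).
Proof.
move=> N0; have Np : 0 < N%:R :> R by rewrite ltr0n.
apply/cadlag01P => e e0; exists [seq i%:R / N%:R | i <- iota 0 N.+1].
move=> s u s0 su u1 ns.
suff -> : step_path k s = step_path k u by rewrite subrr normr0 ltW.
suff e1 : Num.truncn (N%:R * s) = Num.truncn (N%:R * u) by rewrite /step_path e1.
have us : 0 <= N%:R * s := mulr_ge0 (ltW Np) s0.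
have uu : 0 <= N%:R * u := mulr_ge0 (ltW Np) (le_trans s0 su).
apply/eqP; rewrite eqn_leq le_truncn ?ler_pM2l//=.
rewrite leqNgt; apply/negP => lt; apply: ns.
exists ((Num.truncn (N%:R * u))%:R / N%:R).
  apply: (map_f (fun i : nat => i%:R / N%:R)); rewrite mem_iota add0n /=.
  rewrite ltnS -(ler_nat R); apply: (@le_trans _ _ (N%:R * u)); first by rewrite truncn_le.
  by rewrite -[leRHS]mulr1 ler_pM2l.
rewrite ltr_pdivlMr// ler_pdivrMr// ![_ * N%:R]mulrC truncn_le uu andbT.
by rewrite -truncn_lt_nat.
Qed.

Definition tent s := Num.max 0 (1 - `|s|).

Lemma tent_out s : 1 <= `|s| -> tent s = 0.
Proof. by move=> h; rewrite /tent max_l// subr_le0. Qed.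

Lemma tent_range s : 0 <= tent s <= 1.
Proof.
rewrite /tent le_max lexx /= ge_max ler01 /= lerBlDr lerDl; exact: normr_ge0.
Qed.

Lemma tent_lip s t : `|tent s - tent t| <= `|s - t|.
Proof.
have h := ler_dist_dist s t; have h0 := normr_ge0 (s - t).
rewrite /tent; move: h h0; move: `|s| `|t| `|s - t| => a b c.
by rewrite !ler_norml; case: (leP 0 (1 - a)) => ha; case: (leP 0 (1 - b)) => hb; lra.
Qed.

Lemma nat_ceil t : 0 <= t -> exists n : nat, n%:R - 1 < t <= n%:R.
Proof.
move=> t0; have [h|h] := eqVneq t (Num.truncn t)%:R.
  by exists (Num.truncn t); rewrite -h lexx andbT; lra.
exists (Num.truncn t).+1; have /andP[h1 h2] := truncn_itv t0.
rewrite -natr1 addrK (ltW (lt_le_trans h2 _)) ?natr1// andbT.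
by rewrite lt_neqAle eq_sym h.
Qed.

(* A time change moving every point of [ts] up to the grid of mesh [1/N]:
   the identity plus one small tent at each point of [ts]. *)
Lemma grid_time_change ts g N : (0 < N)%N -> uniq ts -> 0 < g ->
  (forall t, t \in ts -> 0 <= t <= 1) ->
  (forall s t, s \in [:: 0, 1 & ts] -> t \in [:: 0, 1 & ts] -> `|s - t| < g -> s = t) ->
  (size ts)%:R < N%:R * g ->
  exists lam, [/\ time_change lam,
    forall s, `|lam s - s| <= (size ts)%:R / N%:R &
    forall t, t \in ts -> exists n : nat, n%:R - 1 < N%:R * t <= n%:R /\ lam t = n%:R / N%:R].
Proof.
move=> N0 uts g0 ts01 hg Ng; have Np : 0 < N%:R :> R by rewrite ltr0n.
have /choice[c hc] : forall t, exists n : nat, 0 <= t -> n%:R - 1 < N%:R * t <= n%:R.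
  move=> t; have [t0|t0] := leP 0 t; last by exists 0%N.
  by have [n hn] := @nat_ceil (N%:R * t) (mulr_ge0 (ltW Np) t0); exists n.
(* [D t] is the upward distance from [t] to the grid. The tents have half-width [g], so each
   vanishes at every other point of [ts]. *)
pose D t := (c t)%:R / N%:R - t.
have Dr t : 0 <= t -> 0 <= D t <= N%:R^-1.
  move=> /hc /andP[h1 h2]; rewrite /D subr_ge0 ler_pdivlMr// mulrC h2 /=.
  by rewrite lerBlDr ler_pdivrMr// mulrDl mulVf ?gt_eqF// mulrC; clear -h1; lra.
have gi : 0 <= g^-1 by rewrite invr_ge0 ltW.
pose S s := \sum_(t <- ts) D t * tent ((s - t) / g).
have Slip s u : `|S s - S u| <= (size ts)%:R / (N%:R * g) * `|s - u|.
  rewrite /S -sumrB; apply: le_trans (ler_norm_sum _ _ _) _.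
  rewrite -sum1_size natr_sum !mulr_suml big_seq [leRHS]big_seq.
  apply: ler_sum => t tts; rewrite mul1r -mulrBr normrM invfM -mulrA.
  have /andP[t0 _] := ts01 t tts; have /andP[D0 D1] := Dr t t0.
  apply: ler_pM => //; first by rewrite ger0_norm.
  apply: le_trans (tent_lip _ _) _.
  have -> : (s - t) / g - (u - t) / g = g^-1 * (s - u) by ring.
  by rewrite normrM (ger0_norm gi).
set q := (size ts)%:R / (N%:R * g).
(* The sum of tents is [q]-Lipschitz with [q < 1], so adding it to the identity leaves a strictly
   increasing map. *)
have q1 : q < 1 by rewrite ltr_pdivrMr ?mulr_gt0// mul1r.
have q0 : 0 <= q by rewrite divr_ge0// mulr_ge0// ltW.
(* The endpoints stay fixed: being grid points they have zero displacement if listed in [ts], and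
   all remaining points of [ts] are at distance at least [g]. *)
have S01 s : s \in [:: 0; 1] -> S s = 0.
  move=> s01; rewrite /S big_seq big1// => t tts.
  have [->|st] := eqVneq t s.
    rewrite /D; suff -> : (c s)%:R / N%:R = s by rewrite subrr mul0r.
    apply: (canLR (mulfK _)); rewrite ?gt_eqF//.
    have := hc s; move: s01; rewrite !inE => /orP[] /eqP -> /(_ ltac:(lra)) /andP[].
      rewrite mulr0 mul0r => h _; apply/eqP; rewrite pnatr_eq0 -leqn0 -ltnS -(ltr_nat R).
      by clear -h; lra.
    rewrite mulr1 mul1r ler_nat => h h'; apply/eqP; rewrite eqr_nat eqn_leq h' andbT.
    by rewrite -ltnS -(ltr_nat R) -natr1; clear -h; lra.
  rewrite tent_out ?mulr0//.
  rewrite normrM (ger0_norm gi) ler_pdivlMr// mul1r leNgt.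
  apply/negP => /hg h; move/eqP: st; apply; apply/esym/h.
    by move: s01; rewrite !inE => /orP[] ->; rewrite ?orbT.
  by rewrite !inE tts !orbT.
pose lam s := s + S s.
have lip s u : `|lam s - lam u| <= 2 * `|s - u|.
  rewrite /lam opprD addrACA; apply: le_trans (ler_normD _ _) _.
  have := ler_wpM2r (normr_ge0 (s - u)) (ltW q1); have := Slip s u; rewrite -/q.
  by clear; lra.
exists lam; split.
- split.
  + by rewrite /lam S01 ?addr0 ?inE ?eqxx.
  + by rewrite /lam S01 ?addr0 ?inE ?eqxx ?orbT.
  + apply: continuous_subspaceT => s; apply/cvgrPdist_le => e e0.
    exists (e / 2) => /=; first by rewrite divr_gt0.
    move=> u /= su; apply: le_trans (lip _ _) _; clear -su; lra.
  + move=> s u s0 su u1; rewrite /lam.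
    have us : 0 <= u - s by rewrite subr_ge0 ltW.
    have := Slip u s; rewrite -/q (ger0_norm us) ler_norml => /andP[h _].
    have h' : q * (u - s) < 1 * (u - s) by rewrite ltr_pM2r// subr_gt0.
    by clear -h h'; lra.
- move=> s; rewrite /lam addrAC subrr add0r.
  apply: le_trans (ler_norm_sum _ _ _) _.
  rewrite -sum1_size natr_sum !mulr_suml big_seq [leRHS]big_seq.
  apply: ler_sum => t tts; rewrite mul1r normrM.
  have /andP[t0 _] := ts01 t tts; have /andP[D0 D1] := Dr t t0.
  have /andP[T0 T1] := tent_range ((s - t) / g).
  by rewrite -[leRHS]mulr1; apply: ler_pM => //; rewrite ger0_norm.
- move=> t tts; have /andP[t0 _] := ts01 t tts; exists (c t); split; first exact: hc.
  rewrite /lam /S (bigD1_seq t)//= subrr mul0r /tent normr0 subr0 max_r// mulr1.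
  rewrite big_seq_cond big1; first by rewrite addr0 /D addrC subrK.
  move=> v /andP[vts vt]; rewrite -/(tent _) tent_out ?mulr0//.
  rewrite normrM (ger0_norm gi) ler_pdivlMr// mul1r leNgt.
  apply/negP => /hg h; move/eqP: vt; apply; apply/esym/h; rewrite !inE ?tts ?vts !orbT //.
Qed.

(** Once the partition points of [x] are moved onto the grid, [s] and the grid time sampled at
    [lam s] lie in the same cell of [x]. The error is then [e / 2] for the oscillation plus [1 / N]
    for rounding the value. *)
Lemma step_path_J1_cvg x : cadlag01 x ->
  J1_cvg (fun n => step_path (quantized_sample n.+1 x)) x.
Proof.
move=> cx e e0; have e20 : 0 < e / 2 by lra.
have [ts0 hts0] := cadlag01_osc cx e20.
pose ts := undup [seq t <- ts0 | 0 <= t <= 1].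
have ts01 t : t \in ts -> 0 <= t <= 1 by rewrite mem_undup mem_filter => /andP[].
have hts : osc_le x (e / 2) ts.
  move=> s u s0 su u1 ns; apply: hts0 => // -[t tts /andP[st tu]]; apply: ns.
  exists t; rewrite ?st// mem_undup mem_filter tts andbT (le_trans s0 (ltW st)).
  exact: le_trans u1.
have [g g0 hg] := seq_gap [:: 0, 1 & ts].
pose m : R := (size ts)%:R + 1.
have m0 : 0 < m by rewrite /m ltr_wpDl.
pose K := Num.max (m / g) (m * 2 / e).
near=> n.
have Np : 0 < n.+1%:R :> R by rewrite ltr0n.
have nK : K <= n.+1%:R.
  apply: (@le_trans _ _ n%:R); last by rewrite ler_nat.
  by near: n; exact: nbhs_infty_ger.
have [nK1 nK2] : m / g <= n.+1%:R /\ m * 2 / e <= n.+1%:R.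
  by move: nK; rewrite ge_max => /andP[].
rewrite ler_pdivrMr// in nK1; rewrite ler_pdivrMr// in nK2.
have szg : (size ts)%:R < n.+1%:R * g by apply: lt_le_trans nK1; rewrite /m ltrDl.
have [lam [tl l1 l2]] := grid_time_change (ltn0Sn n) (undup_uniq _) g0 ts01 hg szg.
exists lam; split=> // s s01; have ls01 := tc_range tl s01.
have sz0 : 0 <= (size ts)%:R :> R by [].
split.
  apply: le_trans (l1 s) _; rewrite ler_pdivrMr// mulrC; apply: le_trans nK2.
  by rewrite /m; clear -sz0; lra.
have Nls0 : 0 <= n.+1%:R * lam s by apply: mulr_ge0 (ltW Np) _; case/andP: ls01.
pose r := (Num.truncn (n.+1%:R * lam s))%:R / n.+1%:R : R.
have stepE : step_path (quantized_sample n.+1 x) (lam s) =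
    (Num.floor (n.+1%:R * x r))%:~R / n.+1%:R.
  rewrite /step_path /quantized_sample ffunE inordK// ltnS -(ler_nat R).
  apply: (@le_trans _ _ (n.+1%:R * lam s)); first by rewrite truncn_le.
  by rewrite -[leRHS]mulr1 ler_pM2l//; case/andP: ls01.
have r0 : 0 <= r by rewrite divr_ge0.
have r1 : r <= 1.
  rewrite ler_pdivrMr// mul1r; apply: (@le_trans _ _ (n.+1%:R * lam s)).
    by rewrite truncn_le.
  by rewrite -[leRHS]mulr1 ler_pM2l//; case/andP: ls01.
(* Both sides say that the grid point just above [t], namely [lam t], does not exceed [lam s]. *)
have key t : t \in ts -> (t <= s) = (t <= r).
  move=> tts; have [k [/andP[k1 k2] lk]] := l2 t tts; have t01 := ts01 t tts.
  rewrite /r ler_pdivlMr// mulrC -(tc_leE tl t01 s01) lk ler_pdivrMr// [lam s * _]mulrC.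
  apply/idP/idP => h.
    apply: le_trans k2 _; rewrite ler_nat truncn_ge_nat//.
  rewrite -truncn_ge_nat// -ltnS -(ltr_nat R) -natr1.
  by apply: lt_le_trans (_ : n.+1%:R * t + 1 <= _); [clear -k1; lra|rewrite lerD2r].
have xr : `|x s - x r| <= e / 2.
  case/andP: s01 => s0 s1.
  have [sr|/ltW rs] := leP s r.
    apply: hts => // -[t tts /andP[st tr]].
    by have := key t tts; rewrite tr leNgt st.
  rewrite distrC; apply: hts => // -[t tts /andP[st tr]].
  by have := key t tts; rewrite tr [t <= r]leNgt st.
have fl : `|(Num.floor (n.+1%:R * x r))%:~R / n.+1%:R - x r| <= n.+1%:R^-1.
  have /andP[f1 f2] := floor_itv (n.+1%:R * x r).
  rewrite intrD in f2; rewrite ler_norml.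
  rewrite lerBrDr lerBlDr !ler_pdivlMr ?ler_pdivrMr// mulrDl mulNr mulVf ?gt_eqF//.
  rewrite mulrDl mulVf ?gt_eqF// ![x r * _]mulrC.
  by apply/andP; split; [clear -f2; lra|clear -f1; lra].
have inv : n.+1%:R^-1 <= e / 2.
  rewrite -[leLHS]mul1r ler_pdivrMr// mulrC; apply: le_trans (_ : m * 2 / 2 / 1 <= _).
    by rewrite /m; clear -sz0; lra.
  by clear -nK2; lra.
rewrite stepE; apply: le_trans (ler_distD (x r) _ _) _.
by rewrite [`|x r - _|]distrC; apply: le_trans (lerD fl xr) _; rewrite [leRHS](splitr e) lerD2r.
Unshelve. all: by end_near. Qed.

Lemma J1_continuous_measurable d (T : measurableType d) (W : T -> R -> R)
    (F : (R -> R) -> R) :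
  J1_continuous F -> (forall w, cadlag01 (W w)) ->
  (forall s, 0 <= s <= 1 -> measurable_fun setT (fun w => W w s)) ->
  measurable_fun setT (fun w => F (W w)).
Proof.
move=> cF cW mW.
apply: (@measurable_realfun.measurable_fun_cvg _ _ _ _
  (fun n w => F (step_path (quantized_sample n.+1 (W w))))); last first.
  move=> w _; apply: cF => //; first by move=> n; exact: step_path_cadlag.
  exact: step_path_J1_cvg.
move=> n _ B mB; rewrite setTI.
pose A (k : {ffun 'I_n.+2 -> int}) := [set w | quantized_sample n.+1 (W w) = k].
have mA k : measurable (A k).
  (* The finitely many coordinate conditions, padded with [setT] into a countable intersection. *)
  pose G (j : nat) := if insub j is Some i then
    [set w | (quantized_sample n.+1 (W w)) i = k i] else setT.
  rewrite (_ : A k = \bigcap_j G j).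
    apply: bigcapT_measurable => j; rewrite /G; case: insubP => [i _ _|_]; last by [].
    have mi : measurable_fun setT (fun w => W w (i%:R / n.+1%:R)).
      apply: mW; rewrite divr_ge0//= ler_pdivrMr ?ltr0n// mul1r ler_nat -ltnS.
      exact: ltn_ord.
    have Np : 0 < n.+1%:R :> R by rewrite ltr0n.
    rewrite (_ : mkset _ = setT `&` (fun w => W w (i%:R / n.+1%:R)) @^-1`
      `[(k i)%:~R / n.+1%:R, (k i + 1)%:~R / n.+1%:R[); first exact: mi.
    rewrite setTI; apply/seteqP; split=> w /=; rewrite ffunE in_itv/= ler_pdivrMr//
      ltr_pdivlMr// ![_ * n.+1%:R]mulrC -floor_eq; first by move=> ->.
    by move/eqP.
  apply/seteqP; split=> [w wk j _|w h]; first by rewrite /G; case: insub => //= i; rewrite wk.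
  by apply/ffunP => i; have := h i I; rewrite /G valK.
(* The preimage is a union over all integer samples, enumerated through [unpickle]; nothing is
   required of [F] on the individual step paths. *)
pose E (j : nat) := if unpickle j is Some k then
  (if `[< B (F (step_path (k : {ffun 'I_n.+2 -> int}))) >] then A k else set0) else set0.
rewrite (_ : _ @^-1` B = \bigcup_j E j).
  apply: bigcupT_measurable => j; rewrite /E; case: unpickle => // k.
  by case: ifP.
apply/seteqP; split=> [w Bw|w [j _]].
  exists (pickle (quantized_sample n.+1 (W w))) => //.
  by rewrite /E pickleK; case: asboolP.
by rewrite /E; case: unpickle => // k; case: asboolP => // Bk wk; rewrite /preimage /= wk.
Qed.

End Discretization.

Section Mapping.
Context {R : realType}.

(* Neither function is assumed measurable: the integral of a nonnegative
   function is a supremum over the simple functions below it. *)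
Lemma ge0_integral_le d (T : measurableType d) (mu : {measure set T -> \bar R})
    (f g : T -> \bar R) : (forall x, 0 <= f x)%E -> (forall x, f x <= g x)%E ->
  (\int[mu]_x f x <= \int[mu]_x g x)%E.
Proof.
move=> f0 fg; have g0 x : (0 <= g x)%E := Order.le_trans (f0 x) (fg x).
rewrite !ge0_integralTE//; apply: ereal_sup_le => _ [h hf <-].
by exists h => // x; exact: Order.le_trans (hf x) (fg x).
Qed.

Lemma bounded_integral_range d (T : measurableType d) (P : probability T R)
    (f : T -> R) (M : R) : (forall x, 0 <= f x <= M) ->
  (0 <= \int[P]_x (f x)%:E <= M%:E)%E.
Proof.
move=> fM; apply/andP; split.
  by apply: integral_ge0 => x _; rewrite lee_fin; case/andP: (fM x).
have -> : M%:E = (\int[P]_x (cst M%:E x))%E.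
  by rewrite integral_cst// [X in _ = (_ * X)%E](probability_setT P) mule1.
by apply: ge0_integral_le => x; rewrite lee_fin; case/andP: (fM x).
Qed.

Lemma bounded_integral_fin_num d (T : measurableType d) (P : probability T R)
    (f : T -> R) (M : R) : (forall x, 0 <= f x <= M) -> (\int[P]_x (f x)%:E)%E \is a fin_num.
Proof.
move=> /(bounded_integral_range P) /andP[h1 h2].
by rewrite ge0_fin_numE//; apply: le_lt_trans h2 _; rewrite ltry.
Qed.

Lemma sandwich_cvg (F : set_system R) (FF : Filter F) (A : R -> R) (l : R)
    (lo up : nat -> R -> R) (L U : nat -> R) :
  (forall n, \forall t \near F, lo n t <= A t <= up n t) ->
  (forall n, lo n t @[t --> F] --> L n) -> (forall n, up n t @[t --> F] --> U n) ->
  (forall n, L n <= l <= U n) -> (U n - L n) @[n --> \oo] --> (0 : R) ->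
  A t @[t --> F] --> l.
Proof.
move=> hA hL hU hl h0; apply/cvgrPdist_le => e e0.
have e20 : 0 < e / 2 by rewrite divr_gt0.
have /cvgrPdist_le /(_ _ e20) [n _ /(_ n (leqnn n))] := h0.
rewrite /= sub0r normrN => hn.
have /cvgrPdist_le /(_ _ e20) h1 := hL n.
have /cvgrPdist_le /(_ _ e20) h2 := hU n.
have := hA n; move: h1 h2; apply: filterS3 => t.
have := hl n; move: hn; move: (L n) (U n) (lo n t) (up n t) (A t) => a b c d r.
rewrite !ler_norml => /andP[? ?] /andP[? ?] /andP[? ?] /andP[? ?] /andP[? ?].
by apply/andP; split; lra.
Qed.

Lemma time_lim_filter (b : bool) : ProperFilter (@time_lim R b).
Proof. by case: b; rewrite /time_lim; exact: _. Qed.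

Lemma near_time_lim_gt0 (b : bool) : \forall t \near @time_lim R b, 0 < t.
Proof. by case: b; rewrite /time_lim; [exact: nbhs_right_gt|exact: nbhs_pinfty_gt]. Qed.

(** [lo] comes from [h] and [up] from [M - h]. Their expectations converge by hypothesis, and
    dominated convergence, which is where measurability along [W] enters, closes the gap because
    both tend to [h] at every continuity point of [h]. *)
Lemma cvg_dist_J1_mapping_ge0 (at0 : bool)
    d (Omega : measurableType d) (P : probability Omega R) (Z : R -> Omega -> R -> R)
    d' (Omega' : measurableType d') (P' : probability Omega' R) (W : Omega' -> R -> R)
    (h : (R -> R) -> R) (M : R) :
  cvg_dist_J1 at0 P Z P' W ->
  (\forall t \near @time_lim R at0, forall w, cadlag01 (Z t w)) ->
  (forall w, cadlag01 (W w)) ->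
  (forall s, 0 <= s <= 1 -> measurable_fun setT (fun w => W w s)) ->
  (forall x, 0 <= h x <= M) ->
  P'.-negligible [set w | ~ J1_continuous_at h (W w)] ->
  (\int[P]_w (h (Z t w))%:E)%E @[t --> time_lim at0] --> (\int[P']_w (h (W w))%:E)%E.
Proof.
move=> cZ cadZ cadW mW hM nh.
have FF := time_lim_filter at0.
have hM' x : 0 <= M - h x <= M by have := hM x; lra.
pose lo (n : nat) := lipschitz_minorant h M n%:R.
pose up (n : nat) x := M - lipschitz_minorant (fun x => M - h x) M n%:R x.
have n0 (n : nat) : 0 <= n%:R :> R by [].
have loM n x : 0 <= lo n x <= M by exact: lipschitz_minorant_range.
have upM n x : 0 <= up n x <= M.
  by have := lipschitz_minorant_range hM' x (n0 n); rewrite /up; lra.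
have lo_le n x : cadlag01 x -> lo n x <= h x.
  by move=> cx; exact: lipschitz_minorant_le_self.
have le_up n x : cadlag01 x -> h x <= up n x.
  by move=> cx; have := lipschitz_minorant_le_self hM' (n0 n) cx; rewrite /up; lra.
have lo_cont n : J1_continuous (lo n) by exact: lipschitz_minorant_continuous.
have up_cont n : J1_continuous (up n).
  move=> u x cu cx ux; apply: cvgB; first exact: cvg_cst.
  exact: lipschitz_minorant_continuous cu cx ux.
have bdd (g : (R -> R) -> R) : (forall x, 0 <= g x <= M) -> bounded_fun_D g.
  by move=> gM; exists M => x; have /andP[g0 g1] := gM x; rewrite ger0_norm.
pose I (g : (R -> R) -> R) t := fine (\int[P]_w (g (Z t w))%:E)%E.
pose J (g : (R -> R) -> R) := fine (\int[P']_w (g (W w))%:E)%E.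
have IE (g : (R -> R) -> R) t : (forall x, 0 <= g x <= M) ->
    (\int[P]_w (g (Z t w))%:E)%E = (I g t)%:E.
  by move=> gM; rewrite fineK//; exact: bounded_integral_fin_num.
have JE (g : (R -> R) -> R) : (forall x, 0 <= g x <= M) ->
    (\int[P']_w (g (W w))%:E)%E = (J g)%:E.
  by move=> gM; rewrite fineK//; exact: bounded_integral_fin_num.
have cvgI (g : (R -> R) -> R) : (forall x, 0 <= g x <= M) -> J1_continuous g ->
    I g t @[t --> time_lim at0] --> J g.
  by move=> gM cg; have := cZ g cg (bdd g gM); rewrite JE// => /fine_cvg.
rewrite JE//; under eq_fun do rewrite IE//.
apply: cvg_EFin; first by apply: nearW.
apply: (@sandwich_cvg _ _ _ _ (fun n => I (lo n)) (fun n => I (up n))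
  (fun n => J (lo n)) (fun n => J (up n))).
- move=> n; move: cadZ; apply: filterS => t ct.
  rewrite -!lee_fin -!IE//; apply/andP; split; apply: ge0_integral_le => w;
    rewrite lee_fin.
  + by case/andP: (loM n (Z t w)).
  + exact: lo_le.
  + by case/andP: (hM (Z t w)).
  + exact: le_up.
- by move=> n; exact: cvgI.
- by move=> n; exact: cvgI.
- move=> n; rewrite -!lee_fin -!JE//; apply/andP; split; apply: ge0_integral_le => w;
    rewrite lee_fin.
  + by case/andP: (loM n (W w)).
  + exact: lo_le.
  + by case/andP: (hM (W w)).
  + exact: le_up.
have mlo n : measurable_fun setT (fun w => lo n (W w)).
  exact: J1_continuous_measurable.
have mup n : measurable_fun setT (fun w => up n (W w)).
  exact: J1_continuous_measurable.
pose gap n w := up n (W w) - lo n (W w).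
have gapM n w : 0 <= gap n w <= M.
  have := lo_le n _ (cadW w); have := le_up n _ (cadW w).
  by have := loM n (W w); have := upM n (W w); rewrite /gap; lra.
have mgap n : measurable_fun setT (gap n) by apply: measurable_funB.
have gapE n : J (up n) - J (lo n) = fine (\int[P']_w (gap n w)%:E)%E.
  apply: EFin_inj; rewrite EFinB -!JE// fineK; last first.
    by apply: (@bounded_integral_fin_num _ _ P' (gap n) M) => w; exact: gapM.
  have -> : (\int[P']_w (up n (W w))%:E = \int[P']_w (lo n (W w))%:E
      + \int[P']_w (gap n w)%:E)%E.
    rewrite -ge0_integralD//.
    + by apply: eq_integral => w _; rewrite -EFinD /gap addrC subrK.
    + by move=> w _; rewrite lee_fin; case/andP: (loM n (W w)).
    + by apply/measurable_EFinP.
    + by move=> w _; rewrite lee_fin; case/andP: (gapM n w).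
    + by apply/measurable_EFinP.
  by rewrite addeAC subee ?add0e// JE.
under eq_fun do rewrite gapE.
apply: (@fine_cvg _ _ _ _ _ 0%R).
have aecvg : {ae P', forall w, setT w ->
    (gap n w)%:E @[n --> \oo] --> (cst 0%E w : \bar R)}.
  apply: negligibleS nh => w /=; apply: contra_not => hw _.
  have hw' : J1_continuous_at (fun x => M - h x) (W w).
    by move=> u cu ux; apply: cvgB; [exact: cvg_cst|exact: hw].
  have c1 := lipschitz_minorant_cvg hM (cadW w) hw.
  have c2 := lipschitz_minorant_cvg hM' (cadW w) hw'.
  apply: cvg_EFin; first exact: nearW.
  rewrite (_ : 0 = M - (M - h (W w)) - h (W w)); last by ring.
  by apply: cvgB c1; apply: cvgB c2; exact: cvg_cst.
have aebd : {ae P', forall w n, setT w -> (`|(gap n w)%:E| <= cst M%:E w)%E}.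
  by apply: aeW => w n _; rewrite /= lee_fin; have /andP[g0 g1] := gapM n w; rewrite ger0_norm.
have mgap' n : measurable_fun setT (fun w => (gap n w)%:E) by apply/measurable_EFinP.
have [_ _] := dominated_convergence measurableT mgap' (measurable_cst _) aecvg
  (finite_measure_integrable_cst P' M measurableT) aebd.
rewrite integral_cst// mul0e; exact.
Qed.


End Mapping.

Section SignedMapping.
Context {R : realType}.

(** The constant sequence [x] converges to [y] under the identity time change. This makes values
    outside [[0, 1]] harmless. *)
Lemma J1_continuous_eq01 (g : (R -> R) -> R) (x y : R -> R) :
  J1_continuous g -> cadlag01 x -> cadlag01 y ->
  (forall s, 0 <= s <= 1 -> x s = y s) -> g x = g y.
Proof.
move=> cg cx cy xy.
have : J1_cvg (fun _ => x) y.
  move=> e e0; apply: nearW => n; exists id; split; first exact: time_change_id.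
  by move=> s s01; rewrite subrr normr0 xy// subrr normr0 ltW.
move=> /(cg _ _ (fun _ => cx) cy) h.
exact: (cvg_unique (@norm_hausdorff _ _) (cvg_cst _) h).
Qed.

Lemma pos_part_lip (a b : R) : `|Num.max a 0 - Num.max b 0| <= `|a - b|.
Proof.
have h := normr_ge0 (a - b).
case: (leP a 0) => a0; case: (leP b 0) => b0; rewrite ?subrr ?normr0//.
- by rewrite sub0r normrN distrC !ger0_norm; lra.
- by rewrite subr0 !ger0_norm; lra.
Qed.

Lemma J1_continuous_at_pos_part (g : (R -> R) -> R) x :
  J1_continuous_at g x -> J1_continuous_at (fun y => Num.max (g y) 0) x.
Proof.
move=> hg u cu ux; apply/cvgrPdist_le => e e0.
have /cvgrPdist_le /(_ e e0) := hg u cu ux; apply: filterS => n.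
exact/le_trans/pos_part_lip.
Qed.

(** The integral is the difference of those of the positive and negative parts, even without
    measurability. Each part is bounded and nonnegative and has a finite limit, so the difference
    converges. *)
Lemma cvg_dist_J1_mapping (at0 : bool)
    d (Omega : measurableType d) (P : probability Omega R) (Z : R -> Omega -> R -> R)
    d' (Omega' : measurableType d') (P' : probability Omega' R) (W : Omega' -> R -> R)
    (T : (R -> R) -> R -> R) :
  cvg_dist_J1 at0 P Z P' W ->
  (\forall t \near @time_lim R at0, forall w, cadlag01 (Z t w)) ->
  (forall w, cadlag01 (W w)) ->
  (forall s, 0 <= s <= 1 -> measurable_fun setT (fun w => W w s)) ->
  (forall x, cadlag01 x -> cadlag01 (T x)) ->
  (forall (u : nat -> R -> R) x, (forall n, cadlag01 (u n)) -> cadlag01 x ->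
     no_ties x -> J1_cvg u x -> J1_cvg (fun n => T (u n)) (T x)) ->
  P'.-negligible [set w | ~ no_ties (W w)] ->
  cvg_dist_J1 at0 P (fun t w => T (Z t w)) P' (fun w => T (W w)).
Proof.
move=> cZ cadZ cadW mW Tcad Tcvg nt g cg [M hM].
have FF := time_lim_filter (R := R) at0.
have M0 : 0 <= M := le_trans (normr_ge0 _) (hM id).
have main (f : (R -> R) -> R) : J1_continuous f -> (forall x, `|f x| <= M) ->
    [/\ (\int[P]_w (Num.max (f (T (Z t w))) 0)%:E)%E @[t --> time_lim at0]
          --> (\int[P']_w (Num.max (f (T (W w))) 0)%:E)%E &
        (\int[P']_w (Num.max (f (T (W w))) 0)%:E)%E \is a fin_num].
  move=> cf fM.
  have hf x : 0 <= Num.max (f (T x)) 0 <= M.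
    by rewrite le_max lexx orbT ge_max M0 andbT (le_trans (ler_norm _) (fM _)).
  split; last by apply: (@bounded_integral_fin_num _ _ _ P' _ M) => w; exact: hf.
  apply: (cvg_dist_J1_mapping_ge0 cZ cadZ cadW mW hf).
  apply: negligibleS nt => w /=; apply: contra_not => nw.
  apply: (@J1_continuous_at_pos_part (fun x => f (T x))) => u cu ux.
  by apply: cf; [move=> n; exact: Tcad|exact: Tcad|exact: Tcvg].
have cgN : J1_continuous (fun x => - g x) by move=> u x cu cx ux; apply: cvgN; exact: cg.
have [c1 f1] := main g cg hM.
have [c2 f2] := main _ cgN (fun x => (ltac:(by rewrite normrN))).
have E d0 (O : measurableType d0) (Q : probability O R) (V : O -> R -> R) :
    (\int[Q]_w (g (T (V w)))%:E = \int[Q]_w (Num.max (g (T (V w))) 0)%:E -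
      \int[Q]_w (Num.max (- g (T (V w))) 0)%:E)%E.
  rewrite [LHS]integralE; congr (_ - _)%E; apply: eq_integral => w _.
    by rewrite funeposE EFin_max.
  by rewrite funenegE EFin_max.
rewrite E; under eq_fun do rewrite E.
by apply: cvgeB => //; exact: fin_num_adde_defr.
Qed.

End SignedMapping.

(** * Equivariance of trimming under drift removal and rescaling *)

Section AffineEquivariance.
Context {R : realType}.
Variables (a b : R).
Hypothesis b0 : 0 < b.
Implicit Types (x y : R -> R) (s tau : R).

Definition affine_image x y := forall s, 0 <= s <= 1 -> y s = (x s - s * a) / b.

Lemma affine_cvg x s l (F : set_system R) {FF : Filter F} :
  x u @[u --> F] --> l -> id u @[u --> F] --> s ->
  (x u - u * a) / b @[u --> F] --> (l - s * a) / b.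
Proof.
move=> hx hs; apply: cvgM; last exact: cvg_cst.
by apply: cvgB => //; apply: cvgM => //; exact: cvg_cst.
Qed.

Lemma left_cvg_id s : id u @[u --> s^'-] --> s.
Proof. by apply: cvg_at_left_filter; exact: cvg_id. Qed.

Lemma affine_left_cvg x y s l : affine_image x y -> 0 < s <= 1 ->
  x u @[u --> s^'-] --> l -> y u @[u --> s^'-] --> (l - s * a) / b.
Proof.
move=> xy /andP[s0 s1] hx; apply: cvg_trans (affine_cvg hx (@left_cvg_id s)).
apply: near_eq_cvg; near=> u; rewrite xy//; apply/andP; split.
  by near: u; exact: nbhs_left_ge.
by apply: le_trans s1; near: u; apply: filterS (nbhs_left_lt s) => u /ltW.
Unshelve. all: by end_near. Qed.

Lemma affine_image_cadlag x y : cadlag01 x -> affine_image x y -> cadlag01 y.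
Proof.
move=> [xr xl] xy; split=> s s01.
  rewrite xy; last by lra.
  apply: cvg_trans (affine_cvg (xr s s01) (cvg_at_right_filter (@cvg_id _ (nbhs s)))).
  case/andP: s01 => s0 s1.
  apply: near_eq_cvg; near=> u; rewrite xy//; apply/andP; split.
    by apply: le_trans s0 _; near: u; apply: filterS (nbhs_right_gt s) => u /ltW.
  by near: u; apply: filterS (nbhs_right_lt s1) => u /ltW.
by have /cvg_ex[l hl] := xl s s01; exact: cvgP (affine_left_cvg xy s01 hl).
Unshelve. all: by end_near. Qed.

(** The linear drift is continuous, so only the factor [1 / b] reaches the jumps; dividing by a
    positive number then leaves all record times unchanged. *)
Lemma affine_jump x y s : cadlag01 x -> affine_image x y -> 0 <= s <= 1 ->
  jump y s = jump x s / b.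
Proof.
move=> cx xy s01; have [s0|sp] := leP s 0; first by rewrite !jump0// mul0r.
have s01' : 0 < s <= 1 by rewrite sp; case/andP: s01.
have h := affine_left_cvg xy s01' (jump_left_cvg cx s01').
rewrite /jump leNgt sp /= -/(jump x s) (cvg_lim (@norm_hausdorff _ _) h) xy//.
by rewrite /jump leNgt sp /=; ring.
Qed.

Lemma running_sup_scale (f g : R -> R) tau : finitely_above f -> finitely_above g ->
  0 <= tau <= 1 -> (forall s, 0 <= s <= 1 -> g s = f s / b) ->
  running_sup g tau = running_sup f tau / b.
Proof.
move=> ff fg t01 h; have st s : 0 <= s <= tau -> 0 <= s <= 1 by lra.
apply: le_anti; apply/andP; split.
  apply: running_sup_le => // s s0; rewrite h ?st//.
  by rewrite ler_pM2r ?invr_gt0//; exact: running_sup_ge.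
rewrite ler_pdivrMr//; apply: running_sup_le => // s s0.
have -> : f s = g s * b by rewrite h ?st// divfK ?gt_eqF.
by rewrite ler_pM2r//; exact: running_sup_ge.
Qed.

Lemma affine_S_pos x y tau : cadlag01 x -> affine_image x y -> 0 <= tau <= 1 ->
  S_pos y tau = S_pos x tau / b.
Proof.
move=> cx xy t01; have cy := affine_image_cadlag cx xy.
apply: (running_sup_scale (jump_finitely_above cx) (jump_finitely_above cy)) => //.
by move=> s s01; exact: affine_jump.
Qed.

Lemma affine_jump_modulus x y tau : cadlag01 x -> affine_image x y -> 0 <= tau <= 1 ->
  jump_modulus y tau = jump_modulus x tau / b.
Proof.
move=> cx xy t01; have cy := affine_image_cadlag cx xy.
apply: (running_sup_scale (abs_jump_finitely_above cx) (abs_jump_finitely_above cy)) => //.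
by move=> s s01; rewrite (affine_jump cx xy s01) normrM [`|b^-1|]ger0_norm// invr_ge0 ltW.
Qed.

Lemma affine_T1p x y : cadlag01 x -> affine_image x y -> affine_image (T1p x) (T1p y).
Proof.
move=> cx xy s s01; rewrite /T1p (affine_S_pos cx xy s01) xy//.
ring.
Qed.

Lemma affine_R1 x y : cadlag01 x -> affine_image x y -> R1 y = R1 x.
Proof.
move=> cx xy; rewrite /R1; congr inf; apply/seteqP.
have bi : injective (fun z => z / b) by apply: mulIf; rewrite invr_eq0 gt_eqF.
have i01 : 0 <= (1 : R) <= 1 by lra.
split=> s /= [s01]; rewrite (affine_jump cx xy s01) (affine_S_pos cx xy i01).
  by move=> /bi.
by move=> ->.
Qed.

Lemma affine_Ltilde x y tau : cadlag01 x -> affine_image x y -> 0 <= tau <= 1 ->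
  Ltilde y tau = Ltilde x tau.
Proof.
move=> cx xy t01; rewrite /Ltilde; congr sup.
have bi : injective (fun z => z / b) by apply: mulIf; rewrite invr_eq0 gt_eqF.
have st s : 0 <= s <= tau -> 0 <= s <= 1 by lra.
have e : sup ((fun u => `|jump y u|) @` `[0, tau]) =
    sup ((fun u => `|jump x u|) @` `[0, tau]) / b := affine_jump_modulus cx xy t01.
have bn : `|b^-1| = b^-1 by rewrite ger0_norm// invr_ge0 ltW.
apply/seteqP; split=> s /= [s0]; rewrite (affine_jump cx xy (st s s0)) e normrM bn.
  by move=> /bi.
by move=> ->.
Qed.

Lemma affine_Rtrim1 x y : cadlag01 x -> affine_image x y ->
  affine_image (Rtrim1 x) (Rtrim1 y).
Proof.
move=> cx xy s s01; rewrite /Rtrim1 (affine_R1 cx xy) xy//.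
have [R01 _] := R1P cx; rewrite (affine_jump cx xy R01).
by case: ifP => _; ring.
Qed.

Lemma affine_Mtrim1 x y : cadlag01 x -> affine_image x y ->
  affine_image (Mtrim1 x) (Mtrim1 y).
Proof.
move=> cx xy s s01; rewrite /Mtrim1 (affine_Ltilde cx xy s01) xy//.
have [L0 _ _] := LtildeP cx s01.
have L01 : 0 <= Ltilde x s <= 1.
  by case/andP: L0 => -> h /=; apply: le_trans h _; case/andP: s01.
by rewrite (affine_jump cx xy L01); ring.
Qed.

End AffineEquivariance.

Section AffineIterates.
Context {R : realType}.
Variables (a b : R).
Hypothesis b0 : 0 < b.
Implicit Types (x y : R -> R).

Lemma affine_iter (T : (R -> R) -> R -> R) (r : nat) x y :
  (forall x, cadlag01 x -> cadlag01 (T x)) ->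
  (forall x y, cadlag01 x -> affine_image a b x y -> affine_image a b (T x) (T y)) ->
  cadlag01 x -> affine_image a b x y -> affine_image a b (iter r T x) (iter r T y).
Proof.
move=> Tcad Taff cx xy; elim: r => [//|r ih] /=; apply: Taff ih.
exact: iter_cadlag.
Qed.

Lemma affine_T1n x y : cadlag01 x -> affine_image a b x y ->
  affine_image a b (T1n x) (T1n y).
Proof.
move=> cx xy s s01; rewrite !T1nE.
(* Reflecting the path reverses the sign of the drift. *)
have xyN : affine_image (- a) b (fun t => - x t) (fun t => - y t).
  by move=> t t01; rewrite xy//; ring.
by rewrite (affine_T1p b0 (cadlag01N cx) xyN s01); ring.
Qed.

Lemma affine_Trim_rs (r s : nat) x y : cadlag01 x -> affine_image a b x y ->
  affine_image a b (Trim_rs r s x) (Trim_rs r s y).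
Proof.
move=> cx xy; apply: affine_iter; first exact: T1p_cadlag.
- by move=> x' y'; exact: affine_T1p.
- by apply: iter_cadlag => // z; exact: T1n_cadlag.
- by apply: affine_iter => //; [exact: T1n_cadlag|exact: affine_T1n].
Qed.

End AffineIterates.

Section RescaledPaths.
Context {R : realType}.

Lemma cadlag_pos_cadlag01 (x : R -> R) (t : R) : 0 < t -> cadlag_pos x ->
  cadlag01 (fun u => x (u * t)).
Proof.
move=> t0 [xr xl]; split=> s /andP[s0 s1].
  have /right_cvgP h := xr (s * t) (mulr_ge0 s0 (ltW t0)).
  apply/right_cvgP => e /h[r r0 hr]; exists (r / t); first by rewrite divr_gt0.
  move=> u su us; apply: hr; first by rewrite ltr_pM2r.
  by rewrite -ltrBlDl -mulrBl -ltr_pdivlMr// ltrBlDl.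
have : 0 < s * t by rewrite mulr_gt0.
move=> /xl /cvg_ex[l /left_cvgP h]; apply: cvgP; apply/left_cvgP.
move=> e /h[r r0 hr]; exists (r / t); first by rewrite divr_gt0.
move=> u su us; apply: hr; last by rewrite ltr_pM2r.
by rewrite ltrBlDr -ltrBlDl -mulrBl -ltr_pdivlMr// ltrBlDl -ltrBlDr.
Qed.

Variables (at0 : bool) (d : measure_display) (Omega : measurableType d).
Variables (P : probability Omega R) (X : R -> Omega -> R).
Variables (d' : measure_display) (Omega' : measurableType d').
Variables (P' : probability Omega' R) (Y : R -> Omega' -> R) (a b : R -> R).
Hypothesis cX : forall w, cadlag_pos (fun t => X t w).
Hypothesis b0 : forall t : R, 0 < t -> 0 < b t.

Lemma affine_rescaled t w : 0 < t ->
  affine_image (a t) (b t) (fun u => X (u * t) w) (fun u => (X (u * t) w - u * a t) / b t).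
Proof. by []. Qed.

Lemma rescaled_cadlag t w : 0 < t -> cadlag01 (fun u => (X (u * t) w - u * a t) / b t).
Proof.
move=> t0; apply: (affine_image_cadlag _ (affine_rescaled w t0)).
exact: (cadlag_pos_cadlag01 t0 (cX w)).
Qed.

(** For [t > 0] the two integrands coincide: equivariance identifies the paths on [[0, 1]], which is
    all that a J1-continuous functional sees on cadlag paths. *)
Lemma cvg_dist_J1_rescaled (T : (R -> R) -> R -> R) :
  (forall x, cadlag01 x -> cadlag01 (T x)) ->
  (forall a b x y, 0 < b -> cadlag01 x -> affine_image a b x y ->
    affine_image a b (T x) (T y)) ->
  cvg_dist_J1 at0 P (fun t w => T (fun tau => (X (tau * t) w - tau * a t) / b t)) P'
    (fun w => T (fun tau => Y tau w)) ->
  cvg_dist_J1 at0 P (fun t w tau => (T (fun u => X (u * t) w) tau - tau * a t) / b t) P'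
    (fun w => T (fun tau => Y tau w)).
Proof.
move=> Tcad Taff h g cg bg; have := h g cg bg; apply: cvg_trans.
have FF := time_lim_filter (R := R) at0.
apply: near_eq_cvg; near=> t.
have t0 : 0 < t by near: t; exact: near_time_lim_gt0.
apply: eq_integral => w _; congr (_%:E).
have cXt := cadlag_pos_cadlag01 t0 (cX w).
have aff := Taff _ _ _ _ (b0 t0) cXt (affine_rescaled w t0).
apply: J1_continuous_eq01 => //.
- exact/Tcad/rescaled_cadlag.
- exact: (affine_image_cadlag (Tcad _ cXt) (fun _ _ => erefl)).
Unshelve. all: by end_near. Qed.

End RescaledPaths.

(** * Increments of a stable process *)

Section InfinitelyOften.
Context {R : realType} {d : measure_display} {Omega : measurableType d}.
Variable P : probability Omega R.
Implicit Types (A B : set Omega) (c : R).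

Definition pr (A : set Omega) : R := fine (P A).

Lemma prE A : measurable A -> P A = (pr A)%:E.
Proof. by move=> mA; rewrite fineK//; exact: fin_num_measure. Qed.

Lemma pr_ge0 A : 0 <= pr A.
Proof. by apply: fine_ge0; exact: measure_ge0. Qed.

Lemma pr_le A B : measurable A -> measurable B -> A `<=` B -> pr A <= pr B.
Proof. by move=> mA mB AB; rewrite -lee_fin -!prE//; apply: le_measure; rewrite ?inE. Qed.

Lemma pr_le1 A : measurable A -> pr A <= 1.
Proof. by move=> mA; rewrite -lee_fin -prE//; exact: probability_le1. Qed.

Lemma pr_setC A : measurable A -> pr (~` A) = 1 - pr A.
Proof.
move=> mA; apply: EFin_inj; rewrite EFinB -!prE//; last exact: measurableC.
exact: probability_setC.
Qed.

Lemma pr0 : pr set0 = 0.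
Proof. by rewrite /pr measure0. Qed.

Lemma pr_setU A B : measurable A -> measurable B -> pr (A `|` B) <= pr A + pr B.
Proof.
move=> mA mB; rewrite -lee_fin EFinD -!prE//; last exact: measurableU.
exact: measureU2.
Qed.

Definition io (A : nat -> set Omega) := \bigcap_n \bigcup_(m in [set m | (n <= m)%N]) A m.

Lemma measurable_io (A : nat -> set Omega) : (forall n, measurable (A n)) -> measurable (io A).
Proof. by move=> mA; apply: bigcapT_measurable => n; apply: bigcup_measurable => m _. Qed.

(** Reverse Fatou for events: the tail unions decrease to [io A], and each contains an event of
    probability at least [c]. *)
Lemma pr_io_ge (A : nat -> set Omega) c : (forall n, measurable (A n)) ->
  (forall n, exists2 m, (n <= m)%N & c <= pr (A m)) -> c <= pr (io A).
Proof.
move=> mA hA; pose B n := \bigcup_(m in [set m | (n <= m)%N]) A m.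
have mB n : measurable (B n) by apply: bigcup_measurable => m _.
rewrite -lee_fin -prE; last exact: measurable_io.
have cB : (P \o B) n @[n --> \oo] --> P (io A).
  apply: nonincreasing_cvg_mu => //.
  - by rewrite -ge0_fin_numE//; exact: fin_num_measure.
  - exact: measurable_io.
  - move=> n m nm; apply/subsetPset => w [k /= mk Ak]; exists k => //=.
    exact: leq_trans nm mk.
rewrite -(cvg_lim _ cB)//; apply: lime_ge; first exact: cvgP cB.
apply: nearW => n /=; rewrite prE// lee_fin; have [m nm cA] := hA n.
by apply: le_trans cA _; apply: pr_le => // w Aw; exists m.
Qed.

Lemma pr_io_small (A : nat -> set Omega) c : (forall n, measurable (A n)) -> pr (io A) < c ->
  exists n, forall m, (n <= m)%N -> pr (A m) < c.
Proof.
move=> mA h; apply: contrapT => hn; move: h; apply/negP; rewrite -leNgt.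
apply: pr_io_ge => // n; apply: contrapT => hn'; apply: hn; exists n => m nm.
by rewrite ltNge; apply/negP => h; apply: hn'; exists m.
Qed.

(** Turns a pathwise impossibility into small probabilities from some index on; the rate estimates
    below start from it. *)
Lemma pr_empty_io_small (A : nat -> set Omega) c : (forall n, measurable (A n)) -> 0 < c ->
  (forall w, ~ io A w) -> exists n, forall m, (n <= m)%N -> pr (A m) < c.
Proof.
move=> mA c0 h; apply: pr_io_small => //.
by rewrite (_ : io A = set0) ?pr0//; apply/seteqP; split=> // w /h.
Qed.

Lemma pr_bigcap_ge (A : nat -> set Omega) c : (forall n, measurable (A n)) ->
  (forall n m w, (n <= m)%N -> A m w -> A n w) -> (forall n, c <= pr (A n)) ->
  c <= pr (\bigcap_n A n).
Proof.
move=> mA dA hA; rewrite (_ : \bigcap_n A n = io A).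
  by apply: pr_io_ge => // n; exists n.
apply/seteqP; split=> w h n _; first by exists n => /=; [|exact: h].
by have [m /= nm Am] := h n I; exact: dA Am.
Qed.

Definition ev (A : nat -> set Omega) := \bigcup_n \bigcap_(m in [set m | (n <= m)%N]) A m.

Lemma measurable_ev (A : nat -> set Omega) : (forall n, measurable (A n)) -> measurable (ev A).
Proof. by move=> mA; apply: bigcupT_measurable => n; apply: bigcap_measurable => //; exists n => /=. Qed.

Lemma pr_ev_le (A : nat -> set Omega) c : (forall n, measurable (A n)) ->
  (forall n, exists2 m, (n <= m)%N & pr (A m) <= c) -> pr (ev A) <= c.
Proof.
move=> mA hA; have mC n : measurable (~` A n) by exact: measurableC.
have : 1 - c <= pr (io (fun n => ~` A n)).
  apply: pr_io_ge => // n; have [m nm h] := hA n; exists m => //.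
  by rewrite pr_setC// lerD2l lerN2.
rewrite (_ : io _ = ~` ev A).
  by rewrite pr_setC ?lerD2l ?lerN2//; exact: measurable_ev.
rewrite /ev setC_bigcup; apply: eq_bigcapr => n _.
by rewrite setC_bigcap.
Qed.

End InfinitelyOften.

(** * Increments over a grid and their relation to jumps *)

Section Cells.
Context {R : realType}.
Implicit Types (x : R -> R) (s t e : R) (N i : nat).

Definition cell_inc x N i := x (i.+1%:R / N%:R) - x (i%:R / N%:R).

Lemma cell_range N i : (i < N)%N -> 0 <= i%:R / N%:R :> R /\ i.+1%:R / N%:R <= 1 :> R.
Proof.
move=> iN; have N0 : 0 < N%:R :> R by rewrite ltr0n (leq_ltn_trans _ iN).
by rewrite divr_ge0// ler_pdivrMr// mul1r ler_nat.
Qed.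

Lemma cell_length N i : (0 < N)%N -> i.+1%:R / N%:R = i%:R / N%:R + N%:R^-1 :> R.
Proof. by move=> N0; rewrite -natr1 mulrDl mul1r. Qed.

Lemma natr_inv_small (g : R) : 0 < g -> exists N0, forall N, (N0 <= N)%N ->
  (0 < N)%N /\ N%:R^-1 < g.
Proof.
move=> g0; exists (Num.truncn g^-1).+1 => N hN.
have N0 : (0 < N)%N by exact: leq_trans hN.
split=> //; have Np : 0 < N%:R :> R by rewrite ltr0n.
rewrite -[ltRHS]invrK ltf_pV2 ?posrE ?invr_gt0//.
by apply: lt_le_trans (truncnS_gt _) _; rewrite ler_nat.
Qed.

(** A cell shorter than the gap between partition points contains at most one of them. With none the
    increment is small; with one, the oscillation on either side of it costs [e] each. *)
Lemma cell_inc_jump x e : cadlag01 x -> 0 < e -> exists N0, forall N i,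
  (N0 <= N)%N -> (i < N)%N -> `|cell_inc x N i| <= e \/
  exists2 t, i%:R / N%:R < t <= i.+1%:R / N%:R &
    `|cell_inc x N i - jump x t| <= e + e.
Proof.
move=> cx e0; have [ts hts] := cadlag01_osc cx e0; have [g g0 hg] := seq_gap ts.
have [N0 hN0] := natr_inv_small g0; exists N0 => N i /hN0[Np Ng] iN.
have [p0 q1] := cell_range iN; have len := @cell_length N i Np.
rewrite /cell_inc; move: p0 q1 len; set p := i%:R / N%:R; set q := i.+1%:R / N%:R.
move=> p0 q1 len.
have ip : 0 < N%:R^-1 :> R by rewrite invr_gt0 ltr0n.
have pq : p < q by rewrite len ltrDl.
have [[t tts /andP[pt tq]]|ns] := pselect (separated ts p q); last first.
  by left; rewrite distrC; apply: hts => //; exact: ltW.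
right; exists t; first by rewrite pt tq.
have only v : p < v -> v <= q -> v \in ts -> v = t.
  move=> pv vq vts; apply: hg => //.
  by rewrite ltr_norml; apply/andP; clear -len Ng pv vq pt tq; split; lra.
have h1 : `|x t - x q| <= e.
  apply: hts => //; first by apply: ltW; exact: le_lt_trans pt.
  move=> [v vts /andP[tv vq]]; have := only v (lt_trans pt tv) vq vts.
  by move=> vt; rewrite vt ltxx in tv.
apply/ler_addgt0Pr => d d0.
have t01 : 0 < t <= 1 by rewrite (le_lt_trans p0 pt) (le_trans tq).
have [r r0 hr] := jump_leftP cx t01 d0.
have tp : 0 < t - p by rewrite subr_gt0.
have [t0 t1] := andP t01.
have [u /and4P[u0 ut ur up]] := exists_left_of t0 r0 tp.
rewrite opprB addrC subrK in up.
have h2 := hr u ur ut.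
have h3 : `|x p - x u| <= e.
  apply: hts => //; [exact: ltW|exact: le_trans (ltW ut) t1|].
  move=> [v vts /andP[pv vu]]; have vt := only v pv (le_trans vu (le_trans (ltW ut) tq)) vts.
  by move: vu; rewrite vt leNgt ut.
move: h1 h2 h3; move: (x p) (x q) (x t) (x u) (jump x t) => a b c f j.
by rewrite !ler_norml => /andP[? ?] /andP[? ?] /andP[? ?]; apply/andP; split; lra.
Qed.

Lemma cell_of s N : (0 < N)%N -> 0 < s <= 1 ->
  exists2 i, (i < N)%N & i%:R / N%:R < s <= i.+1%:R / N%:R.
Proof.
move=> N0 /andP[s0 s1]; have Np : 0 < N%:R :> R by rewrite ltr0n.
have Ns0 : 0 < N%:R * s by rewrite mulr_gt0.
have [n /andP[h1 h2]] := nat_ceil (ltW Ns0).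
case: n h1 h2 => [|n] h1 h2; first by have := lt_le_trans Ns0 h2; rewrite ltxx.
exists n.
  rewrite -(ltr_nat R); apply: (@lt_le_trans _ _ (N%:R * s)).
    by rewrite -natr1 addrK in h1.
  by rewrite -[leRHS]mulr1 ler_pM2l.
rewrite ltr_pdivrMr// ler_pdivlMr// [s * _]mulrC h2 andbT.
by rewrite -natr1 addrK in h1.
Qed.

(** Right continuity controls the right end of the cell around [s], and the left limit controls its
    left end. *)
Lemma jump_cell_inc x s e : cadlag01 x -> 0 < s <= 1 -> 0 < e -> exists N0, forall N i,
  (N0 <= N)%N -> (i < N)%N -> i%:R / N%:R < s <= i.+1%:R / N%:R ->
  `|cell_inc x N i - jump x s| <= e.
Proof.
move=> cx s01 e0; have e20 : 0 < e / 2 by rewrite divr_gt0.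
have [ts hts] := cadlag01_osc cx e20.
have [r r0 hr] := separated_right ts s.
have [r' r'0 hr'] := jump_leftP cx s01 e20.
have rr : 0 < Num.min r r' by rewrite lt_min r0.
have [N0 hN0] := natr_inv_small rr; exists N0 => N i /hN0[Np Ng] iN /andP[ps sq].
have [p0 q1] := cell_range iN; have len := @cell_length N i Np.
rewrite /cell_inc; move: p0 q1 len ps sq; set p := i%:R / N%:R; set q := i.+1%:R / N%:R.
move=> p0 q1 len ps sq.
move: Ng; rewrite lt_min => /andP[Nr Nr'].
have h1 : `|x s - x q| <= e / 2.
  apply: hts => //; first by case/andP: s01 => /ltW.
  by apply: hr; clear -len Nr ps; lra.
have h2 := hr' p ltac:(clear -len Nr' sq; lra) ps.
move: h1 h2; move: (x p) (x q) (x s) (jump x s) => a b c j.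
by rewrite !ler_norml => /andP[? ?] /andP[? ?]; apply/andP; split; lra.
Qed.

Lemma jump_rescale x (a s : R) : 0 < a <= 1 -> cadlag01 x -> 0 < s <= 1 ->
  jump (fun u => x (u * a)) s = jump x (s * a).
Proof.
move=> /andP[a0 a1] cx /andP[s0 s1]; apply: jump_eqP => // e e0.
have sa01 : 0 < s * a <= 1 by rewrite mulr_gt0// mulr_ile1// ltW.
have [r r0 hr] := jump_leftP cx sa01 e0; exists (r / a); first by rewrite divr_gt0.
move=> u su us; apply: hr; last by rewrite ltr_pM2r.
by rewrite ltrBlDr -ltrBlDl -mulrBl -ltr_pdivlMr// ltrBlDl -ltrBlDr.
Qed.

End Cells.

Section LevyIncrements.
Context {R : realType} {d : measure_display} {Omega : measurableType d}.
Variables (P : probability Omega R) (Y : R -> Omega -> R).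
Hypothesis levyY : levy_process P Y.
Implicit Types (a : R) (N i n : nat) (B C : set R) (w : Omega).

Definition rescaled_path a w := fun u => Y (u * a) w.
Definition increment a N i w := cell_inc (rescaled_path a w) N i.

Definition hit a N n B := [set w | exists2 i, (i < n)%N & B (increment a N i w)].

Let mY t : measurable_fun setT (Y t). Proof. by case: levyY. Qed.

Lemma measurable_increment a N i B : measurable B ->
  measurable [set w | B (increment a N i w)].
Proof.
move=> mB; rewrite -[mkset _]setTI.
have : measurable_fun setT (fun w => increment a N i w) by apply: measurable_funB; exact: mY.
by apply.
Qed.

Lemma measurable_hit a N n B : measurable B -> measurable (hit a N n B).
Proof.
move=> mB; rewrite (_ : hit _ _ _ _ =
  \bigcup_(i in [set i | (i < n)%N]) [set w | B (increment a N i w)]).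
  by apply: bigcup_measurable => i _; exact: measurable_increment.
by apply/seteqP; split=> [w [i]|w [i]]; exists i.
Qed.

Definition cell_law a N B := pr P (Y (a / N%:R) @^-1` B).

Lemma measurable_level t B : measurable B -> measurable (Y t @^-1` B).
Proof. by move=> mB; rewrite -[X in measurable X]setTI; exact: mY. Qed.

Lemma cell_law_le1 a N B : measurable B -> cell_law a N B <= 1.
Proof. by move=> mB; apply: pr_le1; exact: measurable_level. Qed.

Lemma pr_increment a N i B : 0 <= a -> (0 < N)%N -> measurable B ->
  pr P [set w | B (increment a N i w)] = cell_law a N B.
Proof.
move=> a0 N0 mB; have Np : 0 < N%:R :> R by rewrite ltr0n.
have s0 : 0 <= i%:R / N%:R * a by rewrite mulr_ge0// divr_ge0.
have t0 : 0 <= a / N%:R by rewrite divr_ge0.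
have [_ _ _ _ /(_ _ _ s0 t0 B mB)] := levyY.
rewrite (_ : a / N%:R + i%:R / N%:R * a = i.+1%:R / N%:R * a); last first.
  by rewrite -natr1; ring.
by rewrite /cell_law /pr => <-.
Qed.

Let grid a N i : R := i%:R / N%:R * a.

Let indep a N n : 0 <= a -> (0 < N)%N ->
  indep_RVs P (fun i : 'I_n => fun w => increment a N i w).
Proof.
move=> a0 N0; have Np : 0 < N%:R :> R by rewrite ltr0n.
have [_ _ _ /(_ n (grid a N)) h _] := levyY; apply: h.
  by rewrite /grid mul0r mul0r.
by move=> i; rewrite /grid ler_wpM2r// ler_pM2r ?invr_gt0// ler_nat.
Qed.

Lemma pr_hit a N n B : 0 <= a -> (0 < N)%N -> measurable B ->
  pr P (hit a N n B) = 1 - (1 - cell_law a N B) ^+ n.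
Proof.
move=> a0 N0 mB; have mC := measurableC mB.
have := @indep a N n a0 N0 (fun _ => ~` B) (fun _ => mC).
rewrite (_ : \bigcap_(i in _) _ = ~` hit a N n B); last first.
  apply/seteqP; split=> w.
    by move=> h [i ni]; have := h (Ordinal ni) I.
  by move=> h i _ /= Bi; apply: h; exists i.
rewrite -/(pr P _) pr_setC; last exact: measurable_hit.
rewrite (eq_bigr (fun _ => 1 - cell_law a N B)).
  by rewrite prodr_const card_ord => <-; ring.
move=> i _; rewrite -/(pr P _) -(pr_increment i a0 N0 mB) -pr_setC//.
exact: measurable_increment.
Qed.

Lemma pr_pair a N i j B C : 0 <= a -> (0 < N)%N -> i != j ->
  measurable B -> measurable C ->
  pr P ([set w | B (increment a N i w)] `&` [set w | C (increment a N j w)])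
    = cell_law a N B * cell_law a N C.
Proof.
move=> a0 N0 ij mB mC; pose n := (maxn i j).+1.
have iN : (i < n)%N by rewrite ltnS leq_maxl.
have jN : (j < n)%N by rewrite ltnS leq_maxr.
(* Independence is stated for initial blocks of increments; the cells other than [i] and [j] are
   left unconstrained. *)
pose D (k : 'I_n) := if val k == i then B else if val k == j then C else setT.
have mD k : measurable (D k) by rewrite /D; do 2 case: ifP => // _.
have := @indep a N n a0 N0 D mD.
rewrite (_ : \bigcap_(k in _) _ = [set w | B (increment a N i w)] `&`
  [set w | C (increment a N j w)]); last first.
  apply/seteqP; split=> w.
    move=> h; split; first by have := h (Ordinal iN) I; rewrite /D /= eqxx.
    by have := h (Ordinal jN) I; rewrite /D /= eq_sym (negbTE ij) eqxx.
  move=> [Bi Cj] k _; rewrite /D /=; case: eqP => [->//|_]; by case: eqP => [->|].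
rewrite -/(pr P _) => ->; rewrite (bigD1 (Ordinal iN))//= (bigD1 (Ordinal jN))/=; last first.
  by rewrite -val_eqE /= eq_sym.
rewrite big1 ?mulr1.
  rewrite /D /= eqxx eq_sym (negbTE ij) eqxx.
  by rewrite -(pr_increment i a0 N0 mB) -(pr_increment j a0 N0 mC).
move=> k /andP[]; rewrite -!val_eqE /= /D => /negbTE -> /negbTE ->.
by rewrite preimage_setT probability_setT.
Qed.

End LevyIncrements.

Section Auxiliary.
Context {R : realType}.

(** Relates hits to expected counts: among [n] independent trials a success has probability at least
    [n p / (1 + n p)]. *)
Lemma bernoulli_upper (p : R) n : 0 <= p <= 1 -> (1 - p) ^+ n * (1 + n%:R * p) <= 1.
Proof.
move=> /andP[p0 p1]; have q0 : 0 <= 1 - p by rewrite subr_ge0.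
elim: n => [|n ih]; first by rewrite expr0 mul0r addr0 mulr1.
rewrite exprSr -mulrA; apply: le_trans ih.
apply: ler_wpM2l; first exact: exprn_ge0.
have -> : (1 - p) * (1 + n.+1%:R * p) = 1 + n%:R * p - n.+1%:R * p * p.
  by rewrite -natr1; ring.
by rewrite gerBl !mulr_ge0.
Qed.

Lemma injective_avoids (f : nat -> R) (L : seq R) : injective f ->
  exists n, forall k, (n <= k)%N -> f k \notin L.
Proof.
move=> fi; elim: L => [|l L [n hn]]; first by exists 0%N.
have [[k0 fk0]|nk] := pselect (exists k, f k = l).
  exists (maxn n k0.+1) => k; rewrite geq_max => /andP[nk kk]; rewrite inE negb_or hn// andbT.
  by rewrite -fk0; apply/eqP => /fi kk0; move: kk; rewrite kk0 ltnn.
exists n => k nk'; rewrite inE negb_or hn// andbT; apply/eqP => e; apply: nk; by exists k.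
Qed.

Definition modulus_near (v e : R) := [set y : R | v - e < `|y| < v + e].
Definition modulus_ge (v : R) := [set y : R | v <= `|y|].

Lemma measurable_modulus (i : interval R) : measurable [set y : R | `|y| \in i].
Proof.
rewrite -[mkset _]setTI.
have : measurable_fun [set: R] (fun y : R => `|y|) by exact: normr_measurable.
by move=> /(_ measurableT [set` i] (measurable_itv i)).
Qed.

Lemma measurable_affine_preimage (k z : R) (B : set R) : measurable B ->
  measurable [set y | B (k * y + z)].
Proof.
move=> mB; rewrite -[mkset _]setTI.
have : measurable_fun [set: R] (fun y => k * y + z).
  by apply: measurable_funD => //; exact: measurable_funM.
by apply.
Qed.

Lemma measurable_modulus_near v e : measurable (modulus_near v e).
Proof.
rewrite (_ : modulus_near _ _ = [set y | `|y| \in `]v - e, v + e[]).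
  exact: measurable_modulus.
by apply/seteqP; split=> y /=; rewrite in_itv.
Qed.

Lemma measurable_modulus_ge v : measurable (modulus_ge v).
Proof.
rewrite (_ : modulus_ge _ = [set y | `|y| \in `[v, +oo[]).
  exact: measurable_modulus.
by apply/seteqP; split=> y /=; rewrite in_itv/= andbT.
Qed.

End Auxiliary.

(** * Rates at which stable increments visit a given modulus *)

Section StableRates.
Context {R : realType} {d : measure_display} {Omega : measurableType d}.
Variables (P : probability Omega R) (Y : R -> Omega -> R) (alpha : R).
Hypothesis levyY : levy_process P Y.
Hypothesis alpha0 : 0 < alpha.
Hypothesis stableY : stable_levy alpha P Y.
Implicit Types (a v e kappa eta : R) (N i n m : nat) (B : set R) (w : Omega).

Let mY t : measurable_fun setT (Y t). Proof. by case: levyY. Qed.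

Let mlev t B (mB : measurable B) : measurable (Y t @^-1` B) :=
  @measurable_level _ _ _ P Y levyY t B mB.

Let mhit a N n B (mB : measurable B) : measurable (hit Y a N n B) :=
  @measurable_hit _ _ _ P Y levyY a N n B mB.

Let mu := cell_law P Y.

Ltac forget := clear -levyY alpha0 stableY mY mlev mhit mu.

Lemma path_cadlag a w : 0 < a -> cadlag01 (rescaled_path Y a w).
Proof. by move=> a0; case: levyY => _ _ h _ _; exact: (cadlag_pos_cadlag01 a0 (h w)). Qed.

(** Right continuity at 0 forbids large values of [Y (a / N)] for infinitely many [N]. The bound 1/3
    is chosen so that two such events cannot cover the whole space. *)
Lemma small_time_increment a e : 0 < a -> 0 < e ->
  exists n0, forall N, (n0 <= N)%N -> mu a N (modulus_ge e) < 3^-1.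
Proof.
move=> a0 e0; have t0 : 0 < 3^-1 :> R by rewrite invr_gt0.
apply: (@pr_empty_io_small _ _ _ P (fun N => Y (a / N%:R) @^-1` modulus_ge e)) => // [N|w hw].
  exact: mlev _ (measurable_modulus_ge e).
have [_ /(_ w) Y0 /(_ w)[/(_ 0 (lexx _)) /right_cvgP h _] _ _] := levyY.
have e20 : 0 < e / 2 by rewrite divr_gt0.
have [r r0 hr] := h _ e20; have [n0 hn0] := natr_inv_small (divr_gt0 r0 a0).
have [N /= /hn0[N0 Nr]] := hw n0 I.
rewrite /modulus_ge /= => hN.
have Np : 0 < N%:R :> R by rewrite ltr0n.
have := hr (a / N%:R) (divr_gt0 a0 Np).
rewrite add0r Y0 subr0 mulrC -ltr_pdivlMr// => /(_ Nr).
by rewrite mulrC => h2; have := le_trans hN h2; move: e0; forget; lra.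
Qed.

Definition scale a := a `^ (alpha^-1).

Lemma scale_gt0 a : 0 < a -> 0 < scale a.
Proof. exact: powR_gt0. Qed.

Lemma scale_le a a' : 0 <= a -> a <= a' -> scale a <= scale a'.
Proof.
move=> a0 aa; apply: ge0_ler_powR => //; rewrite ?nnegrE ?invr_ge0//.
  exact: ltW.
exact: le_trans aa.
Qed.

Lemma scale_le1 a : 0 <= a -> a <= 1 -> scale a <= 1.
Proof. by move=> a0 a1; apply: le_trans (scale_le a0 a1) _; rewrite /scale powR1. Qed.

(** Stability at times [a / N] and [1 / N] expresses both laws through [Y 1]; eliminating it relates
    the two cells directly, with relative shift [dl N]. *)
Lemma stable_drift a : 0 < a <= 1 -> exists dl : nat -> R,
  (forall N B, (0 < N)%N -> measurable B ->
     mu a N B = mu 1 N [set y | B (scale a * y + dl N)]) /\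
  (forall e, 0 < e -> exists n0, forall N, (n0 <= N)%N -> `|dl N| < e).
Proof.
move=> /andP[a0 a1].
have /choice[da hda] : forall s, exists ds, 0 < s ->
    same_law P (Y s) P (fun w => s `^ (alpha^-1) * Y 1 w + ds).
  move=> s; have [s0|s0] := ltP 0 s; last by exists 0.
  by have [ds h] := stableY s0; exists ds.
have c0 := scale_gt0 a0; have c1 := scale_le1 (ltW a0) a1.
pose dl (N : nat) := da (a / N%:R) - scale a * da (1 / N%:R).
have mpre z B := @measurable_affine_preimage R (scale a) z B.
have law N B : (0 < N)%N -> measurable B ->
    mu a N B = mu 1 N [set y | B (scale a * y + dl N)].
  move=> N0 mB; have Np : 0 < N%:R :> R by rewrite ltr0n.
  have aN : 0 < a / N%:R by rewrite divr_gt0.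
  have iN : 0 < 1 / N%:R :> R by rewrite divr_gt0.
  rewrite /mu /cell_law /pr (hda _ aN B mB) (hda _ iN _ (mpre (dl N) B mB)).
  congr (fine (P _)); apply/seteqP.
  have -> : (a / N%:R) `^ alpha^-1 = scale a * (1 / N%:R) `^ alpha^-1.
    by rewrite -powRM ?ltW// mulrA mulr1.
  by split=> w; rewrite /= /preimage /= /dl mulrDr mulrA -addrA
    [scale a * da _ + _]addrC subrK.
exists dl; split=> // e e0; have e20 : 0 < e / 2 by rewrite divr_gt0.
have [n1 h1] := small_time_increment a0 e20.
have [n2 h2] := small_time_increment (ltr01 : 0 < 1 :> R) e20.
exists (maxn 1 (maxn n1 n2)) => N; rewrite !geq_max => /and3P[N0 /h1 {}h1 /h2 {}h2].
have mge := measurable_modulus_ge (e / 2).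
rewrite (law _ _ N0 mge) in h1.
set A := Y (1 / N%:R) @^-1` [set y | modulus_ge (e / 2) (scale a * y + dl N)].
set A' := Y (1 / N%:R) @^-1` (modulus_ge (e / 2)).
have mA : measurable A by exact: mlev _ (mpre _ _ mge).
have mA' : measurable A' by exact: mlev _ mge.
(* The two events have total probability below 2/3. At a point outside both, [dl N] is a difference
   of two numbers smaller than [e / 2]. *)
have [w nw] : exists w, ~ (A `|` A') w.
  apply: contrapT => hn; have : pr P (A `|` A') = 1.
    rewrite (_ : A `|` A' = setT) ?/pr ?probability_setT//.
    by apply/seteqP; split=> // w _; apply: contrapT => h; apply: hn; exists w.
  have := pr_setU P mA mA'; rewrite -/(mu 1 N _) in h1 h2 *.
  by move: h1 h2; rewrite /mu /cell_law -/A -/A'; forget; lra.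
have /not_orP[] : ~ (A w \/ A' w) by [].
rewrite /A /A' /preimage /modulus_ge /= => /negP; rewrite -ltNge => k1 /negP; rewrite -ltNge => k2.
have -> : dl N = (scale a * Y (1 / N%:R) w + dl N) - scale a * Y (1 / N%:R) w by ring.
apply: le_lt_trans (ler_normB _ _) _.
have : `|scale a * Y (1 / N%:R) w| <= `|Y (1 / N%:R) w|.
  by rewrite normrM (ger0_norm (ltW c0)) ler_piMl.
by move: k1 k2; forget; lra.
Qed.

(** Since [scale a <= 1], scaling does not widen the window; doubling its radius absorbs the shift,
    eventually below [e]. *)
Lemma scaling_rate a v e : 0 < a <= 1 -> 0 < e -> exists n0, forall N, (n0 <= N)%N ->
  mu 1 N (modulus_near v e) <= mu a N (modulus_near (scale a * v) (2 * e)).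
Proof.
move=> a01 e0; have [a0 a1] := andP a01.
have [dl [law hdl]] := stable_drift a01; have [n0 hn0] := hdl e e0.
exists (maxn 1 n0) => N; rewrite geq_max => /andP[N0 /hn0 dN].
have mB := measurable_modulus_near (scale a * v) (2 * e).
rewrite law//; apply: pr_le.
- exact: mlev _ (measurable_modulus_near _ _).
- exact: mlev _ (measurable_affine_preimage _ _ (measurable_modulus_near _ _)).
move=> w; rewrite /preimage /modulus_near /=; move: (Y _ w) => y /andP[h1 h2].
have c0 := scale_gt0 a0; have c1 := scale_le1 (ltW a0) a1.
have ce : scale a * e <= e by rewrite ler_piMl// ltW.
have k1 : scale a * (v - e) < scale a * `|y| by rewrite ltr_pM2l.
have k2 : scale a * `|y| < scale a * (v + e) by rewrite ltr_pM2l.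
rewrite mulrBr in k1; rewrite mulrDr in k2.
have ny : `|scale a * y| = scale a * `|y| by rewrite normrM (ger0_norm (ltW c0)).
have k3 := ler_normD (scale a * y) (dl N); rewrite ny in k3.
have k4 : scale a * `|y| <= `|scale a * y + dl N| + `|dl N|.
  rewrite -ny; apply: le_trans (ler_normB _ _); by rewrite addrK.
move: ce k1 k2 k3 k4 dN; move: (scale a * v) (scale a * e) (scale a * `|y|) => p q r.
by forget; move=> ? ? ? ? ? ?; apply/andP; split; lra.
Qed.

Lemma pr_hit_ge a N B kappa : 0 <= a -> (0 < N)%N -> measurable B -> 0 < kappa ->
  kappa < N%:R * mu a N B -> kappa / (1 + kappa) <= pr P (hit Y a N N B).
Proof.
move=> a0 N0 mB k0 hk; rewrite (pr_hit levyY)// -/(mu a N B).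
have k1 : 0 < 1 + kappa by rewrite addr_gt0.
have m01 : 0 <= mu a N B <= 1 by rewrite pr_ge0/= cell_law_le1.
have := bernoulli_upper N m01.
have : 0 <= (1 - mu a N B) ^+ N by rewrite exprn_ge0// subr_ge0; case/andP: m01.
move: ((1 - mu a N B) ^+ N) hk => q hk q0 hq.
rewrite ler_pdivrMr// mulrBl mul1r lerBrDr -lerBrDl addrK.
apply: le_trans hq; rewrite ler_wpM2l// lerD2l; exact: ltW.
Qed.

(** Hits on arbitrarily fine grids, to every precision, give jumps with modulus arbitrarily close to
    [v]. Only finitely many jumps exceed [v / 2], so one of them has modulus exactly [v]. *)
Lemma level_io_jump a v w : 0 < a -> 0 < v ->
  (\bigcap_m io (fun N => hit Y a N N (modulus_near v (2 * m.+1%:R^-1)))) w ->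
  exists2 s, 0 < s <= 1 & `|jump (rescaled_path Y a w) s| = v.
Proof.
move=> a0 v0 hw; set x := rescaled_path Y a w; have cx : cadlag01 x := path_cadlag w a0.
have approx e : 0 < e -> exists2 t, 0 < t <= 1 & `| `|jump x t| - v| <= e.
  (* The bound [v / 4] rules out the alternative that the increment is merely small. *)
  move=> e0; pose e' := Num.min (e / 4) (v / 4).
  have e'0 : 0 < e' by rewrite lt_min !divr_gt0.
  have [e'e e'v] : e' <= e / 4 /\ e' <= v / 4 by rewrite /e' !ge_min !lexx orbT.
  have [N0 hN0] := cell_inc_jump cx e'0.
  have e'2 : 0 < e' / 2 by rewrite divr_gt0.
  have [m hm] := natr_inv_small e'2.
  have [N /= NN [i iN]] := hw m I N0 I.
  have [_ mlt] := hm m.+1 (leqnSn m).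
  rewrite /modulus_near /= -/x; have inc := hN0 N i NN iN.
  rewrite /increment -/x; move: inc mlt; set z := cell_inc x N i; set q := m.+1%:R^-1.
  move=> [zs|[t ti zt]] mlt /andP[z1 z2].
    by exfalso; move: zs z1 mlt e'v v0; forget; lra.
  exists t.
    have [p0 q1] := @cell_range R N i iN.
    by case/andP: ti => t1 t2; rewrite (le_lt_trans p0 t1) (le_trans t2).
  have k := le_trans (ler_dist_dist _ _) zt.
  move: k z1 z2 mlt e'e; move: (`|z|) (`|jump x t|) => b c.
  by forget; rewrite !ler_norml => /andP[? ?] ? ? ? ?; apply/andP; split; lra.
have v20 : 0 < v / 2 by rewrite divr_gt0.
have [_ /(_ _ v20)[ts hts]] := abs_jump_finitely_above cx.
have [g g0 hg] := seq_gap (v :: [seq `|jump x t| | t <- ts]).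
have g'0 : 0 < Num.min (g / 2) (v / 4) by rewrite lt_min !divr_gt0.
have [t t01 ht] := approx _ g'0; exists t => //.
have [h1 h2] : `| `|jump x t| - v| <= g / 2 /\ `| `|jump x t| - v| <= v / 4.
  by move: ht; rewrite le_min => /andP[].
apply: hg; last by apply: le_lt_trans h1 _; move: g0; forget; lra.
  rewrite inE; apply/orP; right; apply: (map_f (fun t => `|jump x t|)); apply: hts.
    by case/andP: t01 => /ltW -> ->.
  by move: h2 v0; forget; rewrite ler_norml => /andP[? ?] ?; lra.
by rewrite inE eqxx.
Qed.

(* If jumps of modulus [v] occurred with positive probability, scaling would
   give infinitely many levels above [scale 2^-1 * v], each charged with
   probability at least [kappa / (1 + kappa)]; but a cadlag path has only
   finitely many jumps there. *)
Lemma level_rate v kappa : 0 < v -> 0 < kappa ->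
  exists2 e, 0 < e & exists n0, forall N, (n0 <= N)%N ->
    N%:R * mu 1 N (modulus_near v e) <= kappa.
Proof.
move=> v0 k0; apply: contrapT => hn.
have often e n : 0 < e -> exists2 N, (n <= N)%N &
    kappa < N%:R * mu 1 N (modulus_near v e).
  move=> e0; apply: contrapT => hn'; apply: hn; exists e => //; exists n => N nN.
  by rewrite leNgt; apply/negP => h; apply: hn'; exists N.
pose H a m N := hit Y a N N (modulus_near (scale a * v) (2 * m.+1%:R^-1)).
pose F a := \bigcap_m io (H a m).
pose p0 := kappa / (1 + kappa).
have p00 : 0 < p0 by rewrite divr_gt0// addr_gt0.
have mH a m N : measurable (H a m N).
  exact: mhit (measurable_modulus_near _ _).
have mF a : measurable (F a) by apply: bigcapT_measurable => m; exact: measurable_io.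
have prF a : 0 < a <= 1 -> p0 <= pr P (F a).
  move=> a01; apply: pr_bigcap_ge.
  - by move=> m; exact: measurable_io.
  - move=> n m w nm hw k _; have [N /= kN [i iN hi]] := hw k I; exists N => //=.
    exists i => //; move: hi; rewrite /modulus_near /=.
    have : m.+1%:R^-1 <= n.+1%:R^-1 :> R by rewrite lef_pV2 ?posrE// ler_nat.
    move: (m.+1%:R^-1) (n.+1%:R^-1) (scale a * v) (`|_|) => ? ? ? ?; forget.
    by move=> ? /andP[? ?]; apply/andP; split; lra.
  move=> m; apply: pr_io_ge => // n.
  have m0 : 0 < m.+1%:R^-1 :> R by rewrite invr_gt0.
  have [n0 hn0] := scaling_rate v a01 m0.
  have [N] := often _ (maxn 1 (maxn n n0)) m0.
  rewrite !geq_max => /and3P[N0 nN /hn0 sc] hN; exists N => //.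
  apply: pr_hit_ge => //; [by case/andP: a01 => /ltW|exact: measurable_modulus_near|].
  by apply: lt_le_trans hN _; rewrite ler_wpM2l.
(* Infinitely many distinct time scales in []1/2, 1]]: they give distinct levels, all at least
   [scale 2^-1 * v]. *)
pose ak (k : nat) : R := (1 + k.+1%:R^-1) / 2.
have ak01 k : 2^-1 < ak k <= 1.
  have k1 : k.+1%:R^-1 <= 1 :> R by rewrite invf_le1// ler1n.
  have k00 : 0 < k.+1%:R^-1 :> R by rewrite invr_gt0.
  by rewrite /ak; move: (k.+1%:R^-1) k1 k00; forget => z ? ?; apply/andP; split; lra.
have ak0 k : 0 < ak k by have /andP[h _] := ak01 k; apply: lt_trans h; rewrite invr_gt0.
have ak01' k : 0 < ak k <= 1 by rewrite ak0; case/andP: (ak01 k).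
have akinj : injective (fun k => scale (ak k) * v).
  move=> k l /(mulIf (lt0r_neq0 v0)) /powR_injective.
  rewrite invr_gt0 alpha0 !nnegrE => /(_ isT (ltW (ak0 _)) (ltW (ak0 _))).
  rewrite /ak => /(mulIf _) -/(_ (invr_neq0 (lt0r_neq0 (ltr0Sn _ _)))) /addrI /invr_inj /eqP.
  by rewrite eqr_nat eqSS => /eqP.
have [n hn'] : exists n, forall m, (n <= m)%N -> pr P (F (ak m)) < p0.
  apply: (@pr_empty_io_small _ _ _ P (fun m => F (ak m))) => // w hw.
  pose x := rescaled_path Y 1 w; have cx : cadlag01 x by exact: path_cadlag.
  have c0 : 0 < scale 2^-1 by apply: scale_gt0; rewrite invr_gt0.
  have cv : 0 < scale 2^-1 * v / 2 by rewrite divr_gt0// mulr_gt0.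
  have [_ /(_ _ cv)[ts hts]] := abs_jump_finitely_above cx.
  have [n hn'] := injective_avoids [seq `|jump x t| | t <- ts] akinj.
  have [k /= nk Fk] := hw n I.
  have ckv : 0 < scale (ak k) * v by rewrite mulr_gt0// scale_gt0.
  have [s s01 hs] := level_io_jump (ak0 k) ckv Fk.
  have := hn' k nk; rewrite -hs.
  (* Every scale is read on the same path [x], restricted to times up to [ak k]; its finite list of
     large jumps thus has to contain all the levels that occur. *)
  have -> : rescaled_path Y (ak k) w = (fun u => x (u * ak k)).
    by apply/funext => u; rewrite /x /rescaled_path mulr1.
  have [s0 s1] := andP s01; have [_ ak1] := andP (ak01 k).
  rewrite jump_rescale// => /negP; apply; apply: (map_f (fun t => `|jump x t|)); apply: hts.
    by rewrite (mulr_ge0 (ltW s0) (ltW (ak0 k))) (mulr_ile1 (ltW s0) (ltW (ak0 k)) s1 ak1).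
  rewrite -(jump_rescale (ak01' k) cx s01).
  have -> : (fun u => x (u * ak k)) = rescaled_path Y (ak k) w.
    by apply/funext => u; rewrite /x /rescaled_path mulr1.
  rewrite hs; apply: (@lt_le_trans _ _ (scale 2^-1 * v)).
    have c2 : 0 < scale 2^-1 * v := mulr_gt0 c0 v0.
    by rewrite ltr_pdivrMr// ltr_pMr// ltr1n.
  rewrite ler_pM2r//; apply: scale_le; first by rewrite invr_ge0.
  by apply: ltW; case/andP: (ak01 k).
by have := hn' n (leqnn n); rewrite ltNge prF.
Qed.

(** Near time 0 a path moves by less than [eta], so for a large [K] the first [N / (K + 1)] cells
    contain a large increment with probability below 1/2. By independence their expected number of
    large increments is then at most 1. *)
Lemma big_rate eta : 0 < eta -> exists C, exists n0, forall N, (n0 <= N)%N ->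
  N%:R * mu 1 N (modulus_ge eta) <= C.
Proof.
move=> e0; have mB := measurable_modulus_ge eta.
pose G K N := hit Y 1 N (N %/ K.+1) (modulus_ge eta).
have mG K N : measurable (G K N) by exact: mhit.
have h20 : 0 < 2^-1 :> R by rewrite invr_gt0.
have [K /(_ K (leqnn K)) hK] : exists n, forall K, (n <= K)%N -> pr P (io (G K)) < 2^-1.
  apply: (@pr_empty_io_small _ _ _ P (fun K => io (G K))) => // [K|w hw]; first exact: measurable_io.
  have [_ /(_ w) Y0 /(_ w)[/(_ 0 (lexx _)) /right_cvgP h _] _ _] := levyY.
  have e30 : 0 < eta / 3 by rewrite divr_gt0.
  have [r r0 hr] := h _ e30; rewrite Y0 add0r in hr.
  have near0 u : 0 <= u -> u < r -> `|Y u w| <= eta / 3.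
    move=> u0 ur; have [->|un0] := eqVneq u 0; first by rewrite Y0 normr0 ltW.
    by have := hr u; rewrite subr0; apply => //; rewrite lt_neqAle eq_sym un0.
  have [n hn] := natr_inv_small r0.
  have [K /= nK GK] := hw n I; have [_ Kr] := hn K.+1 (leqW nK).
  have [N /= N0 [i iN]] := GK 1%N I.
  have Np : 0 < N%:R :> R by rewrite ltr0n.
  have iK : i.+1%:R / N%:R <= K.+1%:R^-1 :> R.
    rewrite ler_pdivrMr// mulrC ler_pdivlMr// -natrM ler_nat.
    by apply: leq_trans (leq_trunc_div N K.+1); rewrite leq_mul2r iN orbT.
  rewrite /modulus_ge /= /increment /cell_inc /rescaled_path !mulr1 => hi.
  have h1 := near0 (i.+1%:R / N%:R) (divr_ge0 _ (ltW Np)) (le_lt_trans iK Kr).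
  have i0 : i%:R / N%:R <= i.+1%:R / N%:R :> R by rewrite ler_pM2r ?invr_gt0// ler_nat.
  have h2 := near0 (i%:R / N%:R) (divr_ge0 _ (ltW Np)) (le_lt_trans i0 (le_lt_trans iK Kr)).
  have := le_trans hi (ler_normB _ _).
  by move: (h1 (ler0n _ _)) (h2 (ler0n _ _)) e0; forget; lra.
have [n0 hn0] := pr_io_small (mG K) hK.
exists (2 * K.+1%:R), (maxn K.+1 n0) => N; rewrite geq_max => /andP[KN /hn0].
have N0 : (0 < N)%N by exact: leq_trans KN.
rewrite /G (pr_hit levyY)// -/(mu 1 N _).
have m01 : 0 <= mu 1 N (modulus_ge eta) <= 1 by rewrite pr_ge0/= cell_law_le1.
have := bernoulli_upper (N %/ K.+1) m01; set n := (N %/ K.+1)%N.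
have n0' : (0 < n)%N by rewrite divn_gt0.
(* Rounding the quotient down loses at most a factor 2, as [n >= 1]. *)
have Nn : N%:R <= K.+1%:R * (2 * n%:R) :> R.
  rewrite -natrM -natrM ler_nat; apply: ltnW; apply: leq_trans (ltn_ceil N (ltn0Sn K)) _.
  by rewrite -/n mulnC leq_mul2l /= mul2n -addnn -addn1 leq_add2l.
move: m01; move: (mu _ _ _) ((1 - _) ^+ n) => p q /andP[p00 p1] hq q1.
have nhalf : n%:R * p <= 1.
  rewrite leNgt; apply/negP => np.
  have : 2^-1 * (1 + n%:R * p) < q * (1 + n%:R * p).
    rewrite ltr_pM2r; first by move: q1; forget; lra.
    by move: np; forget; lra.
  move: hq np; move: (n%:R * p) => z; forget => hq np h.
  by have := lt_le_trans h hq; rewrite ltNge => /negP; apply; move: np; lra.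
apply: le_trans (ler_wpM2r p00 Nn) _.
have -> : K.+1%:R * (2 * n%:R) * p = 2 * K.+1%:R * (n%:R * p) by ring.
by rewrite -[leRHS]mulr1 ler_wpM2l// mulr_ge0.
Qed.

(** Compactness of [[eta, M]]: a window of radius [e] at [v] contains the windows of radius below
    [e / 2] at all levels within [e / 2] of [v]. One [m] serves both as precision and as threshold
    for [N]. *)
Lemma uniform_level_rate eta M kappa : 0 < eta -> 0 < kappa ->
  exists m, forall u N, eta <= u <= M -> (m <= N)%N ->
    N%:R * mu 1 N (modulus_near u m.+1%:R^-1) <= kappa.
Proof.
move=> e0 k0; have /compact_near_coveringP := @segment_compact R eta M.
move=> /(_ nat \oo%classic (fun m u => forall N, (m <= N)%N ->
  N%:R * mu 1 N (modulus_near u m.+1%:R^-1) <= kappa)) [].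
  move=> v; rewrite /= in_itv/= => /andP[ev vM].
  have [e ee [n0 hn0]] := level_rate (lt_le_trans e0 ev) k0.
  have e20 : 0 < e / 2 by rewrite divr_gt0.
  have [n1 hn1] := natr_inv_small e20.
  exists (ball v (e / 2), [set m | (maxn n0 n1 <= m)%N]).
    split; first exact: nbhsx_ballx.
    by exists (maxn n0 n1).
  move=> [u m] /= []; rewrite -ball_normE /= => uv; rewrite geq_max => /andP[nm n1m] N mN.
  have [_ me] := hn1 m.+1 (leqW n1m).
  apply: le_trans (hn0 N (leq_trans nm mN)); rewrite ler_wpM2l//.
  apply: pr_le; [exact: mlev _ (measurable_modulus_near _ _)..|].
  move=> w; rewrite /preimage /modulus_near /=; move: (`|Y _ w|) me uv => z.
  move: (m.+1%:R^-1); forget => q ?; rewrite ltr_norml => /andP[? ?] /andP[? ?].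
  by apply/andP; split; lra.
move=> m _ hm; exists m => u N uM mN; exact: (hm m (leqnn m)).
Qed.

End StableRates.

Lemma dist_le_length (R : realType) (p l s t : R) :
  p < s -> s <= p + l -> p < t -> t <= p + l -> `|s - t| <= l.
Proof. by move=> ? ? ? ?; rewrite ler_norml; apply/andP; split; lra. Qed.

(** * Near ties between grid increments, and almost sure absence of ties *)

Section StableTies.
Context {R : realType} {d : measure_display} {Omega : measurableType d}.
Variables (P : probability Omega R) (Y : R -> Omega -> R) (alpha : R).
Hypothesis levyY : levy_process P Y.
Hypothesis alpha0 : 0 < alpha.
Hypothesis stableY : stable_levy alpha P Y.
Implicit Types (e kappa eta M : R) (N i j k n m K : nat) (w : Omega).

Lemma pr_bigsetU (r : seq nat) (A : nat -> set Omega) :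
  (forall i, measurable (A i)) ->
  pr P (\big[setU/set0]_(i <- r) A i) <= \sum_(i <- r) pr P (A i).
Proof.
move=> mA; elim: r => [|i r ih]; first by rewrite !big_nil pr0.
rewrite !big_cons; apply: le_trans (pr_setU _ (mA i) _) _; first exact: bigsetU_measurable.
by rewrite lerD2l.
Qed.

Lemma pr_sum_disjoint K (A : nat -> set Omega) (B : set Omega) :
  (forall k, measurable (A k)) -> measurable B -> (forall k, A k `<=` B) ->
  (forall k l w, A k w -> A l w -> k = l) -> \sum_(k < K) pr P (A k) <= pr P B.
Proof.
move=> mA mB AB disj.
have mU : measurable (\big[setU/set0]_(k < K) A k) by exact: bigsetU_measurable.
have -> : \sum_(k < K) pr P (A k) = pr P (\big[setU/set0]_(k < K) A k).
  have mA' (k : 'I_K) : measurable ((A \o val) k) by exact: mA.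
  have tA : trivIset setT (A \o @nat_of_ord K).
    by move=> k l _ _ [w [/= Ak Al]]; apply/val_inj; exact: disj Ak Al.
  apply: EFin_inj; rewrite -sumEFin -prE// (measure_bigsetU_ord P xpredT mA' tA).
  by apply: eq_bigr => k _; rewrite -(prE P (mA k)).
apply: pr_le => //; elim/big_ind: _ => // A1 A2 h1 h2 w [/h1|/h2]//.
Qed.

Definition ties eta M := [set w | exists s t,
  [/\ 0 < s <= 1, 0 < t <= 1, s != t,
      `|jump (rescaled_path Y 1 w) s| = `|jump (rescaled_path Y 1 w) t| &
      eta <= `|jump (rescaled_path Y 1 w) s| <= M]].

Let mu := cell_law P Y 1.

Definition bin eta e k := [set y : R | eta <= `|y| /\ k%:R * e <= `|y| < k.+1%:R * e].

Lemma measurable_bin eta e k : measurable (bin eta e k).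
Proof.
rewrite (_ : bin eta e k = modulus_ge eta `&`
  [set y : R | `|y| \in `[k%:R * e, k.+1%:R * e[]).
  by apply: measurableI; [exact: measurable_modulus_ge|exact: measurable_modulus].
by apply/seteqP; split=> y /=; rewrite in_itv.
Qed.

(** The strip of the first increment fixes a deterministic level [k * e] to which the second is
    compared, so the event is a product and independence applies. The radius [3 * e] covers the
    strip width and the discretization errors. *)
Definition near_tie eta e K N i j k := if i == j then set0 else
  [set w | bin eta e k (increment Y 1 N i w)] `&`
  [set w | modulus_near (k%:R * e) (3 * e) (increment Y 1 N j w)].

Definition near_ties eta e K N :=
  \big[setU/set0]_(i <- iota 0 N) \big[setU/set0]_(j <- iota 0 N)
    \big[setU/set0]_(k <- iota 0 K) near_tie eta e K N i j k.

Lemma measurable_near_tie eta e K N i j k : measurable (near_tie eta e K N i j k).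
Proof.
rewrite /near_tie; case: ifP => // _; apply: measurableI.
  exact: (measurable_increment levyY _ _ _ (measurable_bin _ _ _)).
exact: (measurable_increment levyY _ _ _ (measurable_modulus_near _ _)).
Qed.

Lemma measurable_near_ties eta e K N : measurable (near_ties eta e K N).
Proof.
by do 3 (apply: bigsetU_measurable => ? _); exact: measurable_near_tie.
Qed.

Lemma near_tiesP eta e K N w i j k : (i < N)%N -> (j < N)%N -> (k < K)%N ->
  near_tie eta e K N i j k w -> near_ties eta e K N w.
Proof.
move=> iN jN kK h; rewrite /near_ties -bigcup_seq; exists i; first by rewrite /= mem_iota.
rewrite -bigcup_seq; exists j; first by rewrite /= mem_iota.
by rewrite -bigcup_seq; exists k; rewrite //= mem_iota.
Qed.

(** Union bound over pairs and strips: one factor [N] turns the mass near each level into a rate at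
    most [kappa], the other multiplies the total mass of the disjoint strips. *)
Lemma pr_near_ties eta e K N kappa : (0 < N)%N -> 0 <= kappa ->
  (forall k, (k < K)%N -> bin eta e k !=set0 ->
    N%:R * mu N (modulus_near (k%:R * e) (3 * e)) <= kappa) -> 0 < e ->
  pr P (near_ties eta e K N) <= kappa * (N%:R * mu N (modulus_ge eta)).
Proof.
move=> N0 k0 hk e0.
pose c k := mu N (bin eta e k) * mu N (modulus_near (k%:R * e) (3 * e)).
have tie_le i j k : pr P (near_tie eta e K N i j k) <= c k.
  rewrite /near_tie; case: eqP => [_|/eqP ij].
    by rewrite pr0 mulr_ge0// pr_ge0.
  by rewrite (pr_pair levyY _ N0 ij (measurable_bin _ _ _) (measurable_modulus_near _ _)).
apply: (@le_trans _ _ (\sum_(i <- iota 0 N) \sum_(j <- iota 0 N) \sum_(k <- iota 0 K) c k)).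
  apply: le_trans (pr_bigsetU _ _) _.
    by move=> i; do 2 (apply: bigsetU_measurable => ? _); exact: measurable_near_tie.
  apply: ler_sum => i _; apply: le_trans (pr_bigsetU _ _) _.
    by move=> j; apply: bigsetU_measurable => ? _; exact: measurable_near_tie.
  apply: ler_sum => j _; apply: le_trans (pr_bigsetU _ _) _.
    by move=> k; exact: measurable_near_tie.
  by apply: ler_sum.
have sumc (x : R) : \sum_(i <- iota 0 N) x = N%:R * x.
  by rewrite big_const_seq count_predT size_iota iter_addr_0 mulr_natl.
set S := \sum_(k <- iota 0 K) c k.
rewrite (sumc (\sum_(j <- iota 0 N) S)) (sumc S) {}/S.
have bins : \sum_(k < K) mu N (bin eta e k) <= mu N (modulus_ge eta).
  apply: (@pr_sum_disjoint K (fun k => Y (1 / N%:R) @^-1` bin eta e k)).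
  - by move=> k; exact: (measurable_level levyY _ (measurable_bin _ _ _)).
  - exact: (measurable_level levyY _ (measurable_modulus_ge _)).
  - by move=> k w [].
  move=> k l w [_ /andP[h1 h2]] [_ /andP[h3 h4]].
  have : k%:R * e < l.+1%:R * e by exact: le_lt_trans h4.
  have : l%:R * e < k.+1%:R * e by exact: le_lt_trans h2.
  rewrite !ltr_pM2r// !ltr_nat !ltnS => lk kl; apply/eqP.
  by rewrite eqn_leq lk kl.
(* The rate is assumed only at levels of nonempty strips, which are bounded away from 0; an empty
   strip contributes nothing. *)
have cbound k : (k < K)%N -> N%:R * c k <= kappa * mu N (bin eta e k).
  move=> kK; have [[y hy]|nb] := pselect (bin eta e k !=set0).
    rewrite /c mulrCA [kappa * _]mulrC ler_wpM2l ?pr_ge0//.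
    by apply: hk => //; exists y.
  have b0 : mu N (bin eta e k) = 0.
    rewrite /mu /cell_law (_ : _ @^-1` _ = set0) ?pr0//.
    by apply/seteqP; split=> // w hw; apply: nb; exists (Y (1 / N%:R) w).
  by rewrite /c b0 mul0r !mulr0.
rewrite [kappa * _]mulrCA; apply: ler_wpM2l; first by [].
apply: le_trans (ler_wpM2l k0 bins).
have -> : iota 0 K = index_iota 0 K by rewrite /index_iota subn0.
rewrite big_mkord !mulr_sumr.
by apply: ler_sum => k _; exact: cbound.
Qed.

(** On fine grids the two tied jumps fall in different cells, and the increments there approach
    them. Lowering the threshold to [eta / 2] leaves room for the approximation error. *)
Lemma ties_near_ties eta M e K : 0 < eta -> 0 < e -> e <= eta / 4 ->
  M + e <= K%:R * e -> ties eta M `<=` ev (near_ties (eta / 2) e K).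
Proof.
move=> eta0 e0 ee MK w [s [t [s01 t01 st jst /andP[js1 js2]]]].
have cx : cadlag01 (rescaled_path Y 1 w) := path_cadlag levyY w ltr01.
have e40 : 0 < e / 4 by rewrite divr_gt0.
have [n1 h1] := jump_cell_inc cx s01 e40.
have [n2 h2] := jump_cell_inc cx t01 e40.
have dst : 0 < `|s - t| by rewrite normr_gt0 subr_eq0.
have [n3 h3] := natr_inv_small dst.
exists (maxn n1 (maxn n2 n3)) => // N /=.
rewrite !geq_max => /and3P[/h1 {}h1 /h2 {}h2 /h3 [N0 Nst]].
have [i iN /andP[is1 is2]] := cell_of N0 s01.
have [j jN /andP[jt1 jt2]] := cell_of N0 t01.
have {}h1 := h1 i iN ltac:(by rewrite is1 is2).
have {}h2 := h2 j jN ltac:(by rewrite jt1 jt2).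
have ij : i != j.
  apply/eqP => ij; rewrite -ij in jt1 jt2; move: Nst; rewrite ltNge => /negP; apply.
  rewrite (cell_length i N0) in is2 jt2; exact: dist_le_length is1 is2 jt1 jt2.
have k1 := le_trans (ler_dist_dist _ _) h1.
have k2 := le_trans (ler_dist_dist _ _) h2; rewrite -jst in k2.
pose a := `|increment Y 1 N i w|.
have a0 : 0 <= a / e := divr_ge0 (normr_ge0 _) (ltW e0).
pose k := Num.truncn (a / e).
have /andP[ka1 ka2] := truncn_itv a0.
rewrite -/k in ka1 ka2; rewrite ler_pdivlMr// in ka1; rewrite ltr_pdivrMr// in ka2.
rewrite -/(increment Y 1 N i w) -/(increment Y 1 N j w) in k1 k2.
have kK : (k < K)%N.
  rewrite -(ltr_nat R) -(ltr_pM2r e0); apply: le_lt_trans ka1 _.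
  apply: lt_le_trans MK; move: k1 js2 e0; rewrite /a ler_norml => /andP[_].
  by move=> ? ? ?; lra.
apply: (@near_tiesP _ _ _ _ _ i j k) => //; rewrite /near_tie (negbTE ij); split=> /=.
  split; last by rewrite -/a ka1.
  by move: k1 js1 ee eta0; rewrite ler_norml => /andP[+ _]; move=> ? ? ? ?; lra.
rewrite /modulus_near /= -/a in k1 *; rewrite -natr1 mulrDl mul1r in ka2.
move: k1 k2; rewrite !ler_norml => /andP[? ?] /andP[? ?]; apply/andP.
by move: ka1 ka2; move: (k%:R * e) => z ? ?; split; lra.
Qed.

(** The bound [kappa * C] holds for every [kappa] with [C] fixed beforehand, since [C] depends on
    [eta] only. *)
Lemma ties_negligible eta M : 0 < eta -> eta <= M -> P.-negligible (ties eta M).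
Proof.
move=> eta0 etaM; have eta20 : 0 < eta / 2 by rewrite divr_gt0.
have [C [n0 hC]] := big_rate levyY eta20.
have small kappa : 0 < kappa -> exists2 A, measurable A /\ ties eta M `<=` A &
    pr P A <= kappa * C.
  move=> k0; have eta80 : 0 < eta / 8 by rewrite divr_gt0.
  have [m hm] := uniform_level_rate levyY alpha0 stableY (2 * M) eta80 k0.
  (* The second bound fits the radius [3 * e] into the window of [uniform_level_rate]; the first
     places every nonempty strip used at a level between [eta / 8] and [2 * M]. *)
  pose e := Num.min (eta / 8) (m.+1%:R^-1 / 3).
  have e0 : 0 < e by rewrite lt_min eta80 divr_gt0// invr_gt0.
  have [e1 e2] : e <= eta / 8 /\ e <= m.+1%:R^-1 / 3 by rewrite /e !ge_min !lexx orbT.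
  pose K := (Num.truncn ((M + e) / e)).+1.
  have Me0 : 0 <= (M + e) / e.
    by rewrite divr_ge0 ?(ltW e0)// addr_ge0 ?(ltW e0)// (le_trans (ltW eta0)).
  have /andP[K1 K2] := truncn_itv Me0; rewrite -/K in K2.
  rewrite ler_pdivlMr// in K1; rewrite ltr_pdivrMr// in K2.
  exists (ev (near_ties (eta / 2) e K)).
    split; first by apply: measurable_ev => N; exact: measurable_near_ties.
    by apply: ties_near_ties (ltW K2) => //; move: e1 eta0; lra.
  apply: pr_ev_le => [N|n]; first exact: measurable_near_ties.
  exists (maxn n (maxn 1 (maxn n0 m))); first exact: leq_maxl.
  set N := maxn _ _.
  have : [&& (0 < N)%N, (n0 <= N)%N & (m <= N)%N].
    by rewrite /N !leq_max !leqnn !orbT.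
  move=> /and3P[N0 n0N mN].
  have kC := ler_wpM2l (ltW k0) (hC N n0N).
  apply: le_trans kC; apply: pr_near_ties => //; first exact: ltW.
  move=> k kK [y [yeta /andP[y1 y2]]].
  have kM : k%:R * e <= 2 * M.
    have h : k%:R * e <= (Num.truncn ((M + e) / e))%:R * e.
      by rewrite ler_pM2r// ler_nat -ltnS.
    apply: le_trans h _; apply: le_trans K1 _.
    by move: e1 eta0 etaM; lra.
  have keta : eta / 8 <= k%:R * e.
    by move: y2 yeta e1 eta0; rewrite -natr1 mulrDl mul1r; move: (k%:R * e) => z; lra.
  apply: le_trans (hm (k%:R * e) N _ mN); last by rewrite keta.
  rewrite ler_wpM2l//; apply: pr_le.
  - exact: (measurable_level levyY _ (measurable_modulus_near _ _)).
  - exact: (measurable_level levyY _ (measurable_modulus_near _ _)).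
  move=> w; rewrite /preimage /modulus_near /= => /andP[h1 h2].
  by apply/andP; move: h1 h2 e2; move: (k%:R * e) (m.+1%:R^-1) (`|_|) => ? ? ?; split; lra.
have /choice[A hA] : forall n : nat, exists A, [/\ measurable A, ties eta M `<=` A &
    pr P A <= n.+1%:R^-1 * C].
  by move=> n; have [|A [mA sA] pA] := small n.+1%:R^-1; [rewrite invr_gt0|exists A].
exists (\bigcap_n A n); split.
- by apply: bigcapT_measurable => n; case: (hA n).
- have mI : measurable (\bigcap_n A n) by apply: bigcapT_measurable => n; case: (hA n).
  rewrite prE//; congr (_%:E); apply: le_anti; rewrite pr_ge0 andbT.
  have le n : pr P (\bigcap_n A n) <= n.+1%:R^-1 * C.
    have [mA _ pA] := hA n; apply: le_trans pA; apply: pr_le => //.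
    by move=> w; apply.
  have C0 : 0 <= C by have := le_trans (pr_ge0 P _) (le 0%N); rewrite invr1 mul1r.
  apply/ler_addgt0Pr => e e0; rewrite add0r.
  have eC : 0 < e / (C + 1) by rewrite divr_gt0// ltr_wpDl.
  have [n hn] := natr_inv_small eC; have [_ h] := hn n.+1 (leqnSn n).
  apply: le_trans (le n) _; apply: le_trans (ler_wpM2r C0 (ltW h)) _.
  by rewrite mulrAC ler_pdivrMr ?ltr_wpDl// ler_wpM2l ?(ltW e0)// lerDl.
- by move=> w tw n _; have [_ h _] := hA n; exact: h.
Qed.

(** Every nonzero modulus lies in [[1 / (n + 1), n + 1]] for some [n], so countably many negligible
    events suffice. *)
Lemma stable_no_ties : P.-negligible [set w | ~ no_ties (fun tau => Y tau w)].
Proof.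
have neg (n : nat) : P.-negligible (ties n.+1%:R^-1 n.+1%:R).
  apply: ties_negligible; first by rewrite invr_gt0.
  by apply: (@le_trans _ _ 1); rewrite ?invf_le1 ?ler1n.
apply: negligibleS (negligible_bigcup neg) => w nt; apply: contrapT => hn; apply: nt.
move=> s t s01 t01 jst js0; apply: contrapT => st; apply: hn.
have E : rescaled_path Y 1 w = (fun tau => Y tau w).
  by apply/funext => u; rewrite /rescaled_path mulr1.
have pos u : 0 <= u <= 1 -> jump (fun tau => Y tau w) u != 0 -> 0 < u <= 1.
  by move=> /andP[u0 ->] ju; rewrite andbT ltNge; apply/negP => u0'; rewrite jump0 ?eqxx in ju.
have jt0 : jump (fun tau => Y tau w) t != 0 by rewrite -normr_gt0 -jst normr_gt0.
have c0 : 0 < `|jump (fun tau => Y tau w) s| by rewrite normr_gt0.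
move: c0; set c := `|jump _ s| => c0.
exists (maxn (Num.truncn c) (Num.truncn c^-1)) => //.
exists s, t; rewrite E; split; [exact: pos|exact: pos|exact/eqP|by []|].
apply/andP; split.
  rewrite -/c -[leRHS]invrK lef_pV2 ?posrE ?invr_gt0//.
  by apply: ltW; apply: lt_le_trans (truncnS_gt _) _; rewrite ler_nat ltnS leq_maxr.
by apply: ltW; apply: lt_le_trans (truncnS_gt _) _; rewrite ler_nat ltnS leq_maxl.
Qed.

End StableTies.

(** * Convergence of the three trimmed processes *)

Unset Implicit Arguments.
Set Strict Implicit.

Theorem theorem3p1
  (R : realType) (at0 : bool)
  (d : measure_display) (Omega : measurableType d) (P : probability Omega R)
  (X : R -> Omega -> R) (gammaX : R) (PiX : {measure set R -> \bar R})
  (d' : measure_display) (Omega' : measurableType d') (P' : probability Omega' R)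
  (Y : R -> Omega' -> R) (PiY : {measure set R -> \bar R})
  (alpha c : R) (a b : R -> R) :
  levy_process P X -> has_triplet P X gammaX 0 PiX ->
  levy_process P' Y -> has_triplet P' Y 0 0 PiY ->
  0 < alpha < 2 -> stable_levy alpha P' Y ->
  0 < c -> (forall x : R, 0 < x -> PiY (~` `[- x, x]%classic) = (c * x `^ (- alpha))%:E) ->
  (forall t : R, 0 < t -> 0 < b t) ->
  cvg_dist at0 P (fun t w => (X t w - a t) / b t) P' (Y 1) ->
  cvg_dist_J1 at0 P (fun t w tau => (X (tau * t) w - tau * a t) / b t) P'
    (fun w tau => Y tau w) ->
  [/\ (* (i) *)
      (tail_pos PiX x @[x --> 0^'+] --> +oo%E) ->
      forall r : nat, (0 < r)%N ->
        cvg_dist_J1 at0 P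
          (fun t w tau => (Rtrim r (fun u => X (u * t) w) tau - tau * a t) / b t) P'
          (fun w => Rtrim r (fun tau => Y tau w)),
      (* (ii) *)
      (tail_pos PiX x @[x --> 0^'+] --> +oo%E) ->
      (tail_neg PiX x @[x --> 0^'+] --> +oo%E) ->
      forall r s : nat,
        cvg_dist_J1 at0 P
          (fun t w tau => (Trim_rs r s (fun u => X (u * t) w) tau - tau * a t) / b t) P'
          (fun w => Trim_rs r s (fun tau => Y tau w)) &
      (* (iii) *)
      (tail PiX x @[x --> 0^'+] --> +oo%E) ->
      forall r : nat, (0 < r)%N ->
        cvg_dist_J1 at0 P
          (fun t w tau => (Mtrim r (fun u => X (u * t) w) tau - tau * a t) / b t) P'
          (fun w => Mtrim r (fun tau => Y tau w))].
Proof.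
move=> levyX _ levyY _ /andP[alpha0 _] stableY _ _ b0 _ cvgZ.
have [_ _ cX _ _] := levyX; have [mY _ cY _ _] := levyY.
have cadY w : cadlag01 (fun tau => Y tau w).
  rewrite (_ : (fun tau => Y tau w) = (fun tau => Y (tau * 1) w)).
    exact: (cadlag_pos_cadlag01 ltr01 (cY w)).
  by apply/funext => tau; rewrite mulr1.
have FF := time_lim_filter (R := R) at0.
have cadZ : \forall t \near @time_lim R at0, forall w,
    cadlag01 (fun tau => (X (tau * t) w - tau * a t) / b t).
  near=> t => w; apply: rescaled_cadlag => //.
  by near: t; exact: near_time_lim_gt0.
have nt := stable_no_ties levyY alpha0 stableY.
have mapping T := cvg_dist_J1_mapping (T := T) cvgZ cadZ cadY (fun s _ => mY s).
have rescale T := @cvg_dist_J1_rescaled R at0 d Omega P X d' Omega' P' Y a b cX b0 T.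
split.
- move=> _ r _; apply: (rescale (Rtrim r)).
  + by move=> x; apply: iter_cadlag => z; exact: Rtrim1_cadlag.
  + move=> a' b' x y b'0; apply: affine_iter; first exact: Rtrim1_cadlag.
    exact: affine_Rtrim1.
  + apply: mapping nt => [x|u x].
      by apply: iter_cadlag => z; exact: Rtrim1_cadlag.
    apply: iter_J1_cvg; [exact: Rtrim1_cadlag|exact: Rtrim1_no_ties|exact: Rtrim1_J1_cvg].
- move=> _ _ r s; apply: (rescale (Trim_rs r s)).
  + exact: Trim_rs_cadlag.
  + by move=> a' b' x y b'0; exact: affine_Trim_rs.
  (* Here the operator is continuous at every cadlag path, so [g] composed with it is itself an
     admissible test functional. *)
  + move=> g cg [M hM]; apply: (cvgZ (fun x => g (Trim_rs r s x))); last by exists M.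
    move=> u x cu cx ux; apply: cg; [|exact: Trim_rs_cadlag|exact: Trim_rs_J1_cvg].
    by move=> n; exact: Trim_rs_cadlag.
- move=> _ r _; apply: (rescale (Mtrim r)).
  + by move=> x; apply: iter_cadlag => z; exact: Mtrim1_cadlag.
  + move=> a' b' x y b'0; apply: affine_iter; first exact: Mtrim1_cadlag.
    exact: affine_Mtrim1.
  + apply: mapping nt => [x|u x].
      by apply: iter_cadlag => z; exact: Mtrim1_cadlag.
    apply: iter_J1_cvg; [exact: Mtrim1_cadlag|exact: Mtrim1_no_ties|exact: Mtrim1_J1_cvg].
Unshelve. all: by end_near. Qed.
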